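(* Suppose $f$ satisfies the structure conditions (i)–(vi) below in $K_n^+$ and in addition \[ \sum_i f_i(\lambda)>\sum_i\lambda_i^2 f_i(\lambda)\quad\text{for all }\lambda\in K_n^+\text{ with }0<f(\lambda)<1. \] Let $\Omega\subset\mathbb{R}^n$ be a bounded smooth domain and $\sigma\in(0,1)$. Then: (a) there is at most one admissible $u\in C^\infty(\Omega)\cap C^1(\overline\Omega)$ with $f(\kappa[\mathrm{graph}\,u])=\sigma$ in $\Omega$ and $u=0$ on $\partial\Omega$ (equivalently, at most one complete strictly locally convex hypersurface with $f(\kappa)=\sigma$ and asymptotic boundary $\partial\Omega\times\{0\}$); (b) for each $\epsilon>0$ there is at most one admissible $u\in C^\infty(\overline\Omega)$ with $f(\kappa[\mathrm{graph}\,u])=\sigma$ in $\Omega$ and $u=\epsilon$ on $\partial\Omega$. In particular these uniqueness statements hold for $f=(H_n/H_l)^{1/(n-l)}$ with $l=n-1$ or $l=n-2$.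
   Context: Half-space model $\mathbb{H}^{n+1}=\{(x,x_{n+1}):x_{n+1}>0\}$, metric $\sum dx_i^2/x_{n+1}^2$. For a graph $x_{n+1}=u(x)$, $u>0$, oriented upward, the hyperbolic principal curvatures $\kappa[\mathrm{graph}\,u]$ are the eigenvalues of $h_{ij}=\frac{\delta_{ij}+u_iu_j+uu_{ij}}{u^2\sqrt{1+|Du|^2}}$ relative to $g_{ij}=\frac{\delta_{ij}+u_iu_j}{u^2}$. Admissible: $u>0$ and $\{\delta_{ij}+u_iu_j+uu_{ij}\}>0$. $K_n^+=\{\lambda:\lambda_i>0\}$; $f_i=\partial f/\partial\lambda_i$. Structure conditions on smooth symmetric $f$ on $K_n^+$: (i) $f_i>0$; (ii) concave; (iii) $f>0$ in $K_n^+$, $f=0$ on $\partial K_n^+$; (iv) $f(1,\dots,1)=1$; (v) homogeneous of degree one; (vi) there are $\varepsilon_0,\delta_0>0$ with $\lim_{R\to\infty}f(\lambda_1,\dots,\lambda_{n-1},\lambda_n+R)\ge1+\varepsilon_0$ uniformly on $B_{\delta_0}(1,\dots,1)$. $H_l$ is the normalized $l$-th elementary symmetric polynomial ($H_0=1$). *)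

(* Defs.v *)
From HB Require Import structures.
From mathcomp Require Import all_boot all_order all_algebra all_fingroup.
From mathcomp Require Import all_classical all_reals all_analysis.
Set Implicit Arguments. Unset Strict Implicit. Unset Printing Implicit Defensive.
Import Order.TTheory GRing.Theory Num.Theory.
Import numFieldNormedType.Exports.
Local Open Scope classical_set_scope.
Local Open Scope ring_scope.

Section Defs.
Variables (R : realType) (n : nat).
Notation vec := 'rV[R]_n.

Definition evec (i : 'I_n) : vec := delta_mx 0 i.

Definition partial (u : vec -> R) (i : 'I_n) : vec -> R :=
  fun x => 'D_(evec i) u x.

Fixpoint iterD (ds : seq 'I_n) (u : vec -> R) : vec -> R :=
  match ds with
  | [::] => u
  | i :: ds' => partial (iterD ds' u) i
  end.

Definition smooth_on (A : set vec) (u : vec -> R) : Prop :=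
  open A /\
  forall ds : seq 'I_n,
    {within A, continuous (iterD ds u)} /\
    forall i x, A x -> derivable (iterD ds u) x (evec i).

(** u in C^1(closure A) (together with smooth_on A u): u and its first
    partial derivatives extend continuously to the closure of A *)
Definition C1_closure (A : set vec) (u : vec -> R) : Prop :=
  {within closure A, continuous u} /\
  forall i : 'I_n, exists g : vec -> R,
    {within closure A, continuous g} /\ forall x, A x -> partial u i x = g x.

(** u in C^infinity(closure A) (together with smooth_on A u) *)
Definition Cinf_closure (A : set vec) (u : vec -> R) : Prop :=
  {within closure A, continuous u} /\
  forall ds : seq 'I_n, exists g : vec -> R,
    {within closure A, continuous g} /\ forall x, A x -> iterD ds u x = g x.

Definition bounded_smooth_domain (O : set vec) : Prop :=
  bounded_set O /\ open O /\ connected O /\ O !=set0 /\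
  forall p, (closure O `\` O) p ->
    exists (U : set vec) (rho : vec -> R),
      open U /\ U p /\ smooth_on U rho /\
      (forall x, U x -> (O x <-> rho x < 0)) /\
      (forall x, U x -> exists i, partial rho i x != 0).

Definition Kpos : set vec := [set l | forall i, 0 < l ord0 i].

Definition Kbd : set vec :=
  [set l | (forall i, 0 <= l ord0 i) /\ exists i, l ord0 i = 0].

Definition posdef (A : 'M[R]_n) : Prop :=
  forall v : vec, v != 0 -> 0 < (v *m A *m v^T) ord0 ord0.

Definition grad (u : vec -> R) (x : vec) : vec := \row_i partial u i x.
Definition hess (u : vec -> R) (x : vec) : 'M[R]_n :=
  \matrix_(i, j) partial (partial u j) i x.

Definition adm_matrix (u : vec -> R) (x : vec) : 'M[R]_n :=
  1%:M + (grad u x)^T *m grad u x + u x *: hess u x.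

Definition gmat (u : vec -> R) (x : vec) : 'M[R]_n :=
  (u x ^+ 2)^-1 *: (1%:M + (grad u x)^T *m grad u x).

Definition hmat (u : vec -> R) (x : vec) : 'M[R]_n :=
  (u x ^+ 2 * Num.sqrt (1 + \sum_i (partial u i x) ^+ 2))^-1 *: adm_matrix u x.

(** l lists (with multiplicity) the hyperbolic principal curvatures of
    graph u at x: the eigenvalues of h relative to g, i.e. of g^{-1} h *)
Definition princ_curv (u : vec -> R) (x : vec) (l : vec) : Prop :=
  char_poly (invmx (gmat u x) *m hmat u x) = \prod_i ('X - (l ord0 i)%:P).

Definition admissible (O : set vec) (u : vec -> R) : Prop :=
  forall x, O x -> 0 < u x /\ posdef (adm_matrix u x).

Definition curv_eq (f : vec -> R) (O : set vec) (u : vec -> R) (s : R) : Prop :=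
  forall x, O x -> exists l, princ_curv u x l /\ f l = s.

Definition symmetric_on_K (f : vec -> R) : Prop :=
  forall (p : 'S_n) l, Kpos l -> f (\row_i l ord0 (p i)) = f l.

Definition concave_on_K (f : vec -> R) : Prop :=
  forall l m (t : R), Kpos l -> Kpos m -> 0 <= t <= 1 ->
    t * f l + (1 - t) * f m <= f (t *: l + (1 - t) *: m).

Definition one_vec : vec := const_mx 1.

Definition cond_vi (f : vec -> R) : Prop :=
  exists eps0 delta0 : R, 0 < eps0 /\ 0 < delta0 /\
    forall (i : 'I_n), (i : nat) = n.-1 ->
    forall e : R, 0 < e -> exists R0 : R,
      forall l : vec, \sum_j (l ord0 j - 1) ^+ 2 < delta0 ^+ 2 ->
      forall r : R, R0 <= r -> 1 + eps0 - e <= f (l + r *: evec i).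

Definition structure_conditions (f : vec -> R) : Prop :=
  smooth_on Kpos f /\ symmetric_on_K f /\
  (* (i) *) (forall l i, Kpos l -> 0 < partial f i l) /\
  (* (ii) *) concave_on_K f /\
  (* (iii) *) (forall l, Kpos l -> 0 < f l) /\
              (forall l0, Kbd l0 -> f x @[x --> within Kpos (nbhs l0)] --> 0) /\
  (* (iv) *) f one_vec = 1 /\
  (* (v) *) (forall (t : R) l, 0 < t -> Kpos l -> f (t *: l) = t * f l) /\
  (* (vi) *) cond_vi f.

Definition extra_condition (f : vec -> R) : Prop :=
  forall l, Kpos l -> 0 < f l < 1 ->
    \sum_i l ord0 i ^+ 2 * partial f i l < \sum_i partial f i l.

Definition uniqueness_a (f : vec -> R) (O : set vec) (s : R) : Prop :=
  forall u1 u2 : vec -> R,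
    (smooth_on O u1 /\ C1_closure O u1 /\ admissible O u1 /\ curv_eq f O u1 s /\
       forall x, (closure O `\` O) x -> u1 x = 0) ->
    (smooth_on O u2 /\ C1_closure O u2 /\ admissible O u2 /\ curv_eq f O u2 s /\
       forall x, (closure O `\` O) x -> u2 x = 0) ->
    forall x, O x -> u1 x = u2 x.

Definition uniqueness_b (f : vec -> R) (O : set vec) (s eps : R) : Prop :=
  forall u1 u2 : vec -> R,
    (smooth_on O u1 /\ Cinf_closure O u1 /\ admissible O u1 /\ curv_eq f O u1 s /\
       forall x, (closure O `\` O) x -> u1 x = eps) ->
    (smooth_on O u2 /\ Cinf_closure O u2 /\ admissible O u2 /\ curv_eq f O u2 s /\
       forall x, (closure O `\` O) x -> u2 x = eps) ->
    forall x, O x -> u1 x = u2 x.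

Definition esym (k : nat) (l : vec) : R :=
  \sum_(I : {set 'I_n} | #|I| == k) \prod_(i in I) l ord0 i.
Definition Hnorm (k : nat) (l : vec) : R := esym k l / ('C(n, k))%:R.

Definition Hquot (k : nat) (l : vec) : R :=
  powR (Hnorm n l / Hnorm k l) ((n - k)%:R)^-1.

End Defs.

(* Main.v *)
(** Suppose [u < v] somewhere. Extended by its boundary value, [v] makes
    [|x|^2 + v^2] convex, so the region above graph [v] is hyperbolically
    convex. Take the point of graph [u] below it at maximal distance [d], and
    its unique closest point. The second variation of the distance shows that
    the curvatures of graph [u] there dominate those, [(k + t)/(1 + t k)] with
    [t = tanh d], of the surface parallel to graph [v]. The extra condition
    makes [f] strictly increase along this parallel flow while [f < 1], a
    contradiction. For [eps = 0] the distance tends to [0] at the boundary,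
    because comparison with quadratic test functions forces
    [s^2 (1 + |Du|^2) = 1] there. *)
Require Import Defs.
From HB Require Import structures.
From mathcomp Require Import all_boot all_order all_algebra all_fingroup.
From mathcomp Require Import finmap.
From mathcomp Require Import all_classical all_reals all_analysis.
From mathcomp Require Import ring lra zify.
Import Order.TTheory GRing.Theory Num.Theory.
Local Open Scope classical_set_scope.
Local Open Scope ring_scope.

(** * Simultaneous diagonalization of a symmetric pencil *)

Section LinearAlgebra.
Set Implicit Arguments.
Unset Strict Implicit.
Unset Printing Implicit Defensive.
Variable R : realType.

(** A direct maximum principle for [u - v] is blocked: the equation depends on [u] itself and the
    zeroth-order coefficient of its linearization has no evident sign. Homotheties are hyperbolic
    isometries, but they push one graph over the other only above star-shaped domains. Parallel
    surfaces make sense above every domain; they change the curvatures, and the extra condition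
    controls the direction of this change. The distance to a graph need not be differentiable. The
    second variation is therefore carried out on the two-point function [sphere_gap], which is
    smooth in both points: admissibility makes its second variation positive in the point of graph
    [v], and minimizing over that variable replaces any derivative of the closest point. The
    geometry sees [f] only through [comparison_function]. For the quotients its flow property is
    verified in the principal radii [1 / k]: the map [k -> (k + t)/(1 + t k)] commutes with
    inversion, and [H_n / H_l] becomes the reciprocal of [H_(n-l)], which is of degree one or
    two. *)

Lemma posdef_unitmx n (G : 'M[R]_n) : posdef G -> G \in unitmx.
Proof.
move=> pG; rewrite -row_free_unit -kermx_eq0; apply/negPn/negP => K0.
have /rowV0Pn[v /sub_kermxP vG v0] := K0.
by have := pG v v0; rewrite vG mul0mx mxE ltxx.
Qed.

Lemma posdef_congr n (G P : 'M[R]_n) :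
  P \in unitmx -> posdef G -> posdef (P *m G *m P^T).
Proof.
move=> uP pG v v0; have := pG (v *m P); rewrite trmx_mul !mulmxA; apply.
apply: contraNneq v0 => vP0.
by rewrite -(mulmxK uP v) vP0 mul0mx.
Qed.

(** The pencil [X G - H] is the object on which a congruence acts: its determinant and [\det G] pick
    up the same factor [\det P ^ 2], so the relative characteristic polynomial is a congruence
    invariant. *)
Lemma det_char_poly n (G H : 'M[R]_n) : G \in unitmx ->
  (\det G)%:P * char_poly (invmx G *m H) =
  \det ('X *: map_mx polyC G - map_mx polyC H).
Proof.
move=> uG; rewrite /char_poly /char_poly_mx -det_map_mx -det_mulmx mulmxBr.
rewrite mul_mx_scalar -map_mxM mulmxA mulmxV // mul1mx.
by [].
Qed.

Lemma char_poly_congr n (G H P : 'M[R]_n) : P \in unitmx -> G \in unitmx ->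
  char_poly (invmx (P *m G *m P^T) *m (P *m H *m P^T)) =
  char_poly (invmx G *m H).
Proof.
move=> uP uG.
have u2 : P *m G *m P^T \in unitmx by rewrite !unitmx_mul uP uG unitmx_tr uP.
have d0 (A : 'M[R]_n) : A \in unitmx -> (\det A)%:P != 0.
  by rewrite polyC_eq0 unitmxE unitfE.
apply: (mulfI (d0 _ u2)); rewrite det_char_poly //.
transitivity (\det (map_mx polyC P *m ('X *: map_mx polyC G - map_mx polyC H)
    *m map_mx polyC P^T)).
  rewrite mulmxBr mulmxBl -scalemxAr -scalemxAl !map_mxM.
  by [].
rewrite !det_mulmx -det_char_poly // !det_map_mx !polyCM.
by ring.
Qed.

(** Induction by deflation. The factorization of the characteristic polynomial hands over the real
    eigenvalues, in the order of [l]; each step normalizes an eigenvector with respect to [G] and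
    passes to its [G]-orthogonal complement, which is [H]-orthogonal to it as well. *)
Lemma rel_spectral n (G H : 'M[R]_n) (l : 'rV[R]_n) :
  G^T = G -> H^T = H -> posdef G ->
  char_poly (invmx G *m H) = \prod_i ('X - (l 0 i)%:P) ->
  exists P : 'M[R]_n, P *m G *m P^T = 1%:M /\ P *m H *m P^T = diag_mx l.
Proof.
elim: n G H l => [|n IH] G H l sG sH pG cp.
  by exists 1%:M; split; rewrite [LHS]flatmx0 [RHS]flatmx0.
have uG := posdef_unitmx pG.
have : eigenvalue (invmx G *m H) (l 0 0).
  by rewrite eigenvalue_root_char cp big_ord_recl rootM root_XsubC eqxx.
move=> /eigenvalueP[w wE w0].
(* From [w G^-1 H = l w] follows [v0 H = l v0 G], the eigenvector equation of the pencil. *)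
pose v0 := w *m invmx G.
have v00 : v0 != 0.
  by apply: contraNneq w0 => v00; rewrite -(mulmxKV uG w) -/v0 v00 mul0mx.
pose q := (v0 *m G *m v0^T) 0 0.
have q0 : 0 < q by exact: pG.
pose v := (Num.sqrt q)^-1 *: v0.
have sq0 : Num.sqrt q != 0 by rewrite gt_eqF // sqrtr_gt0.
have vG1 : v *m G *m v^T = 1%:M.
  rewrite /v [(_ *: v0)^T]linearZ /= -!scalemxAl -scalemxAr scalerA.
  rewrite [v0 *m G *m v0^T]mx11_scalar -/q -[_ *: _]/(_ *: _) scale_scalar_mx.
  by rewrite -invfM -expr2 sqr_sqrtr ?ltW // mulVf // gt_eqF.
have vH : v *m H = l 0 0 *: (v *m G).
  by rewrite /v -!scalemxAl scalerA mulrC -scalerA /v0 (mulmxKV uG) -wE mulmxA.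
have [g ug gv] : {g : 'M[R]_(1 + n) | g \in unitmx & usubmx g = v}.
  pose e : 'rV[R]_(1 + n) := row_mx 1%:M 0.
  pose f : 'M[R]_(1 + n) := col_mx v 0.
  have ef : e *m f = v by rewrite mul_row_col mul1mx mul0mx addr0.
  have vn0 : v != 0 by rewrite scaler_eq0 invr_eq0 negb_or sq0.
  have e0 : e != 0.
    by apply: contra_neq vn0 => e0; rewrite -ef e0 mul0mx.
  have [g ug eg] : {g : 'M[R]_(1 + n) | g \in unitmx & e *m f = e *m g}.
    by apply: complete_unitmx; rewrite ef !rank_rV vn0 e0.
  exists g => //; rewrite -ef eg -[in RHS](vsubmxK g) mul_row_col.
  by rewrite mul1mx mul0mx addr0.
(* A Gram-Schmidt step: the remaining rows of [g] lose their [G]-projection onto [v]. *)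
pose b := v *m G *m (dsubmx g)^T.
pose P1 : 'M[R]_(1 + n) := col_mx v (dsubmx g - b^T *m v).
have uP1 : P1 \in unitmx.
  have -> : P1 = block_mx 1%:M 0 (- b^T) 1%:M *m g.
    rewrite -[in RHS](vsubmxK g) mul_block_col !mul1mx mul0mx addr0 gv.
    by rewrite mulNmx addrC.
  by rewrite unitmx_mul ug unitmxE det_lblock !det1 mulr1 unitr1.
pose C := (dsubmx g - b^T *m v).
have vGC : v *m G *m C^T = 0.
  rewrite /C linearB /= trmx_mul trmxK mulmxBr -/b mulmxA vG1 mul1mx.
  by rewrite subrr.
have CGv : C *m G *m v^T = 0.
  by apply: trmx_inj; rewrite !trmx_mul trmxK sG mulmxA vGC trmx0.
have GE : P1 *m G *m P1^T = block_mx 1%:M 0 0 (C *m G *m C^T).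
  rewrite /P1 -/C mul_col_mx [(col_mx v C)^T]tr_col_mx mul_col_row vG1 vGC CGv.
  by [].
have HE : P1 *m H *m P1^T = block_mx (l 0 0)%:M 0 0 (C *m H *m C^T).
  rewrite /P1 -/C mul_col_mx [(col_mx v C)^T]tr_col_mx mul_col_row.
  have vHC : v *m H *m C^T = 0 by rewrite vH -scalemxAl vGC scaler0.
  have -> : C *m H *m v^T = 0.
    by apply: trmx_inj; rewrite !trmx_mul trmxK sH mulmxA vHC trmx0.
  by rewrite vHC vH -scalemxAl vG1 scale_scalar_mx mulr1.
have pG1 : posdef (C *m G *m C^T).
  move=> x x0; have := posdef_congr uP1 pG.
  rewrite GE => /(_ (row_mx 0 x)); rewrite mul_row_block tr_row_mx mul_row_col.
  rewrite !mul0mx !mulmx0 !add0r mul0mx add0r; apply.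
  by rewrite row_mx_eq0 negb_and x0 orbT.
have uG1 := posdef_unitmx pG1.
pose l' : 'rV[R]_n := \row_i l 0 (lift 0 i).
have cp' : char_poly (invmx (C *m G *m C^T) *m (C *m H *m C^T)) =
    \prod_i ('X - (l' 0 i)%:P).
  have := @char_poly_congr (1 + n) G H P1 uP1 uG.
  rewrite cp GE HE.
  have -> : invmx (block_mx 1%:M 0 0 (C *m G *m C^T)) =
      block_mx 1%:M 0 0 (invmx (C *m G *m C^T)) :> matrix R (1 + n) (1 + n).
    have ub : block_mx 1%:M 0 0 (C *m G *m C^T) \in (unitmx : pred 'M[R]_(1 + n)).
      by rewrite unitmxE det_lblock det1 mul1r -unitmxE.
    rewrite -[RHS](mulKmx ub) mulmx_block.
    rewrite !mul0mx !mulmx0 !mul1mx !addr0 add0r mulmxV //.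
    by rewrite -scalar_mx_block mulmx1.
  rewrite mulmx_block !mul0mx !mulmx0 !mul1mx !addr0 !add0r.
  rewrite /char_poly char_block_diag_mx det_lblock -/(char_poly _).
  rewrite big_ord_recl det_mx11 !mxE eqxx /= mulr1n.
  move=> /mulfI -> //; last by rewrite polyXsubC_eq0.
  by apply: eq_bigr => i _; rewrite mxE.
have [||Q [QG QH]] := IH _ _ l' _ _ pG1 cp'.
- by rewrite !trmx_mul trmxK sG mulmxA.
- by rewrite !trmx_mul trmxK sH mulmxA.
exists (block_mx 1%:M 0 0 Q *m P1); rewrite trmx_mul; split.
  transitivity (block_mx 1%:M 0 0 Q *m (P1 *m G *m P1^T) *m
                (block_mx 1%:M 0 0 Q : 'M[R]_(1 + n))^T).
    by rewrite !mulmxA.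
  rewrite GE tr_block_mx !mulmx_block !(trmx0, trmx1, mul0mx, mulmx0).
  rewrite !(mul1mx, mulmx1, addr0, add0r) QG. by rewrite mul0mx -scalar_mx_block.
transitivity (block_mx 1%:M 0 0 Q *m (P1 *m H *m P1^T) *m
                (block_mx 1%:M 0 0 Q : 'M[R]_(1 + n))^T).
  by rewrite !mulmxA.
rewrite HE tr_block_mx !mulmx_block !(trmx0, trmx1, mul0mx, mulmx0).
rewrite !(mul1mx, mulmx1, addr0, add0r) QH mul0mx.
apply/matrixP => i j; rewrite !mxE.
case: splitP => i' ei; rewrite !mxE; case: splitP => j' ej; rewrite !mxE.
- rewrite !ord1 eqxx /=; congr (l _ _ *+ _); first by apply: val_inj; rewrite /= ei ord1.
  by rewrite -val_eqE /= ei ej !ord1 eqxx.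
- by rewrite -val_eqE /= ei ej ord1 mulr0n.
- by rewrite -val_eqE /= ei ej ord1 mulr0n.
- congr (l _ _ *+ _); first by apply: val_inj; rewrite /= ei.
  by rewrite -!val_eqE /= ei ej /= eqSS.
Qed.

End LinearAlgebra.

(** * Ordered eigenvalues under comparison of quadratic forms *)

Section LinearAlgebra.
Set Implicit Arguments.
Unset Strict Implicit.
Unset Printing Implicit Defensive.
Variable R : realType.
Lemma orthogonal_sum_sqr n (O : 'M[R]_n) (e : 'rV[R]_n) : O *m O^T = 1%:M ->
  \sum_j (e *m O) 0 j ^+ 2 = \sum_i e 0 i ^+ 2.
Proof.
move=> OO.
have E (v : 'rV[R]_n) : \sum_j v 0 j ^+ 2 = (v *m v^T) 0 0.
  by rewrite mxE; apply: eq_bigr => j _; rewrite mxE expr2.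
by rewrite !E trmx_mul mulmxA -(mulmxA e) OO mulmx1.
Qed.

(** A dimension count as in the Courant-Fischer principle: with more [l i] than [m j] below [c],
    some nonzero [e] is supported where [l i < c] while [e O] is supported where [m j >= c]. The two
    forms at [e] are then separated by [c |e|^2] in the wrong order. *)
Lemma eigen_count_le n (O : 'M[R]_n) (l m : 'rV[R]_n) (c : R) :
  O *m O^T = 1%:M ->
  (forall e : 'rV[R]_n,
     \sum_j m 0 j * (e *m O) 0 j ^+ 2 <= \sum_i l 0 i * e 0 i ^+ 2) ->
  (#|[pred i : 'I_n | (l 0 i < c)%R]| <= #|[pred j : 'I_n | (m 0 j < c)%R]|)%N.
Proof.
move=> OO lm; rewrite leqNgt; apply/negP => lt_ml.
pose L := [pred i : 'I_n | l 0 i < c]; pose M := [pred j : 'I_n | m 0 j < c].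
(* More rows than columns, hence a nonzero left kernel. *)
pose X : 'M[R]_(#|L|, #|M|) := \matrix_(a, b) O (enum_val a) (enum_val b).
have kX : kermx X != 0.
  rewrite -mxrank_eq0 mxrank_ker subn_eq0 -ltnNge.
  exact: leq_ltn_trans (rank_leq_col X) lt_ml.
have /rowV0Pn[v /sub_kermxP vX v0] := kX.
pose e : 'rV[R]_n := v *m (\matrix_(a, i) (i == enum_val a)%:R).
have eE i : e 0 i = \sum_a v 0 a * (i == enum_val a)%:R.
  by rewrite mxE; apply: eq_bigr => a _; rewrite mxE.
have eL a : e 0 (enum_val a) = v 0 a.
  rewrite eE (bigD1 a) //= eqxx mulr1 big1 ?addr0 // => b ba.
  by rewrite (inj_eq enum_val_inj) eq_sym (negPf ba) mulr0.
have eNL i : ~~ (l 0 i < c) -> e 0 i = 0.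
  move=> iL; rewrite eE big1 // => a _; case: eqP => [ia|]; last by rewrite mulr0.
  by move: iL; rewrite ia; have := enum_valP a; rewrite inE => ->.
have eOM j : m 0 j < c -> (e *m O) 0 j = 0.
  move=> jM; have jM' : j \in M by [].
  have vX0 : \sum_a v 0 a * O (enum_val a) j = 0.
    have := congr1 (fun A : 'rV_#|M| => A 0 (enum_rank_in jM' j)) vX.
    rewrite mxE [in RHS]mxE => vX0; rewrite -[RHS]vX0.
    by apply: eq_bigr => a _; rewrite mxE enum_rankK_in.
  rewrite -[RHS]vX0 mxE.
  transitivity (\sum_i \sum_a v 0 a * (i == enum_val a)%:R * O i j).
    by apply: eq_bigr => i _; rewrite eE mulr_suml.
  rewrite exchange_big /=; apply: eq_bigr => a _.
  rewrite (bigD1 (enum_val a)) //= eqxx mulr1 big1 ?addr0 // => i ia.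
  by rewrite (negPf ia) mulr0 mul0r.
have e0 : 0 < \sum_i e 0 i ^+ 2 * (c - l 0 i).
  have /rV0Pn[a va] : v != 0 by [].
  rewrite (bigD1 (enum_val a)) //= ltr_wpDr //.
    apply: sumr_ge0 => i _; have [lc|lc] := ltP (l 0 i) c.
      by rewrite mulr_ge0 ?sqr_ge0 // subr_ge0 ltW.
    by rewrite eNL ?expr0n ?mul0r // -leNgt.
  rewrite eL mulr_gt0 ?exprn_even_gt0 //= subr_gt0.
  by have := enum_valP a; rewrite inE.
have e1 : 0 <= \sum_j (e *m O) 0 j ^+ 2 * (m 0 j - c).
  apply: sumr_ge0 => j _; have [mc|mc] := ltP (m 0 j) c.
    by rewrite eOM // expr0n mul0r.
  by rewrite mulr_ge0 ?sqr_ge0 // subr_ge0.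
have E1 : \sum_i e 0 i ^+ 2 * (c - l 0 i) =
    c * \sum_i e 0 i ^+ 2 - \sum_i l 0 i * e 0 i ^+ 2.
  rewrite mulr_sumr -sumrB; apply: eq_bigr => i _; ring.
have E2 : \sum_j (e *m O) 0 j ^+ 2 * (m 0 j - c) =
    \sum_j m 0 j * (e *m O) 0 j ^+ 2 - c * \sum_i e 0 i ^+ 2.
  rewrite -(orthogonal_sum_sqr e OO) mulr_sumr -sumrB.
  by apply: eq_bigr => i _; ring.
have := lm e; rewrite E1 in e0; rewrite E2 in e1; lra.
Qed.

Lemma sorting_perm n (l : 'rV[R]_n) :
  exists s : 'S_n, forall i j : 'I_n, (i <= j)%N -> l 0 (s i) <= l 0 (s j).
Proof.
pose t := [tuple l 0 i | i < n].
have pst : perm_eq (sort_tuple <=%R t) t by rewrite perm_sort.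
have [s sE] := tuple_permP pst.
exists s => i j ij.
have nE (k : 'I_n) : l 0 (s k) = nth 0 (sort_tuple <=%R t) k.
  by rewrite sE (nth_map k) ?size_enum_ord // nth_ord_enum tnth_mktuple.
rewrite !nE; apply: (sorted_leq_nth le_trans le_refl) => //.
- exact: (sort_sorted (@le_total _ R)).
- by rewrite inE size_tuple.
- by rewrite inE size_tuple.
Qed.

(** Both lists are sorted. If the [k]-th smallest entry of [l] were below that of [m], then with the
    latter as threshold at least [k + 1] entries of [l] (counting from 0) and at most [k] entries of
    [m] would lie below it, against the eigenvalue count. *)
Lemma eigenvalue_domination n (O : 'M[R]_n) (l m : 'rV[R]_n) :
  O *m O^T = 1%:M ->
  (forall e : 'rV[R]_n,
     \sum_j m 0 j * (e *m O) 0 j ^+ 2 <= \sum_i l 0 i * e 0 i ^+ 2) ->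
  exists p : 'S_n, forall i, m 0 (p i) <= l 0 i.
Proof.
move=> OO lm.
have [s sl] := sorting_perm l; have [t tm] := sorting_perm m.
suff st k : m 0 (t k) <= l 0 (s k).
  by exists (s^-1 * t)%g => i; rewrite permM -{2}(permKV s i) st.
rewrite leNgt; apply/negP => lt_lm.
have := eigen_count_le (m 0 (t k)) OO lm; apply/negP; rewrite -ltnNge.
have -> : #|[pred i : 'I_n | l 0 i < m 0 (t k)]| = #|[pred i : 'I_n | l 0 (s i) < m 0 (t k)]|.
  rewrite -[RHS](card_imset _ (@perm_inj _ s)); apply: eq_card => i.
  rewrite !inE; apply/idP/imsetP => [h|[j +] ->]; last by rewrite inE.
  by exists (s^-1 i)%g; rewrite ?inE permKV.
have -> : #|[pred i : 'I_n | m 0 i < m 0 (t k)]| = #|[pred i : 'I_n | m 0 (t i) < m 0 (t k)]|.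
  rewrite -[RHS](card_imset _ (@perm_inj _ t)); apply: eq_card => i.
  rewrite !inE; apply/idP/imsetP => [h|[j +] ->]; last by rewrite inE.
  by exists (t^-1 i)%g; rewrite ?inE permKV.
apply: proper_card; apply/properP; split.
  apply/fintype.subsetP => i; rewrite !inE => ik.
  apply: le_lt_trans lt_lm; apply: sl; rewrite leqNgt; apply/negP => ki.
  by have := tm _ _ (ltnW ki); rewrite leNgt ik.
by exists k; rewrite !inE ?ltxx.
Qed.

Lemma symmetric_mono_le n (f : 'rV[R]_n -> R) (O : 'M[R]_n) (l m : 'rV[R]_n) :
  symmetric_on_K f ->
  (forall a b : 'rV[R]_n, Kpos a -> (forall i, a 0 i <= b 0 i) -> f a <= f b) ->
  O *m O^T = 1%:M -> Kpos m ->
  (forall e : 'rV[R]_n,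
     \sum_j m 0 j * (e *m O) 0 j ^+ 2 <= \sum_i l 0 i * e 0 i ^+ 2) ->
  f m <= f l.
Proof.
move=> fs fm OO mK /(eigenvalue_domination OO)[p pE].
rewrite -(fs p m mK); apply: fm => i; rewrite mxE //; exact: mK.
Qed.
End LinearAlgebra.

(** * Differentiability and mean values along lines *)

Section Calculus.
Set Implicit Arguments.
Unset Strict Implicit.
Unset Printing Implicit Defensive.
Import numFieldNormedType.Exports.
Variable R : realType.
Lemma coord_le_norm n (v : 'rV[R]_n) i : `|v 0 i| <= `|v|.
Proof.
rewrite [leRHS]/Num.norm /= mx_normrE; apply/bigmax_geP; right => /=.
by exists (0, i).
Qed.

Lemma norm_le_coord n (v : 'rV[R]_n) (c : R) :
  0 <= c -> (forall i, `|v 0 i| <= c) -> `|v| <= c.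
Proof.
move=> c0 vc; rewrite [leLHS]/Num.norm /= mx_normrE; apply/bigmax_leP; split => //=.
by move=> [i j] _ /=; rewrite ord1.
Qed.

Lemma norm_evec_le n (i : 'I_n) : `|evec R i| <= 1.
Proof.
apply: norm_le_coord => // j; rewrite mxE eqxx /=.
by case: (j == i); rewrite ?normr1 ?normr0.
Qed.

Lemma within_continuous_eps n (A : set 'rV[R]_n) (f : 'rV[R]_n -> R) :
  {within A, continuous f} <->
  forall x, A x -> forall e, 0 < e -> exists2 d, 0 < d &
    forall y, A y -> `|y - x| < d -> `|f y - f x| < e.
Proof.
split.
  move=> /subspace_continuousP fc x Ax e e0.
  have /cvgrPdist_lt/(_ e e0) := fc x Ax.
  rewrite near_withinE => /nbhs_normP[d /= d0 dP]; exists d => // y Ay yx.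
  by rewrite distrC; apply: dP => //=; rewrite distrC.
move=> H; apply/subspace_continuousP => x Ax.
apply/cvgrPdist_lt => e e0; have [d d0 dP] := H x Ax e e0.
rewrite near_withinE; apply/nbhs_ballP; exists d => //= y.
rewrite -ball_normE /= => yx Ay.
by rewrite distrC dP // distrC.
Qed.

Lemma open_eps n (A : set 'rV[R]_n) x : open A -> A x ->
  exists2 d, 0 < d & forall y, `|y - x| < d -> A y.
Proof.
move=> oA Ax; have /nbhs_normP[d /= d0 dP] : nbhs x A by exact: open_nbhs_nbhs.
by exists d => // y yx; apply: dP; rewrite /= distrC.
Qed.

Lemma is_derive_epsP (g : R -> R) (x l : R) :
  (forall e, 0 < e -> exists2 d, 0 < d &
    forall h, `|h| < d -> `|g (x + h) - g x - l * h| <= e * `|h|) ->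
  is_derive x 1 g l.
Proof.
move=> H.
have c : (fun h : R => h^-1 *: ((g \o shift x) (h *: 1) - g x)) @ 0^' --> l.
  apply/cvgrPdist_le => e e0; have [d d0 dP] := H e e0.
  near=> h.
  have h0 : h != 0 by near: h; exact: nbhs_dnbhs_neq.
  have hd : `|h| < d by near: h; exact: dnbhs0_lt.
  have := dP h hd; rewrite /= [h *: 1]mulr1 [h + x]addrC => H1.
  have -> : l - h^-1 *: (g (x + h) - g x) =
      - (h^-1 * (g (x + h) - g x - l * h)).
    by rewrite [_ *: _]/(_ * _) [in RHS]mulrBr [l * h]mulrC mulKf // opprB.
  by rewrite normrN normrM normfV ler_pdivrMl ?normr_gt0 // [leRHS]mulrC.
apply: DeriveDef; first by apply/cvg_ex; exists l.
exact: cvg_lim.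
Unshelve. all: by end_near. Qed.

Lemma derive_epsP n (u : 'rV[R]_n -> R) (x v : 'rV[R]_n) :
  derivable u x v -> is_derive (0 : R) 1 (fun t : R => u (x + t *: v)) ('D_v u x).
Proof.
move=> du; have E : (fun h : R => h^-1 *: ((u \o shift x) (h *: v) - u x)) =
   (fun h : R => h^-1 *: (((fun t : R => u (x + t *: v)) \o shift 0) (h *: 1) -
      u (x + 0 *: v))).
  apply/funext => h /=.
  by rewrite scale0r !addr0 [h *: 1]mulr1 [h *: v + x]addrC.
apply: DeriveDef; first by rewrite /derivable -E.
by rewrite /derive -E.
Qed.

Lemma is_derive_line n (u : 'rV[R]_n -> R) (x v : 'rV[R]_n) (a t : R) :
  derivable u (x + (t * a) *: v) v ->
  is_derive t 1 (fun s : R => u (x + (s * a) *: v))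
    ('D_v u (x + (t * a) *: v) * a).
Proof.
move=> /derive_epsP du.
have dg : is_derive t 1 (fun s : R => (s - t) * a) a.
  have -> : (fun s : R => (s - t) * a) = (fun s => a *: (s - t)).
    by apply/funext => s; rewrite mulrC.
  by apply: is_derive_eq; rewrite subr0 [a *: 1]mulr1.
have E : (fun s : R => u (x + (s * a) *: v)) =
   (fun s : R => u (x + (t * a) *: v + s *: v)) \o (fun s : R => (s - t) * a).
  apply/funext => s /=; congr (u _).
  by rewrite -addrA -scalerDl mulrBl [t * a + _]addrC subrK.
rewrite E; apply: is_derive1_comp.
by rewrite subrr mul0r.
Qed.

Lemma MVT_line n (u : 'rV[R]_n -> R) (x v : 'rV[R]_n) (a : R) :
  (forall t : R, 0 <= t <= 1 -> derivable u (x + (t * a) *: v) v) ->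
  exists2 c : R, 0 <= c <= 1 & u (x + a *: v) - u x = 'D_v u (x + (c * a) *: v) * a.
Proof.
move=> H; pose g (s : R) := u (x + (s * a) *: v).
have dg (t : R) : 0 <= t <= 1 -> is_derive t 1 g ('D_v u (x + (t * a) *: v) * a).
  by move=> /H; exact: is_derive_line.
have [|||c c01 E] := @MVT_segment R g (fun t => 'D_v u (x + (t * a) *: v) * a) 0 1.
- exact: ler01.
- by move=> t; rewrite in_itv /= => /andP[t0 t1]; apply: dg; rewrite !ltW.
- apply: derivable_within_continuous => t; rewrite in_itv /= => t01.
  by have [] := dg t t01.
exists c; first by rewrite in_itv in c01.
by move: E; rewrite /g !mul1r mul0r scale0r addr0 subr0 mulr1.
Qed.

(** Frechet differentiability at [x] with gradient [p], in the max norm of row vectors; [smooth_on]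
    by itself speaks only of derivatives along the coordinate axes. *)
Definition eps_diff n (u : 'rV[R]_n -> R) (p x : 'rV[R]_n) :=
  forall e, 0 < e -> exists2 d, 0 < d & forall h, `|h| < d ->
    `|u (x + h) - u x - \sum_i p 0 i * h 0 i| <= e * `|h|.

(** The increment is switched on one coordinate at a time, with the mean value theorem on each piece
    of the path. The tolerance is split as [e / n.+1] so that [n = 0] causes no division by zero. *)
Lemma C1_eps_diff n (u : 'rV[R]_n -> R) (x : 'rV[R]_n) (r : R) : 0 < r ->
  (forall y i, `|y - x| < r -> derivable u y (evec R i)) ->
  (forall i e, 0 < e -> exists2 d, 0 < d &
     forall y, `|y - x| < d -> `|partial u i y - partial u i x| < e) ->
  eps_diff u (grad u x) x.
Proof.
move=> r0 du cu e e0.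
have [d d0 dP] : exists2 d, 0 < d & forall i y, `|y - x| < d ->
    `|partial u i y - partial u i x| <= e / n.+1%:R.
  have en : 0 < e / n.+1%:R by rewrite divr_gt0.
  have : forall i : 'I_n, exists d, 0 < d /\ forall y, `|y - x| < d ->
    `|partial u i y - partial u i x| <= e / n.+1%:R.
    move=> i; have [d d0 dP] := cu i _ en; exists d; split => // y yx.
    by rewrite ltW // dP.
  move=> /choice[d dP]; exists (\big[Order.min/1]_i d i).
    by apply/bigmin_gtP; split => // i _; have [] := dP i.
  move=> i y yx; apply: (dP i).2; apply: lt_le_trans yx _.
  exact: bigmin_le_cond.
exists (Order.min r d); first by rewrite lt_min r0.
move=> h; rewrite lt_min => /andP[hr hd].
pose hk (k : nat) : 'rV[R]_n := \row_i (if (i < k)%N then h 0 i else 0).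
have hkS (k : 'I_n) : hk k.+1 = hk k + h 0 k *: evec R k.
  apply/rowP => i; rewrite !mxE eqxx /= ltnS leq_eqVlt -val_eqE /=.
  by case: ltngtP => [||/val_inj ->]; rewrite ?mulr0 ?addr0 ?mulr1 ?add0r.
have hkle (k : 'I_n) (t : R) : 0 <= t <= 1 ->
    `|hk k + (t * h 0 k) *: evec R k| <= `|h|.
  move=> /andP[t0 t1]; apply: norm_le_coord => // i; rewrite !mxE eqxx /=.
  have := coord_le_norm h i; case: (eqVneq i k) => [->|ik].
    rewrite ltnn add0r mulr1 normrM => hi; apply: le_trans hi.
    by rewrite ger0_norm // ler_piMl.
  by rewrite mulr0 addr0; case: ifP => // _ _; rewrite normr0.
have tele (k : nat) : (k <= n)%N ->
    `|u (x + hk k) - u x - \sum_(i < n | (i < k)%N) grad u x 0 i * h 0 i| <=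
    k%:R * (e / n.+1%:R * `|h|).
  elim: k => [_|k IHk kn].
    rewrite big_pred0 //; have -> : hk 0 = 0 by apply/rowP => i; rewrite !mxE.
    by rewrite addr0 subrr subr0 normr0 mul0r.
  pose k' := Ordinal kn.
  have [|c c01 E] := @MVT_line n u (x + hk k) (evec R k') (h 0 k').
    move=> t t01; apply: du; rewrite -[x + hk k + _]addrA [x + _]addrC addrK.
    by apply: le_lt_trans hr; exact: (hkle k').
  rewrite -addrA -(hkS k') /= in E.
  rewrite (bigD1 k') ?ltnS //=.
  rewrite (eq_bigl (fun i : 'I_n => (i < k)%N)); last first.
    by move=> i; rewrite ltnS -val_eqE /=; case: ltngtP.
  have -> : u (x + hk k.+1) - u x - (grad u x 0 k' * h 0 k' +
     \sum_(i < n | (i < k)%N) grad u x 0 i * h 0 i) =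
    (u (x + hk k.+1) - u (x + hk k) - grad u x 0 k' * h 0 k') +
    (u (x + hk k) - u x - \sum_(i < n | (i < k)%N) grad u x 0 i * h 0 i).
    ring.
  rewrite E (le_trans (ler_normD _ _)) // -(natr1 k) mulrDl mul1r addrC.
  apply: lerD; first by apply: IHk; exact: ltnW.
  rewrite -mulrBl normrM ler_pM //; last exact: coord_le_norm.
  rewrite mxE; apply: dP; rewrite -[x + hk k + _]addrA [x + _]addrC addrK.
  by apply: le_lt_trans hd; exact: (hkle k').
have := tele n (leqnn n).
have -> : hk n = h by apply/rowP => i; rewrite mxE ltn_ord.
rewrite (eq_bigl xpredT) => [/le_trans|i]; last exact: ltn_ord.
apply; rewrite mulrA ler_wpM2r // mulrCA ger_pMr // ler_pdivrMr // mul1r.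
by rewrite ler_nat.
Qed.
End Calculus.

(** * Taylor expansion of order two, symmetry of the Hessian, chain rule, a barrier *)

Section Calculus2.
Set Implicit Arguments.
Unset Strict Implicit.
Unset Printing Implicit Defensive.
Import numFieldNormedType.Exports.
Variable R : realType.
Definition dotp n (v w : 'rV[R]_n) : R := (v *m w^T) 0 0.
Definition qf n (A : 'M[R]_n) (v : 'rV[R]_n) : R := (v *m A *m v^T) 0 0.

Lemma dotpE n (v w : 'rV[R]_n) : dotp v w = \sum_i v 0 i * w 0 i.
Proof. by rewrite /dotp mxE; apply: eq_bigr => i _; rewrite mxE. Qed.

Lemma qfE n (A : 'M[R]_n) (v : 'rV[R]_n) :
  qf A v = \sum_i \sum_j A i j * v 0 i * v 0 j.
Proof.
rewrite /qf mxE exchange_big /=; apply: eq_bigr => j _.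
rewrite !mxE mulr_suml; apply: eq_bigr => i _; ring.
Qed.

Lemma is_derive_eps (g : R -> R) (x l : R) : is_derive x 1 g l ->
  forall e, 0 < e -> exists2 d, 0 < d &
    forall h, `|h| < d -> `|g (x + h) - g x - l * h| <= e * `|h|.
Proof.
move=> [dg lE] e e0.
have : (fun h : R => h^-1 *: ((g \o shift x) (h *: 1) - g x)) @ 0^' --> l.
  by rewrite -lE; exact: dg.
move=> /cvgrPdist_le/(_ e e0).
rewrite near_withinE => /nbhs_normP[d /= d0 dP]; exists d => // h hd.
have [->|h0] := eqVneq h 0.
  by rewrite addr0 subrr mulr0 subr0 normr0 mulr0.
have /= := dP h; rewrite sub0r normrN => /(_ hd h0).
rewrite [h *: 1]mulr1 [h + x]addrC => H1.
have -> : g (x + h) - g x - l * h = - (h * (l - h^-1 *: (g (x + h) - g x))).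
  by rewrite [_ *: _]/(_ * _) mulrBr mulVKf // [l * h]mulrC opprB.
by rewrite normrN normrM [leRHS]mulrC ler_wpM2l.
Qed.

Lemma norm_scale_lt (K : R) (a b d : R) :
  0 <= K -> 0 <= b -> b <= K * a -> a < d / (K + 1) -> 0 <= a -> b < d.
Proof.
move=> K0 b0 bKa ad a0; rewrite ltr_pdivlMr ?ltr_wpDl // in ad.
nra.
Qed.

Lemma eps_diff_line n (u : 'rV[R]_n -> R) (p x v : 'rV[R]_n) (t : R) :
  eps_diff u p (x + t *: v) ->
  is_derive t 1 (fun s : R => u (x + s *: v)) (dotp p v).
Proof.
move=> du; apply: is_derive_epsP => e e0.
have v1 : 0 < `|v| + 1 by rewrite ltr_wpDl.
have [d d0 dP] := du (e / (`|v| + 1)) (divr_gt0 e0 v1).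
exists (d / (`|v| + 1)); first by rewrite divr_gt0.
move=> h hd.
have hv : `|h *: v| < d.
  by apply: (norm_scale_lt _ _ _ hd) => //; rewrite normrZ mulrC.
have := dP _ hv; rewrite -[x + t *: v + _]addrA -scalerDl.
have -> : \sum_i p 0 i * (h *: v) 0 i = dotp p v * h.
  by rewrite dotpE mulr_suml; apply: eq_bigr => i _; rewrite mxE; ring.
move=> /le_trans; apply; rewrite normrZ mulrCA [leRHS]mulrC ler_wpM2l //.
by rewrite mulrAC -mulrA ger_pMr // ler_pdivrMr // mul1r lerDl.
Qed.

Lemma smooth_open n (A : set 'rV[R]_n) u : smooth_on A u -> open A.
Proof. by case. Qed.

Lemma smooth_eps_diff n (A : set 'rV[R]_n) u x ds : smooth_on A u -> A x ->
  eps_diff (Defs.iterD ds u) (grad (Defs.iterD ds u) x) x.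
Proof.
move=> [oA su] Ax; have [r r0 rP] := open_eps oA Ax.
apply: (C1_eps_diff r0) => [y i yx|i e e0].
  by apply: (su ds).2; exact: rP.
have /within_continuous_eps/(_ x Ax e e0)[d d0 dP] := (su (i :: ds)).1.
exists (Order.min r d); first by rewrite lt_min r0.
by move=> y; rewrite lt_min => /andP[yr yd]; apply: dP => //; exact: rP.
Qed.

Lemma smooth_cont n (A : set 'rV[R]_n) u x : smooth_on A u -> A x ->
  forall e, 0 < e -> exists2 d, 0 < d & forall y, `|y - x| < d ->
    `|u y - u x| < e.
Proof.
move=> [oA su] Ax e e0; have [r r0 rP] := open_eps oA Ax.
have /within_continuous_eps/(_ x Ax e e0)[d d0 dP] := (su [::]).1.
exists (Order.min r d); first by rewrite lt_min r0.
by move=> y; rewrite lt_min => /andP[yr yd]; apply: dP => //; exact: rP.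
Qed.

(** The mean value theorem is applied to the error along the segment; its derivative is small by the
    first-order expansion of each partial derivative. These expansions produce the entries
    [hess u x j i], hence the transpose. *)
Lemma taylor2_tr n (A : set 'rV[R]_n) u x : smooth_on A u -> A x ->
  forall e, 0 < e -> exists2 d, 0 < d & forall h, `|h| < d ->
    `|u (x + h) - u x - dotp (grad u x) h - 2^-1 * qf (hess u x)^T h|
      <= e * `|h| ^+ 2.
Proof.
move=> su Ax e e0; have [r r0 rP] := open_eps (smooth_open su) Ax.
have en : 0 < e / n.+1%:R by rewrite divr_gt0.
have [d [d0 dP]] : exists d, 0 < d /\ forall i h, `|h| < d ->
    `|partial u i (x + h) - partial u i x - \sum_j hess u x j i * h 0 j| <=
       e / n.+1%:R * `|h|.
  have : forall i : 'I_n, exists d, 0 < d /\ forall h, `|h| < d ->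
    `|partial u i (x + h) - partial u i x - \sum_j hess u x j i * h 0 j| <=
       e / n.+1%:R * `|h|.
    move=> i; have [d d0 dP] := smooth_eps_diff [:: i] su Ax en.
    exists d; split => // h /dP /=; congr (`| _ - _ | <= _).
    by apply: eq_bigr => j _; rewrite !mxE.
  move=> /choice[d dP]; exists (\big[Order.min/1]_i d i); split.
    by apply/bigmin_gtP; split => // i _; have [] := dP i.
  move=> i h hd; apply: (dP i).2; apply: lt_le_trans hd _.
  exact: bigmin_le_cond.
exists (Order.min r d); first by rewrite lt_min r0.
move=> h; rewrite lt_min => /andP[hr hd].
have th_le (t : R) : 0 <= t <= 1 -> `|t *: h| <= `|h|.
  by move=> /andP[t0 t1]; rewrite normrZ ger0_norm // ler_piMl.
pose G (t : R) := u (x + t *: h) - (dotp (grad u x) h) * t -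
    2^-1 * qf (hess u x)^T h * t ^+ 2.
pose dG (t : R) := dotp (grad u (x + t *: h)) h - dotp (grad u x) h -
    qf (hess u x)^T h * t.
have GE (t : R) : 0 <= t <= 1 -> is_derive t 1 G (dG t).
  move=> t01; have Axt : A (x + t *: h).
    by apply: rP; rewrite addrC addKr (le_lt_trans (th_le t t01)).
  have := eps_diff_line (smooth_eps_diff [::] su Axt).
  rewrite /= => du.
  apply: is_derive_eq.
  have sE (a b : R) : a *: (b : R^o) = a * b by [].
  by rewrite /dG !sE !mulr1; field.
have [|||c c01 E] := @MVT_segment R G dG 0 1.
- exact: ler01.
- by move=> t; rewrite in_itv /= => /andP[t0 t1]; apply: GE; rewrite !ltW.
- apply: derivable_within_continuous => t; rewrite in_itv /= => t01.
  by have [] := GE t t01.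
rewrite in_itv /= in c01.
have -> : u (x + h) - u x - dotp (grad u x) h - 2^-1 * qf (hess u x)^T h = dG c.
  move: E; rewrite subr0 mulr1 => <-; rewrite /G scale1r scale0r addr0; ring.
have -> : dG c = \sum_i (partial u i (x + c *: h) - partial u i x -
    \sum_j hess u x j i * (c *: h) 0 j) * h 0 i.
  rewrite /dG !dotpE qfE mulr_suml -!sumrB; apply: eq_bigr => i _.
  rewrite !mxE !mulrBl; congr (_ - _).
  rewrite !mulr_suml; apply: eq_bigr => j _; rewrite !mxE; ring.
apply: le_trans (ler_norm_sum _ _ _) _.
apply: le_trans (_ : \sum_(i < n) e / n.+1%:R * `|h| ^+ 2 <= _).
  apply: ler_sum => i _; rewrite normrM expr2 mulrA.
  apply: ler_pM => //; last exact: coord_le_norm.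
  have hc := th_le c c01.
  by apply: le_trans (dP i _ (le_lt_trans hc hd)) _; rewrite ler_wpM2l // ltW.
rewrite sumr_const card_ord -[leLHS]mulr_natl mulrA ler_wpM2r ?sqr_ge0 //.
by rewrite mulrCA ger_pMr // ler_pdivrMr // mul1r ler_nat.
Qed.

(** The second difference over a square of side [s] is symmetric in [i] and [j], while the mean
    value theorem taken in direction [i] evaluates it as one particular mixed derivative. Exchanging
    the roles of [i] and [j] gives the symmetry of the Hessian. *)
Lemma mixed_difference n (A : set 'rV[R]_n) u x i j : smooth_on A u -> A x ->
  forall e, 0 < e -> exists2 d, 0 < d & forall s, 0 < s < d ->
    `|u (x + s *: evec R i + s *: evec R j) - u (x + s *: evec R i) -
      u (x + s *: evec R j) + u x - s ^+ 2 * hess u x j i| <= e * s ^+ 2.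
Proof.
move=> su Ax e e0; have [r r0 rP] := open_eps (smooth_open su) Ax.
have e4 : 0 < e / 4 by rewrite divr_gt0.
have [d d0 dP] := smooth_eps_diff [:: i] su Ax e4.
exists (Order.min r d / 2); first by rewrite divr_gt0 // lt_min r0.
move=> s /andP[s0]; rewrite ltr_pdivlMr // lt_min => /andP[sr sd].
have ns (c : R) (b : bool) : 0 <= c <= 1 ->
    `|(c * s) *: evec R i + (b%:R * s) *: evec R j| <= s * 2.
  move=> /andP[c0 c1]; apply: le_trans (ler_normD _ _) _.
  rewrite mulr_natr mulr2n; apply: lerD; rewrite normrZ -[leRHS]mulr1.
    apply: ler_pM => //; last exact: norm_evec_le.
    rewrite ger0_norm; first by rewrite ler_piMl // ltW.
    by rewrite mulr_ge0 // ltW.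
  apply: ler_pM => //; last exact: norm_evec_le.
  by case: b; rewrite ?mul1r ?mul0r ?normr0 ?gtr0_norm // ltW.
pose w (y : 'rV[R]_n) := u (y + s *: evec R j) - u y.
have Ay (c : R) (b : bool) : 0 <= c <= 1 ->
    A (x + (c * s) *: evec R i + (b%:R * s) *: evec R j).
  move=> c01; apply: rP; rewrite -[x + _ + _]addrA [x + _]addrC addrK.
  exact: le_lt_trans (ns c b c01) sr.
have dw (c : R) : 0 <= c <= 1 ->
    is_derive (x + (c * s) *: evec R i) (evec R i) w
     (partial u i (x + (c * s) *: evec R i + s *: evec R j) -
      partial u i (x + (c * s) *: evec R i)).
  move=> c01; have := Ay c true c01; have := Ay c false c01.
  rewrite mul1r mul0r scale0r addr0 => A0 A1.
  have d1 := derivableP ((su.2 [::]).2 i _ A0).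
  have d2 : is_derive (x + (c * s) *: evec R i) (evec R i)
     (fun y => u (y + s *: evec R j))
     (partial u i (x + (c * s) *: evec R i + s *: evec R j)).
    have d3 := (su.2 [::]).2 i _ A1.
    have E : (fun h : R => h^-1 *: (((fun y => u (y + s *: evec R j)) \o
       shift (x + (c * s) *: evec R i)) (h *: evec R i) -
       (fun y => u (y + s *: evec R j)) (x + (c * s) *: evec R i))) =
       (fun h : R => h^-1 *: ((u \o
       shift (x + (c * s) *: evec R i + s *: evec R j)) (h *: evec R i) -
       u (x + (c * s) *: evec R i + s *: evec R j))).
      by apply/funext => h /=; rewrite !addrA.
    by apply: DeriveDef; rewrite /derivable /derive E.
  exact: is_deriveB.
have [|c c01 E] := @MVT_line R n w x (evec R i) s.
  by move=> t t01; have [] := dw t t01.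
have [_ wE] := dw c c01; rewrite wE /w in E.
have -> : u (x + s *: evec R i + s *: evec R j) - u (x + s *: evec R i) -
      u (x + s *: evec R j) + u x = u (x + s *: evec R i + s *: evec R j) -
    u (x + s *: evec R i) - (u (x + s *: evec R j) - u x) by ring.
rewrite E.
have H1 := dP _ (le_lt_trans (ns c true c01) sd).
have H0 := dP _ (le_lt_trans (ns c false c01) sd).
have SE (b : bool) :
  \sum_k grad (Defs.iterD [:: i] u) x 0 k *
     ((c * s) *: evec R i + (b%:R * s) *: evec R j) 0 k =
  c * s * hess u x i i + b%:R * s * hess u x j i.
  have ek (k : 'I_n) : \sum_l grad (Defs.iterD [:: i] u) x 0 l * evec R k 0 l =
      hess u x k i.
    rewrite (bigD1 k) //= big1 => [|l lk]; last first.
      by rewrite !mxE eqxx (negPf lk) mulr0.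
    by rewrite !mxE !eqxx mulr1 addr0.
  rewrite -!ek !mulr_sumr -big_split /=; apply: eq_bigr => k _.
  by rewrite !mxE; ring.
rewrite SE mul1r addrA in H1; rewrite SE !mul0r scale0r !addr0 in H0.
have le1 : `|(c * s) *: evec R i + s *: evec R j| <= s * 2.
  by have := ns c true c01; rewrite mul1r.
have le0 : `|(c * s) *: evec R i| <= s * 2.
  by have := ns c false c01; rewrite mul0r scale0r addr0.
rewrite /= in H0 H1.
have -> : (partial u i (x + (c * s) *: evec R i + s *: evec R j) -
    partial u i (x + (c * s) *: evec R i)) * s - s ^+ 2 * hess u x j i =
  s * ((partial u i (x + (c * s) *: evec R i + s *: evec R j) - partial u i x -
     (c * s * hess u x i i + s * hess u x j i)) -
   (partial u i (x + (c * s) *: evec R i) - partial u i x -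
     c * s * hess u x i i)) by ring.
rewrite normrM gtr0_norm // expr2 mulrCA ler_pM2l //.
apply: le_trans (ler_normB _ _) _.
have -> : e * s = e / 4 * (s * 2) + e / 4 * (s * 2) by field.
apply: lerD; [apply: le_trans H1 _|apply: le_trans H0 _].
  by rewrite ler_wpM2l // ltW.
by rewrite ler_wpM2l // ltW.
Qed.

Lemma hess_sym n (A : set 'rV[R]_n) u x : smooth_on A u -> A x ->
  (hess u x)^T = hess u x.
Proof.
move=> su Ax; apply/matrixP => i j; rewrite mxE.
apply/eqP; rewrite -subr_eq0 -normr_le0; apply/ler_addgt0Pr => e e0.
have e2 : 0 < e / 2 by rewrite divr_gt0.
have [d d0 dP] := mixed_difference i j su Ax e2.
have [d' d'0 d'P] := mixed_difference j i su Ax e2.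
pose s := Order.min d d' / 2.
have s0 : 0 < s by rewrite divr_gt0 // lt_min d0.
have [sd sd'] : s < d /\ s < d'.
  by apply/andP; rewrite -lt_min /s gtr_pMr ?lt_min ?d0 // invf_lt1 // ltr1n.
have := dP s; have := d'P s; rewrite s0 sd sd' => /(_ isT) H1 /(_ isT) H2.
rewrite add0r -(ler_pM2r (x := s ^+ 2)) ?exprn_gt0 //.
rewrite -[X in _ * X <= _]ger0_norm ?sqr_ge0 // -normrM.
set Q1 := (X in `|X| <= _) in H1; set Q2 := (X in `|X| <= _) in H2.
have -> : (hess u x j i - hess u x i j) * s ^+ 2 = Q1 - Q2.
  by rewrite /Q1 /Q2 [x + s *: evec R j + _]addrAC; ring.
apply: le_trans (ler_normB _ _) _.
have -> : e * s ^+ 2 = e / 2 * s ^+ 2 + e / 2 * s ^+ 2 by field.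
exact: lerD.
Qed.

Lemma taylor2 n (A : set 'rV[R]_n) u x : smooth_on A u -> A x ->
  forall e, 0 < e -> exists2 d, 0 < d & forall h, `|h| < d ->
    `|u (x + h) - u x - dotp (grad u x) h - 2^-1 * qf (hess u x) h|
      <= e * `|h| ^+ 2.
Proof. by move=> su Ax; rewrite -(hess_sym su Ax); exact: taylor2_tr su Ax. Qed.

Lemma is_derive_chain n (f : 'rV[R]_n -> R) (p : 'rV[R]_n)
    (g : R -> 'rV[R]_n) (dg : 'rV[R]_n) (t : R) :
  eps_diff f p (g t) ->
  (forall i, is_derive t 1 (fun s => g s 0 i) (dg 0 i)) ->
  is_derive t 1 (f \o g) (dotp p dg).
Proof.
move=> df dgi; apply: is_derive_epsP => e e0.
pose S := \sum_i `|p 0 i|.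
have S0 : 0 <= S by exact: sumr_ge0.
pose C := `|dg| + 1.
have C0 : 0 < C by rewrite ltr_wpDl.
have e1 : 0 < e / 2 / C by rewrite !divr_gt0.
have [d d0 dP] := df _ e1.
pose eta := Order.min 1 (e / 2 / (S + 1)).
have eta0 : 0 < eta by rewrite lt_min ltr01 !divr_gt0 // ltr_wpDl.
have [d' d'0 d'P] : exists2 d', 0 < d' & forall i h, `|h| < d' ->
    `|g (t + h) 0 i - g t 0 i - dg 0 i * h| <= eta * `|h|.
  have : forall i : 'I_n, exists d', 0 < d' /\ forall h, `|h| < d' ->
      `|g (t + h) 0 i - g t 0 i - dg 0 i * h| <= eta * `|h|.
    by move=> i; have [d' ? ?] := is_derive_eps (dgi i) eta0; exists d'.
  move=> /choice[d' d'P]; exists (\big[Order.min/1]_i d' i).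
    by apply/bigmin_gtP; split => // i _; have [] := d'P i.
  move=> i h hd; apply: (d'P i).2; apply: lt_le_trans hd _.
  exact: bigmin_le_cond.
exists (Order.min d' (d / C)); first by rewrite lt_min d'0 divr_gt0.
move=> h; rewrite lt_min => /andP[hd' hd].
pose k := g (t + h) - g t.
have kle : `|k| <= C * `|h|.
  apply: norm_le_coord => [|i]; first by rewrite mulr_ge0 // ltW.
  have -> : k 0 i = (g (t + h) 0 i - g t 0 i - dg 0 i * h) + dg 0 i * h.
    by rewrite /k !mxE subrK.
  apply: le_trans (ler_normD _ _) _; rewrite /C mulrDl addrC lerD //.
    by rewrite normrM ler_wpM2r // coord_le_norm.
  apply: le_trans (d'P i h hd') _; rewrite ler_wpM2r //.
  by rewrite /eta ge_min lexx.
have kd : `|k| < d by apply: le_lt_trans kle _; rewrite mulrC -ltr_pdivlMr.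
have := dP k kd; rewrite {1}/k [g t + _]addrC subrK => H1.
rewrite /=.
have -> : f (g (t + h)) - f (g t) - dotp p dg * h =
  (f (g (t + h)) - f (g t) - \sum_i p 0 i * k 0 i) +
   \sum_i p 0 i * (k 0 i - dg 0 i * h).
  rewrite dotpE mulr_suml -[RHS]addrA; congr (_ + _).
  rewrite -sumrN -sumrN -big_split; apply: eq_bigr => i _ /=; ring.
apply: le_trans (ler_normD _ _) _.
have -> : e * `|h| = e / 2 * `|h| + e / 2 * `|h| by field.
apply: lerD.
  apply: le_trans H1 _; rewrite -[leRHS](_ : e / 2 / C * (C * `|h|) = _).
    by rewrite ler_pM2l.
  by field; rewrite gt_eqF.
apply: le_trans (ler_norm_sum _ _ _) _.
apply: le_trans (_ : \sum_i `|p 0 i| * (eta * `|h|) <= _).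
  apply: ler_sum => i _; rewrite normrM ler_wpM2l //.
  by have := d'P i h hd'; rewrite /k !mxE.
rewrite -mulr_suml mulrA ler_wpM2r // -/S.
apply: le_trans (_ : S * (e / 2 / (S + 1)) <= _).
  by rewrite ler_wpM2l // /eta ge_min lexx orbT.
rewrite mulrCA ger_pMr ?divr_gt0 // ler_pdivrMr ?ltr_wpDl // mul1r.
by rewrite lerDl.
Qed.

(** The derivative is known to be positive only while [g < 1], so [g] need not be monotone. If
    [g T <= s], a minimum is attained at a positive time with value at most [s < 1], where [g] is
    still increasing and so takes smaller values just before. *)
Lemma gt_of_barrier (g dg : R -> R) (T s : R) : 0 < T -> s < 1 ->
  (forall t, 0 <= t <= T -> is_derive t 1 g (dg t)) ->
  g 0 = s ->
  (forall t, 0 <= t <= T -> g t < 1 -> 0 < dg t) -> s < g T.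
Proof.
move=> T0 s1 gdg gs dg0; rewrite ltNge; apply/negP => gTs.
have [|t] := @EVT_min R g 0 T (ltW T0).
  apply: derivable_within_continuous => t; rewrite in_itv /= => t0.
  by have [] := gdg t t0.
rewrite in_itv /= => t0T tmin.
have zT : 0 \in `[0, T]%R by rewrite in_itv /= lexx ltW.
(* A minimum located at 0 can be moved to [T], because [g T <= s = g 0]. *)
have [t' [t'0 t'T t'min gt's]] : exists t', [/\ 0 < t', t' <= T,
    (forall r, r \in `[0, T]%R -> g t' <= g r) & g t' <= s].
  have [t0|t0] := ltP 0 t.
    by exists t; split => //; [case/andP: t0T|rewrite -gs tmin].
  have tE : t = 0 by apply/eqP; rewrite eq_le t0; case/andP: t0T.
  exists T; split => // r rT; apply: le_trans gTs _.
  by rewrite -gs -{1}tE tmin.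
have t'I : 0 <= t' <= T by rewrite ltW.
have d0 : 0 < dg t' by apply: dg0 => //; exact: le_lt_trans gt's s1.
have d2 : 0 < dg t' / 2 by rewrite divr_gt0.
have [d dp dP] := is_derive_eps (gdg _ t'I) d2.
pose h := Order.min (d / 2) t'.
have h0 : 0 < h by rewrite lt_min t'0 divr_gt0.
have hd : `|- h| < d.
  rewrite normrN gtr0_norm // gt_min [d / 2 < d]gtr_pMr // invf_lt1 //.
  by rewrite ltr1n.
have := dP _ hd; rewrite normrN (gtr0_norm h0) ler_norml => /andP[_ H].
have ht : h <= t' by rewrite ge_min lexx orbT.
have := t'min (t' - h); rewrite in_itv /= subr_ge0 ht /=.
have -> : t' - h <= T by lra.
move=> /(_ isT); nra.
Qed.
End Calculus2.

(** * Flow of the curvatures along parallel surfaces *)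

Section CurvatureFunctions.
Set Implicit Arguments.
Unset Strict Implicit.
Unset Printing Implicit Defensive.
Import numFieldNormedType.Exports.
Variable R : realType.
Definition psi n (t : R) (l : 'rV[R]_n) : 'rV[R]_n :=
  \row_i ((l 0 i + t) / (1 + t * l 0 i)).

(** The interface between [f] and the geometry. It is derived from the structure conditions and the
    extra condition in the general case, and by direct computation for the curvature quotients. *)
Record comparison_function n (f : 'rV[R]_n -> R) (s : R) : Prop := {
  cf_symm : symmetric_on_K f;
  cf_mono : forall a b : 'rV[R]_n, Kpos a -> (forall i, a 0 i <= b 0 i) ->
    f a <= f b;
  cf_diag : forall t : R, 0 < t -> f (const_mx t) = t;
  cf_flow : forall (t : R) (l : 'rV[R]_n), 0 < t < 1 -> Kpos l -> f l = s ->
    s < f (psi t l) }.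

Lemma psi_pos n (t : R) (l : 'rV[R]_n) : 0 <= t -> Kpos l -> Kpos (psi t l).
Proof.
move=> t0 lK i; have li := lK i.
rewrite mxE divr_gt0 //; first exact: ltr_wpDr.
by apply: ltr_wpDr => //; rewrite mulr_ge0 // ltW.
Qed.

(** The Riccati equation [k' = 1 - k^2] of parallel surfaces, reparametrized by [t = tanh d], for
    which [dt = (1 - t^2) dd]. *)
Lemma is_derive_psi (l t : R) : 0 <= t < 1 -> 0 < l ->
  is_derive t 1 (fun s => (l + s) / (1 + s * l))
    ((1 - ((l + t) / (1 + t * l)) ^+ 2) / (1 - t ^+ 2)).
Proof.
move=> /andP[t0 t1] l0.
have d0 : 1 + t * l != 0 by rewrite gt_eqF // ltr_wpDr ?mulr_ge0 // ltW.
have e0 : 1 - t ^+ 2 != 0 by rewrite gt_eqF // subr_gt0 expr_lt1.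
have sE (a b : R) : a *: (b : R^o) = a * b by [].
have dd : is_derive t 1 (fun s : R => 1 + s * l) l.
  by apply: is_derive_eq; rewrite !sE; ring.
have dv : is_derive t 1 (fun s : R => (1 + s * l)^-1) (- (1 + t * l) ^- 2 *: l).
  exact: is_deriveV.
apply: is_derive_eq; rewrite !sE; field.
by rewrite d0 e0.
Qed.

(** Monotonicity comes from [f_i > 0] along a segment. Along the parallel flow the derivative of [f]
    is a positive multiple of [sum f_i - sum k_i^2 f_i], positive while [f < 1]; since [f] may pass
    1 on the way, the barrier lemma concludes. *)
Lemma structure_comparison n (f : 'rV[R]_n -> R) (s : R) : 0 < s < 1 ->
  structure_conditions f -> extra_condition f -> comparison_function f s.
Proof.
move=> /andP[s0 s1] [sf [symf [f1 [_ [fpos [_ [fone [homf _]]]]]]]] extraf.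
have df x : Kpos x -> eps_diff f (grad f x) x.
  by move=> Kx; exact: (smooth_eps_diff [::] sf Kx).
split => //.
- move=> a b Ka ab.
  pose g (t : R) : 'rV[R]_n := a + t *: (b - a).
  have gi (t : R) i : g t 0 i = a 0 i + t * (b 0 i - a 0 i) by rewrite !mxE.
  have Kg (t : R) : 0 <= t <= 1 -> Kpos (g t).
    move=> /andP[t0 _] i; rewrite gi ltr_wpDr //.
    by rewrite mulr_ge0 // subr_ge0.
  have dg (t : R) : 0 <= t <= 1 ->
      is_derive t 1 (f \o g) (dotp (grad f (g t)) (b - a)).
    move=> t01; apply: is_derive_chain; first exact/df/Kg.
    move=> i; under eq_fun do rewrite gi.
    have sE (x y : R) : x *: (y : R^o) = x * y by [].
    by apply: is_derive_eq; rewrite !mxE !sE; ring.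
  have [|||c c01 E] := @MVT_segment R (f \o g)
      (fun t => dotp (grad f (g t)) (b - a)) 0 1.
  + exact: ler01.
  + by move=> t; rewrite in_itv /= => /andP[t0 t1]; apply: dg; rewrite !ltW.
  + apply: derivable_within_continuous => t; rewrite in_itv /= => t01.
    by have [] := dg t t01.
  rewrite in_itv /= in c01.
  rewrite -subr_ge0; move: E; rewrite /g /= scale1r scale0r addr0 subrKC => ->.
  rewrite subr0 mulr1 dotpE sumr_ge0 // => i _.
  by rewrite !mxE mulr_ge0 ?subr_ge0 // ltW // f1 //; exact: Kg.
- move=> t t0; have -> : const_mx t = t *: one_vec R n.
    by apply/rowP => i; rewrite !mxE mulr1.
  by rewrite homf // ?fone ?mulr1 // => i; rewrite mxE.
move=> t l /andP[t0 t1] Kl fl.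
have dg (r : R) : 0 <= r <= t -> is_derive r 1 (f \o (fun r => psi r l))
   (dotp (grad f (psi r l)) (\row_i ((1 - psi r l 0 i ^+ 2) / (1 - r ^+ 2)))).
  move=> /andP[r0 rt]; apply: is_derive_chain; first exact/df/psi_pos.
  move=> i; under eq_fun do rewrite mxE.
  rewrite !mxE; apply: is_derive_psi; first by rewrite r0 (le_lt_trans rt).
  exact: Kl.
apply: (@gt_of_barrier R (f \o (fun r => psi r l)) _ t s t0 s1 dg).
  rewrite /= -fl; congr f; apply/rowP => i.
  by rewrite mxE addr0 mul0r addr0 divr1.
move=> r /andP[r0 rt] /= fr.
have r1 : 0 < 1 - r ^+ 2 by rewrite subr_gt0 expr_lt1 // (le_lt_trans rt).
have Kr := psi_pos r0 Kl.
have -> : dotp (grad f (psi r l)) (\row_i ((1 - psi r l 0 i ^+ 2) / (1 - r ^+ 2)))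
   = (\sum_i partial f i (psi r l) -
      \sum_i psi r l 0 i ^+ 2 * partial f i (psi r l)) / (1 - r ^+ 2).
  rewrite dotpE -sumrB mulr_suml; apply: eq_bigr => i _.
  by rewrite [grad _ _ _ _]mxE [(\row_i _) 0 i]mxE; ring.
rewrite divr_gt0 // subr_gt0; apply: extraf => //.
by rewrite fr fpos.
Qed.
End CurvatureFunctions.

(** * Curvature quotients in terms of the principal radii *)

Section CurvatureQuotients.
Set Implicit Arguments.
Unset Strict Implicit.
Unset Printing Implicit Defensive.
Import numFieldNormedType.Exports.
Variable R : realType.
Definition row_inv n (l : 'rV[R]_n) : 'rV[R]_n := \row_i (l 0 i)^-1.

Lemma row_inv_pos n (l : 'rV[R]_n) : Kpos l -> Kpos (row_inv l).
Proof. by move=> lK i; rewrite mxE invr_gt0. Qed.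

Lemma psi_row_inv n (t : R) (l : 'rV[R]_n) : 0 <= t -> Kpos l ->
  psi t (row_inv l) = row_inv (psi t l).
Proof.
move=> t0 lK; apply/rowP => i; rewrite !mxE; have li : 0 < l 0 i by exact: lK.
have lt0 : 0 < l 0 i + t by exact: ltr_wpDr.
have tl0 : 0 < 1 + t * l 0 i by apply: ltr_wpDr => //; rewrite mulr_ge0 // ltW.
by field; rewrite !gt_eqF // addrC.
Qed.

Lemma esym_compl n k (l : 'rV[R]_n) : (k <= n)%N -> Kpos l ->
  Defs.esym k l = (\prod_i l 0 i) * Defs.esym (n - k) (row_inv l).
Proof.
move=> kn lK; rewrite /Defs.esym (reindex_inj (@finset.setC_inj 'I_n)) /= mulr_sumr.
apply: eq_big => [I|I _].
  have := cardsC I; rewrite card_ord => E.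
  apply/eqP/eqP => H; first by apply: (@addIn k); rewrite subnK // -[in LHS]H E.
  by apply/eqP; rewrite -(eqn_add2l (n - k)%N) -{1}H E subnK.
rewrite [\prod_i l 0 i](bigID (mem I)) /= [X in X * _]mulrC -mulrA -big_split /=.
rewrite [X in _ * X]big1 => [|i _].
  by rewrite mulr1; apply: eq_bigl => i; rewrite !inE.
by rewrite mxE mulfV // gt_eqF //; exact: lK.
Qed.

Lemma esym_perm n k (p : 'S_n) (l : 'rV[R]_n) :
  Defs.esym k (\row_i l 0 (p i)) = Defs.esym k l.
Proof.
rewrite /Defs.esym; have hinj : injective (fun I : {set 'I_n} => p @^-1: I).
  move=> I J /setP E; apply/setP => j; have := E (p^-1 j)%g.
  by rewrite !inE permKV.
rewrite (reindex_inj hinj) /=; apply: eq_big => [I|I _].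
  by rewrite on_card_preimset //; exists (p^-1)%g => x _; rewrite ?permK ?permKV.
rewrite [RHS](reindex_inj (@perm_inj _ p)) /=; apply: eq_big => i.
  by rewrite inE.
by rewrite mxE.
Qed.

Lemma esym_le n k (a b : 'rV[R]_n) :
  (forall i, 0 <= a 0 i <= b 0 i) -> Defs.esym k a <= Defs.esym k b.
Proof. by move=> ab; apply: ler_sum => I _; apply: ler_prod => i _. Qed.

Lemma esym_const n k (c : R) :
  Defs.esym k (const_mx c : 'rV[R]_n) = 'C(n, k)%:R * c ^+ k.
Proof.
rewrite /Defs.esym; under eq_bigr => I /eqP Ik.
  under eq_bigr do rewrite mxE.
  rewrite prodr_const Ik; over.
rewrite sumr_const -[LHS]mulr_natl; congr (_%:R * _).
by rewrite -[in RHS](card_ord n) -card_draws cardsE.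
Qed.

Lemma esym_gt0 n k (a : 'rV[R]_n) : (k <= n)%N -> Kpos a -> 0 < Defs.esym k a.
Proof.
move=> kn aK; have : (0 < #|[set A : {set 'I_n} | #|A| == k]%SET|)%N.
  by rewrite card_draws card_ord bin_gt0.
rewrite card_gt0 => /set0Pn[I]; rewrite inE => Ik.
have pos (J : {set 'I_n}) : 0 < \prod_(i in J) a 0 i.
  by apply: prodr_gt0 => i _; exact: aK.
rewrite /Defs.esym (bigD1 I) //= ltr_wpDr // sumr_ge0 // => J _.
exact: ltW.
Qed.

Lemma esym0 n (a : 'rV[R]_n) : Defs.esym 0 a = 1.
Proof.
rewrite /Defs.esym (big_pred1 finset.set0) ?big_set0 // => I.
by rewrite cards_eq0.
Qed.

Lemma esym1 n (a : 'rV[R]_n) : Defs.esym 1 a = \sum_i a 0 i.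
Proof.
rewrite /Defs.esym [RHS](partition_big (fun i => [set i]%SET) (fun I => #|I| == 1%N)) /=.
  apply: eq_bigr => I /cards1P[x ->]; rewrite big_set1 (big_pred1 x) // => i.
  by rewrite (inj_eq finset.set1_inj).
by move=> i _; rewrite cards1.
Qed.

Lemma esym2 n (a : 'rV[R]_n) :
  2 * Defs.esym 2 a = (\sum_i a 0 i) ^+ 2 - \sum_i a 0 i ^+ 2.
Proof.
have -> : (\sum_i a 0 i) ^+ 2 - \sum_i a 0 i ^+ 2 =
    \sum_(q : 'I_n * 'I_n | q.1 != q.2) a 0 q.1 * a 0 q.2.
  rewrite expr2 big_distrlr /= pair_big /= (bigID (fun q => q.1 == q.2)) /=.
  have -> : \sum_(q : 'I_n * 'I_n | q.1 == q.2) a 0 q.1 * a 0 q.2 =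
      \sum_i a 0 i ^+ 2.
    rewrite (reindex_onto (fun i => (i, i)) (fun q => q.1)) /= => [|[i j] /eqP /= ->//].
    by apply: eq_big => i; rewrite ?eqxx // expr2.
  by rewrite [X in X - _]addrC addrK.
rewrite /Defs.esym [RHS](partition_big (fun q => [set q.1; q.2]%SET)
   (fun I => #|I| == 2%N)) /=; last first.
  by move=> q qq; rewrite cards2 qq.
rewrite mulr_sumr; apply: eq_bigr => I /cards2P[x [y [xy ->]]].
rewrite big_setU1 ?inE //= big_set1.
rewrite (bigD1 (x, y)) /= ?xy ?eqxx // (bigD1 (y, x)) /=; last first.
  by rewrite eq_sym xy finset.setUC eqxx xpair_eqE eq_sym (negPf xy).
rewrite big1 => [|[i j] /=]; first by ring.
case/andP => /andP[/andP[ij /eqP/setP E] n1] n2; exfalso.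
have := E i; have := E j; rewrite !inE !eqxx ?orbT /= => /ssrfun.esym Ej /ssrfun.esym Ei.
move: ij n1 n2; rewrite !xpair_eqE.
case/orP: Ei => /eqP ->; case/orP: Ej => /eqP ->; by rewrite ?eqxx.
Qed.

Lemma esym1_flow n (t : R) (r : 'rV[R]_n) : 0 < t < 1 -> Kpos r ->
  n%:R < Defs.esym 1 r -> Defs.esym 1 (psi t r) < Defs.esym 1 r.
Proof.
move=> /andP[t0 t1] rK; rewrite !esym1 => nr.
(* The slope at 1 of [k -> (k + t)/(1 + t k)]. *)
pose c := (1 - t) / (1 + t).
have t1' : 0 < 1 + t by lra.
have c1 : 0 < 1 - c.
  have -> : 1 - c = 2 * t / (1 + t) by rewrite /c; field; rewrite gt_eqF.
  by rewrite divr_gt0 // mulr_gt0.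
(* [psi t] is concave and fixes 1: it lies below its tangent there *)
have tang i : psi t r 0 i <= 1 - c + c * r 0 i.
  have ri : 0 < r 0 i by exact: rK.
  have d0 : 0 < 1 + t * r 0 i by apply: ltr_wpDr => //; exact: mulr_ge0 (ltW t0) (ltW ri).
  rewrite mxE -subr_ge0.
  have -> : 1 - c + c * r 0 i - (r 0 i + t) / (1 + t * r 0 i) =
      t * (1 - t) * (r 0 i - 1) ^+ 2 / ((1 + t) * (1 + t * r 0 i)).
    by rewrite /c; field; rewrite !gt_eqF.
  apply: divr_ge0; last by apply: mulr_ge0; exact: ltW.
  by apply: mulr_ge0; [apply: mulr_ge0; rewrite ?subr_ge0 ltW|exact: sqr_ge0].
have : \sum_i psi t r 0 i <= \sum_i (1 - c + c * r 0 i) by apply: ler_sum => j _; exact: tang.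
rewrite big_split /= sumr_const card_ord -mulr_sumr -mulr_natl; nra.
Qed.

(** Chebyshev's sum inequality for the sequences [r_i] and [r_i (p1 - r_i)], where [p1] is the sum
    of the [r_i]. They are similarly ordered because the product of their differences is
    [(r_i - r_j)^2 (p1 - r_i - r_j)], and [p1 >= r_i + r_j] for distinct indices. *)
Lemma chebyshev_sum n (r : 'rV[R]_n) : Kpos r ->
  (\sum_i r 0 i) * ((\sum_i r 0 i) ^+ 2 - \sum_i r 0 i ^+ 2) <=
  n%:R * ((\sum_i r 0 i) * (\sum_i r 0 i ^+ 2) - \sum_i r 0 i ^+ 3).
Proof.
move=> rK; set p1 := \sum_i r 0 i; set p2 := \sum_i r 0 i ^+ 2.
set p3 := \sum_i r 0 i ^+ 3.
have : 0 <= \sum_i \sum_j (r 0 i - r 0 j) ^+ 2 * (p1 - r 0 i - r 0 j).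
  apply: sumr_ge0 => i _; apply: sumr_ge0 => j _.
  have [->|ij] := eqVneq i j; first by rewrite subrr expr0n mul0r.
  rewrite mulr_ge0 ?sqr_ge0 // /p1 (bigD1 i) //= (bigD1 j) 1?eq_sym //=.
  rewrite [X in 0 <= X](_ : _ = \sum_(k | (k != i) && (k != j)) r 0 k).
    by apply: sumr_ge0 => k _; rewrite ltW //; exact: rK.
  by ring.
have -> : \sum_i \sum_j (r 0 i - r 0 j) ^+ 2 * (p1 - r 0 i - r 0 j) =
   \sum_i (n%:R * (p1 * r 0 i ^+ 2 - r 0 i ^+ 3) - p1 * (2 * p1 * r 0 i)
     + r 0 i ^+ 2 * p1 + r 0 i * p2 + p1 * p2 - p3).
  apply: eq_bigr => i _.
  have -> : n%:R * (p1 * r 0 i ^+ 2 - r 0 i ^+ 3) =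
     \sum_(j < n) (p1 * r 0 i ^+ 2 - r 0 i ^+ 3).
    by rewrite sumr_const card_ord mulr_natl.
  have -> : p1 * (2 * p1 * r 0 i) = \sum_j r 0 j * (2 * p1 * r 0 i).
    by rewrite -mulr_suml.
  have -> : r 0 i ^+ 2 * p1 = \sum_j r 0 i ^+ 2 * r 0 j by rewrite -mulr_sumr.
  have -> : r 0 i * p2 = \sum_j r 0 i * r 0 j ^+ 2 by rewrite -mulr_sumr.
  have -> : p1 * p2 = \sum_j p1 * r 0 j ^+ 2 by rewrite -mulr_sumr.
  rewrite /p3 -!sumrN -!big_split /=; apply: eq_bigr => j _; ring.
have cst (c : R) : \sum_(i < n) c = n%:R * c.
  by rewrite sumr_const card_ord mulr_natl.
rewrite !big_split /= !sumrN !cst.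
rewrite -!mulr_sumr -!mulr_suml big_split /= sumrN -!mulr_sumr -/p1 -/p2 -/p3.
lra.
Qed.

(** Up to a positive factor, the derivative of [p1^2 - p2] along the flow is
    [(n - 1) p1 - (p1 p2 - p3)], with [pk] the power sums. By the Chebyshev inequality this is
    negative as long as [p1^2 - p2 > n (n - 1)], that is, while the normalized [H_2] exceeds 1. *)
Lemma esym2_flow n (t : R) (r : 'rV[R]_n) : 0 < t < 1 -> Kpos r ->
  (1 < n)%N -> 'C(n, 2)%:R < Defs.esym 2 r -> Defs.esym 2 (psi t r) < Defs.esym 2 r.
Proof.
move=> /andP[t0 t1] rK n1 nr.
pose N : R := n%:R * (n%:R - 1).
have CN : 2 * 'C(n, 2)%:R = N.
  have := bin_ffact n 2; rewrite ffactnS ffactn1 => /(congr1 (fun k => k%:R : R)).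
  by rewrite !natrM /N -subn1 natrB 1?ltnW // => <-; rewrite mulrC.
pose p k (s : R) := \sum_i psi s r 0 i ^+ k.
(* Reflection at 1 turns [H_2 > 1] into [g < 1], the form of the barrier lemma. *)
pose g s := 2 - Defs.esym 2 (psi s r) / 'C(n, 2)%:R.
have C0 : 0 < 'C(n, 2)%:R :> R by rewrite ltr0n bin_gt0.
have n0 : 0 < n%:R :> R by rewrite ltr0n (ltn_trans _ n1).
have N0 : 0 < N by rewrite -CN mulr_gt0.
pose dg s := - (2 * p 1%N s * (n%:R - p 2%N s) - 2 * (p 1%N s - p 3%N s)) /
    (1 - s ^+ 2) / N.
have gE s : g s = 2 - ((\sum_i psi s r 0 i) ^+ 2 - \sum_i psi s r 0 i ^+ 2) / N.
  rewrite /g -esym2 -CN; congr (_ - _); field; by rewrite gt_eqF.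
have sE (a b : R) : a *: (b : R^o) = a * b by [].
have dpsi (s : R) i : 0 <= s <= t -> is_derive s 1 (fun s => psi s r 0 i)
    ((1 - psi s r 0 i ^+ 2) / (1 - s ^+ 2)).
  move=> /andP[s0 st]; under eq_fun do rewrite mxE.
  rewrite mxE; apply: is_derive_psi; first by rewrite s0 (le_lt_trans st).
  exact: rK.
have s21 (s : R) : 0 <= s <= t -> 0 < 1 - s ^+ 2.
  by move=> /andP[s0 st]; rewrite subr_gt0 expr_lt1 // (le_lt_trans st).
have gdg (s : R) : 0 <= s <= t -> is_derive s 1 g (dg s).
  move=> st; have s2 := s21 s st.
  have -> : g = (fun s => 2 - ((\sum_i (fun s => psi s r 0 i)) s ^+ 2 -
      (\sum_i (fun s => psi s r 0 i ^+ 2)) s) * N^-1).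
    by apply/funext => z; rewrite gE !fct_sumE.
  have d1 : is_derive s 1 (\sum_i (fun s => psi s r 0 i) : R -> R)
      (\sum_i (1 - psi s r 0 i ^+ 2) / (1 - s ^+ 2)).
    by apply: is_derive_sum => i; exact: dpsi.
  have d2 : is_derive s 1 (\sum_i (fun s => psi s r 0 i ^+ 2) : R -> R)
      (\sum_i 2 * psi s r 0 i * ((1 - psi s r 0 i ^+ 2) / (1 - s ^+ 2))).
    apply: is_derive_sum => i; have di := dpsi s i st.
    by apply: is_derive_eq; rewrite !sE; ring.
  apply: is_derive_eq; rewrite !sE fct_sumE.
  have -> : \sum_i psi s r 0 i = p 1%N s by apply: eq_bigr => i _; rewrite expr1.
  have -> : \sum_i (1 - psi s r 0 i ^+ 2) / (1 - s ^+ 2) =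
      (n%:R - p 2%N s) / (1 - s ^+ 2).
    by rewrite -mulr_suml sumrB sumr_const card_ord.
  have -> : \sum_i 2 * psi s r 0 i * ((1 - psi s r 0 i ^+ 2) / (1 - s ^+ 2)) =
      2 * (p 1%N s - p 3%N s) / (1 - s ^+ 2).
    by rewrite -sumrB mulr_sumr mulr_suml; apply: eq_bigr => i _; ring.
  rewrite /dg; field; by rewrite !gt_eqF.
have psi0 : psi 0 r = r.
  by apply/rowP => i; rewrite mxE addr0 mul0r addr0 divr1.
have := @gt_of_barrier R g dg t (g 0) t0 _ gdg erefl _.
rewrite {3 4}/g psi0 ltrD2l ltrN2 ltr_pM2r ?invr_gt0 //; apply.
  rewrite /g psi0 ltrBlDl -ltrBlDr.
  have -> : 2 - 1 = 1 :> R by ring.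
  by rewrite ltr_pdivlMr // mul1r.
move=> s st; have s2 := s21 s st; case/andP: st => s0 st.
have Ks := psi_pos s0 rK.
have E1 : \sum_i psi s r 0 i = p 1%N s by apply: eq_bigr => i _; rewrite expr1.
have := chebyshev_sum Ks; rewrite gE E1 -/(p 2%N s) -/(p 3%N s) => ch.
rewrite ltrBlDl -ltrBlDr.
have -> : 2 - 1 = 1 :> R by ring.
rewrite ltr_pdivlMr // mul1r => gN.
have p10 : 0 < p 1%N s.
  have i0 : 'I_n by exact: Ordinal (ltn_trans (ltn0Sn 0) n1).
  have k0 : 0 < psi s r 0 i0 by exact: Ks.
  rewrite -E1 (bigD1 i0) //= ltr_wpDr // sumr_ge0 // => i _.
  by rewrite ltW //; exact: Ks.
rewrite /dg !divr_gt0 //.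
have : p 1%N s * N < p 1%N s * (p 1%N s ^+ 2 - p 2%N s) by rewrite ltr_pM2l.
move=> /lt_le_trans/(_ ch); rewrite /N mulrCA ltr_pM2l //; lra.
Qed.

Lemma Hquot_row_inv n k (l : 'rV[R]_n) : (k <= n)%N -> Kpos l ->
  Hquot k l = powR (Hnorm (n - k) (row_inv l))^-1 ((n - k)%:R)^-1.
Proof.
move=> kn lK; rewrite /Hquot; congr powR.
rewrite /Hnorm (esym_compl (leqnn n) lK) subnn esym0 mulr1 binn divr1.
rewrite (esym_compl kn lK) bin_sub //.
have P0 : 0 < \prod_i l 0 i by apply: prodr_gt0 => i _; exact: lK.
have E0 := esym_gt0 (leq_subr k n) (row_inv_pos lK).
have C0 : 0 < 'C(n, k)%:R :> R by rewrite ltr0n bin_gt0.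
by field; rewrite !gt_eqF.
Qed.

(** With [d = n - k], the quotient is a decreasing function of [H_d] of the radii. A level [s < 1]
    therefore lies in the region [H_d > 1], where the flow decreases [H_d] for [d = 1] and
    [d = 2]. *)
Lemma Hquot_comparison n k (s : R) : (0 < n)%N ->
  (k = n.-1 \/ ((1 < n)%N /\ k = n.-2)) -> 0 < s < 1 ->
  comparison_function (@Hquot R n k) s.
Proof.
move=> n0 kE /andP[s0 s1].
have [kn d0] : (k <= n)%N /\ (0 < n - k)%N by case: kE => [|[]]; lia.
set d := (n - k)%N in d0 *.
have dI : 0 < (d%:R : R)^-1 by rewrite invr_gt0 ltr0n.
have C0 : 0 < 'C(n, d)%:R :> R by rewrite ltr0n bin_gt0 leq_subr.
have H0 (l : 'rV[R]_n) : Kpos l -> 0 < Hnorm d (row_inv l).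
  by move=> lK; rewrite divr_gt0 // esym_gt0 ?leq_subr //; exact: row_inv_pos.
have flow (t : R) (r : 'rV[R]_n) : 0 < t < 1 -> Kpos r -> 1 < Hnorm d r ->
    Hnorm d (psi t r) < Hnorm d r.
  move=> t01 rK; rewrite /Hnorm ltr_pdivlMr // mul1r ltr_pM2r ?invr_gt0 //.
  have [d1|[n1 d2]] : d = 1%N \/ ((1 < n)%N /\ d = 2%N).
    by rewrite /d; case: kE => [|[]]; lia.
  - by rewrite d1 bin1; exact: esym1_flow.
  - by rewrite d2; exact: esym2_flow.
split.
- by move=> p l lK; rewrite /Hquot /Hnorm !esym_perm.
- move=> a b aK ab.
  have bK : Kpos b by move=> i; apply: lt_le_trans (ab i); exact: aK.
  have Ha := H0 a aK; have Hb := H0 b bK.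
  rewrite !Hquot_row_inv //; apply: (ge0_ler_powR (ltW dI)).
  - by rewrite nnegrE invr_ge0 ltW.
  - by rewrite nnegrE invr_ge0 ltW.
  rewrite lef_pV2 ?posrE ?H0 // ler_pM2r ?invr_gt0 //; apply: esym_le => i.
  by rewrite !mxE invr_ge0 ltW /= ?lef_pV2 ?posrE //.
- move=> t t0; have tK : Kpos (const_mx t : 'rV[R]_n) by move=> i; rewrite mxE.
  rewrite Hquot_row_inv //.
  have -> : row_inv (const_mx t : 'rV[R]_n) = const_mx t^-1.
    by apply/rowP => i; rewrite !mxE.
  rewrite /Hnorm esym_const mulrAC divff ?gt_eqF // mul1r exprVn invrK.
  rewrite -powR_mulrn ?ltW // -powRrM divff ?powRr1 ?ltW //.
  by rewrite pnatr_eq0 -lt0n.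
move=> t l t01 lK ls; have t0 : 0 <= t by case/andP: t01 => /ltW.
rewrite -ls !Hquot_row_inv //; last exact: psi_pos.
rewrite -psi_row_inv //; have rK := row_inv_pos lK.
have H1 : 1 < Hnorm d (row_inv l).
  rewrite ltNge; apply/negP => H1; move: s1; rewrite -ls Hquot_row_inv // ltNge.
  have p1 : powR 1 (d%:R)^-1 = 1 :> R by rewrite powR1.
  rewrite -[X in X <= _]p1 => /negP; apply.
  have Hl := H0 l lK; apply: (ge0_ler_powR (ltW dI)); rewrite ?nnegrE //.
    by rewrite invr_ge0 ltW.
  by rewrite -[X in X <= _]invr1 lef_pV2 ?posrE.
have P0 : 0 < Hnorm d (psi t (row_inv l)).
  by rewrite divr_gt0 // esym_gt0 ?leq_subr //; exact: psi_pos.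
have Hl := H0 l lK; apply: (gt0_ltr_powR dI).
- by rewrite nnegrE invr_ge0 ltW.
- by rewrite nnegrE invr_ge0 ltW.
by rewrite ltf_pV2 ?posrE //; exact: flow.
Qed.
End CurvatureQuotients.

(** * Taylor expansion of the two-point gap *)

Section SecondVariation.
Set Implicit Arguments.
Unset Strict Implicit.
Unset Printing Implicit Defensive.
Import numFieldNormedType.Exports.
Variable R : realType.
Lemma dotpC n (v w : 'rV[R]_n) : dotp v w = dotp w v.
Proof. by rewrite !dotpE; apply: eq_bigr => i _; rewrite mulrC. Qed.

Lemma dotpDl n (u v w : 'rV[R]_n) : dotp (u + v) w = dotp u w + dotp v w.
Proof. by rewrite /dotp mulmxDl mxE. Qed.

Lemma dotpZl n (t : R) (v w : 'rV[R]_n) : dotp (t *: v) w = t * dotp v w.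
Proof. by rewrite /dotp -scalemxAl mxE. Qed.

Lemma dotpNl n (v w : 'rV[R]_n) : dotp (- v) w = - dotp v w.
Proof. by rewrite -scaleN1r dotpZl mulN1r. Qed.

Lemma dotpDr n (u v w : 'rV[R]_n) : dotp w (u + v) = dotp w u + dotp w v.
Proof. by rewrite dotpC dotpDl !(dotpC w). Qed.

Lemma dotpZr n (t : R) (v w : 'rV[R]_n) : dotp w (t *: v) = t * dotp w v.
Proof. by rewrite dotpC dotpZl dotpC. Qed.

Lemma dotpNr n (v w : 'rV[R]_n) : dotp w (- v) = - dotp w v.
Proof. by rewrite dotpC dotpNl dotpC. Qed.

Definition dotp_lin := (dotpDl, dotpDr, dotpZl, dotpZr, dotpNl, dotpNr).

Lemma dotp_ge0 n (v : 'rV[R]_n) : 0 <= dotp v v.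
Proof. by rewrite dotpE sumr_ge0 // => i _; rewrite -expr2 sqr_ge0. Qed.

Lemma dotp_norm_le n (v : 'rV[R]_n) : `|v| ^+ 2 <= dotp v v.
Proof.
have : `|v| <= Num.sqrt (dotp v v).
  apply: norm_le_coord => [|i]; first exact: sqrtr_ge0.
  rewrite -sqrtr_sqr ler_wsqrtr // dotpE (bigD1 i) //= -expr2 lerDl.
  by apply: sumr_ge0 => j _; rewrite -expr2 sqr_ge0.
by rewrite -(ler_sqr (x := `|v|)) ?nnegrE ?sqrtr_ge0 // sqr_sqrtr // dotp_ge0.
Qed.

Lemma dotp_eq0 n (v : 'rV[R]_n) : dotp v v <= 0 -> v = 0.
Proof.
move=> v0; apply/eqP; rewrite -normr_le0 -(ler_sqr (x := `|v|)) ?nnegrE //.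
by rewrite expr0n; apply: le_trans (dotp_norm_le v) v0.
Qed.

(** The norm dual to the max norm carried by row vectors. *)
Definition l1norm n (v : 'rV[R]_n) : R := \sum_i `|v 0 i|.

Lemma l1norm_ge0 n (v : 'rV[R]_n) : 0 <= l1norm v.
Proof. exact: sumr_ge0. Qed.

Lemma dotp_le n (v w : 'rV[R]_n) : `|dotp v w| <= l1norm v * `|w|.
Proof.
rewrite dotpE mulr_suml (le_trans (ler_norm_sum _ _ _)) //.
by apply: ler_sum => i _; rewrite normrM ler_wpM2l // coord_le_norm.
Qed.

Lemma qfZ n (A : 'M[R]_n) (t : R) (v : 'rV[R]_n) :
  qf A (t *: v) = t ^+ 2 * qf A v.
Proof.
by rewrite !qfE mulr_sumr; apply: eq_bigr => i _; rewrite mulr_sumr;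
  apply: eq_bigr => j _; rewrite !mxE; ring.
Qed.

(* For m = cosh d, it vanishes exactly when the hyperbolic distance between
   (x, u x) and (y, v y) is d. *)
Definition sphere_gap n (m : R) (u v : 'rV[R]_n -> R) (x y : 'rV[R]_n) : R :=
  dotp (x - y) (x - y) + u x ^+ 2 + v y ^+ 2 - 2 * m * u x * v y.

(** The full second-order Taylor term of the gap in the increments [a] and [b], factor one half
    included. *)
Definition gap_hess n (m : R) (u v : 'rV[R]_n -> R) (x y a b : 'rV[R]_n) : R :=
  dotp a a + dotp (grad u x) a ^+ 2 - (m * v y - u x) * qf (hess u x) a +
  (dotp b b + dotp (grad v y) b ^+ 2 + (v y - m * u x) * qf (hess v y) b) -
  2 * (dotp a b + m * dotp (grad u x) a * dotp (grad v y) b).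

Definition gap_grad n (m : R) (u v : 'rV[R]_n -> R) (x y a b : 'rV[R]_n) : R :=
  2 * (dotp (x - y) a - (m * v y - u x) * dotp (grad u x) a) +
  2 * ((v y - m * u x) * dotp (grad v y) b - dotp (x - y) b).

Lemma jet2 n (A : set 'rV[R]_n) u x : smooth_on A u -> A x ->
  exists2 C, 0 < C & forall e, 0 < e -> exists2 d, 0 < d & forall h, `|h| < d ->
    [/\ `|u (x + h) - u x - dotp (grad u x) h - 2^-1 * qf (hess u x) h|
         <= e * `|h| ^+ 2,
        `|u (x + h) - u x - dotp (grad u x) h| <= e * `|h|,
        `|u (x + h) - u x| <= C * `|h| & `|dotp (grad u x) h| <= C * `|h|].
Proof.
move=> su Ax; exists (l1norm (grad u x) + 1); first by rewrite ltr_wpDl // l1norm_ge0.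
move=> e e0; have [d1 d10 dP1] := taylor2 su Ax e0.
pose e' := Order.min e 1.
have e'0 : 0 < e' by rewrite lt_min e0 ltr01.
have [d2 d20 dP2] := smooth_eps_diff [::] su Ax e'0.
exists (Order.min d1 d2); first by rewrite lt_min d10.
move=> h; rewrite lt_min => /andP[h1 h2].
have H2 := dP2 h h2; rewrite /= -dotpE in H2.
have le1 : e' * `|h| <= `|h| by rewrite ler_piMl // /e' ge_min lexx orbT.
have le2 : e' * `|h| <= e * `|h| by rewrite ler_wpM2r // /e' ge_min lexx.
have n1 := dotp_le (grad u x) h.
split; first exact: dP1.
- exact: le_trans H2 le2.
- rewrite -[X in `|X|](subrK (dotp (grad u x) h)).
  apply: le_trans (ler_normD _ _) _; rewrite mulrDl mul1r addrC lerD //.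
  exact: le_trans H2 le1.
- by apply: le_trans n1 _; rewrite ler_wpM2r // lerDl.
Qed.

Lemma gap_expand n (A : set 'rV[R]_n) m u v x y :
  smooth_on A u -> smooth_on A v -> A x -> A y ->
  forall e, 0 < e -> exists2 d, 0 < d & forall a b, `|a| < d -> `|b| < d ->
    `|sphere_gap m u v (x + a) (y + b) - sphere_gap m u v x y -
      gap_grad m u v x y a b - gap_hess m u v x y a b| <=
    e * (`|a| ^+ 2 + `|b| ^+ 2).
Proof.
move=> su sv Ax Ay e e0.
have [C C0 CP] := jet2 su Ax; have [D D0 DP] := jet2 sv Ay.
(* The remainder equals five terms exactly, each containing a Taylor error of [u] or [v] as a
   factor; [K] adds up their coefficients. *)
pose K := 2 * `|u x - m * v y| + 2 * `|v y - m * u x| + 2 * C + 2 * D +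
  2 * `|m| * (C + D) + 1.
have m0 := normr_ge0 m.
have K0 : 0 < K.
  have := normr_ge0 (u x - m * v y); have := normr_ge0 (v y - m * u x).
  have : 0 <= `|m| * (C + D) by rewrite mulr_ge0 // addr_ge0 // ltW.
  by rewrite /K -!mulrA; lra.
have eK : 0 < e / K by rewrite divr_gt0.
have [d1 d10 dP1] := CP _ eK; have [d2 d20 dP2] := DP _ eK.
exists (Order.min d1 d2); first by rewrite lt_min d10.
move=> a b; rewrite !lt_min => /andP[a1 _] /andP[_ b2].
have [A1 A2 A3 A4] := dP1 a a1; have [B1 B2 B3 B4] := dP2 b b2.
set r := _ - 2^-1 * qf (hess u x) a in A1.
set r' := _ - 2^-1 * qf (hess v y) b in B1.
set p := dotp (grad u x) a in A2 A4 r A1; set q := dotp (grad v y) b in B2 B4 r' B1.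
set U := u (x + a) - u x in A2 A3 r A1; set V := v (y + b) - v y in B2 B3 r' B1.
have -> : sphere_gap m u v (x + a) (y + b) - sphere_gap m u v x y -
      gap_grad m u v x y a b - gap_hess m u v x y a b =
   2 * (u x - m * v y) * r + 2 * (v y - m * u x) * r' + (U - p) * (U + p) +
   (V - q) * (V + q) - 2 * m * (U * (V - q) + (U - p) * q).
  rewrite /sphere_gap /gap_grad /gap_hess -/p -/q.
  have -> : u (x + a) = u x + U by rewrite /U [RHS]addrC subrK.
  have -> : v (y + b) = v y + V by rewrite /V [RHS]addrC subrK.
  rewrite !dotp_lin !(dotpC y) !(dotpC b) !(dotpC a x) /r /r'. by field.
have na := normr_ge0 a; have nb := normr_ge0 b.
have ab : `|a| * `|b| <= `|a| ^+ 2 + `|b| ^+ 2 by nra.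
apply: (@le_trans _ _ (e / K * (K * (`|a| ^+ 2 + `|b| ^+ 2)))); last first.
  by rewrite mulrA divfK // gt_eqF.
have eK' := ltW eK.
have t1 : `|2 * (u x - m * v y) * r| <= e / K * (2 * `|u x - m * v y| * `|a| ^+ 2).
  rewrite normrM normrM (ger0_norm (ler0n R 2)) mulrCA.
  by rewrite ler_wpM2l // mulr_ge0.
have t2 : `|2 * (v y - m * u x) * r'| <= e / K * (2 * `|v y - m * u x| * `|b| ^+ 2).
  rewrite normrM normrM (ger0_norm (ler0n R 2)) mulrCA.
  by rewrite ler_wpM2l // mulr_ge0.
have t3 : `|(U - p) * (U + p)| <= e / K * (2 * C * `|a| ^+ 2).
  have -> : e / K * (2 * C * `|a| ^+ 2) = (e / K * `|a|) * (C * `|a| + C * `|a|).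
    by ring.
  rewrite normrM ler_pM //.
  by apply: le_trans (ler_normD _ _) _; exact: lerD.
have t4 : `|(V - q) * (V + q)| <= e / K * (2 * D * `|b| ^+ 2).
  have -> : e / K * (2 * D * `|b| ^+ 2) = (e / K * `|b|) * (D * `|b| + D * `|b|).
    by ring.
  rewrite normrM ler_pM //.
  by apply: le_trans (ler_normD _ _) _; exact: lerD.
have t5 : `|2 * m * (U * (V - q) + (U - p) * q)| <=
    e / K * (2 * `|m| * (C + D) * (`|a| * `|b|)).
  have -> : e / K * (2 * `|m| * (C + D) * (`|a| * `|b|)) =
     2 * `|m| * ((C * `|a|) * (e / K * `|b|) + (e / K * `|a|) * (D * `|b|)).
    by ring.
  rewrite normrM normrM (ger0_norm (ler0n R 2)) ler_wpM2l ?mulr_ge0 //.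
  apply: le_trans (ler_normD _ _) _; rewrite !normrM.
  by apply: lerD; apply: ler_pM.
apply: le_trans (ler_normB _ _) _; apply: le_trans (lerD _ t5) _.
  apply: le_trans (ler_normD _ _) _; apply: (lerD _ t4).
  apply: le_trans (ler_normD _ _) _; apply: (lerD _ t3).
  apply: le_trans (ler_normD _ _) _; exact: (lerD t1 t2).
rewrite -!mulrDr ler_wpM2l // /K.
have mCD : 0 <= 2 * `|m| * (C + D) by rewrite !mulr_ge0 // addr_ge0 // ltW.
have := ler_wpM2l mCD ab.
have nu : 0 <= `|u x - m * v y| * `|b| ^+ 2 by rewrite mulr_ge0 // sqr_ge0.
have nv : 0 <= `|v y - m * u x| * `|a| ^+ 2 by rewrite mulr_ge0 // sqr_ge0.
have nC : 0 <= C * `|b| ^+ 2 by rewrite mulr_ge0 ?sqr_ge0 // ltW.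
have nD : 0 <= D * `|a| ^+ 2 by rewrite mulr_ge0 ?sqr_ge0 // ltW.
have sa := sqr_ge0 `|a|; have sb := sqr_ge0 `|b|.
rewrite !mulrDr !mulrDl; lra.
Qed.
End SecondVariation.

(** * First and second variation at a point of maximal distance *)

Section SecondVariation2.
Set Implicit Arguments.
Unset Strict Implicit.
Unset Printing Implicit Defensive.
Import numFieldNormedType.Exports.
Variable R : realType.
(* Generalizing gradients and Hessians keeps unification from unfolding them. *)
Ltac gen_jets u v x y := move: (grad u x) (grad v y) (hess u x) (hess v y) => ? ? ? ?.
Ltac gen_forms := repeat match goal with
  | |- context [@dotp ?R ?n ?a ?b] => generalize (@dotp R n a b); intro
  | |- context [@qf ?R ?n ?A ?b] => generalize (@qf R n A b); intro
  end.

Lemma ge0_of_quadratic (B K d : R) : 0 < d ->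
  (forall t, 0 < t < d -> 0 <= t * B + t ^+ 2 * K) -> 0 <= B.
Proof.
move=> d0 H; rewrite leNgt; apply/negP => B0.
pose t := Order.min (d / 2) (- B / (`|K| + 1) / 2).
have K1 : 0 < `|K| + 1 by rewrite ltr_wpDl.
have t0 : 0 < t by rewrite lt_min !divr_gt0 // oppr_gt0.
have td : t < d by rewrite gt_min [d / 2 < d]gtr_pMr // invf_lt1 // ltr1n.
have tB : t * (`|K| + 1) <= - B / 2.
  rewrite -ler_pdivlMr // mulrAC /t ge_min; apply/orP; right.
  by rewrite mulrAC.
have := H t; rewrite t0 td => /(_ isT); rewrite expr2 -mulrA -mulrDr pmulr_rge0 //.
have : t * K <= t * (`|K| + 1).
  by rewrite ler_wpM2l ?ltW //; apply: le_lt_trans (ler_norm K) _; rewrite ltrDl.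
lra.
Qed.

Lemma qf_adm n (u : 'rV[R]_n -> R) x b : qf (adm_matrix u x) b =
  dotp b b + dotp (grad u x) b ^+ 2 + u x * qf (hess u x) b.
Proof.
rewrite /qf /adm_matrix !mulmxDr !mulmxDl mxE [X in X + _ = _]mxE mulmx1.
congr (_ + _ + _).
  have -> : b *m ((grad u x)^T *m grad u x) = dotp (grad u x) b *: grad u x.
    rewrite mulmxA.
    have -> : b *m (grad u x)^T = (dotp (grad u x) b)%:M.
      by rewrite [LHS]mx11_scalar dotpC.
    by rewrite mul_scalar_mx.
  by rewrite -scalemxAl mxE expr2.
by rewrite -scalemxAr -scalemxAl mxE.
Qed.

Lemma gap_gradZ n m (u v : 'rV[R]_n -> R) x y (t : R) a b :
  gap_grad m u v x y (t *: a) (t *: b) = t * gap_grad m u v x y a b.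
Proof. by rewrite /gap_grad; gen_jets u v x y; rewrite !dotpZr; gen_forms; ring. Qed.

Lemma gap_hessZ n m (u v : 'rV[R]_n -> R) x y (t : R) a b :
  gap_hess m u v x y (t *: a) (t *: b) = t ^+ 2 * gap_hess m u v x y a b.
Proof. by rewrite /gap_hess; gen_jets u v x y; rewrite !dotpZr !qfZ !dotpZl; gen_forms; ring. Qed.

Section Touching.
Variables (n : nat) (A : set 'rV[R]_n) (m : R) (u v : 'rV[R]_n -> R).
Variables (x y : 'rV[R]_n).
Hypotheses (su : smooth_on A u) (sv : smooth_on A v) (Ax : A x) (Ay : A y).
Hypotheses (m0 : 0 < m) (ux0 : 0 < u x) (vmu : 0 < v y - m * u x).
Hypothesis pv : posdef (adm_matrix v y).
(** A max-min contact. By [gap_ge], [y] is a local closest point for [x]; by [gap_le], every nearby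
    [x + a] still has, close to [y], a point at distance at most [d], where [m = cosh d]. In this
    form no regularity of the distance or of the closest point is required. *)
Hypothesis gap0 : sphere_gap m u v x y = 0.
Hypothesis gap_ge : exists2 d, 0 < d &
  forall b, `|b| < d -> 0 <= sphere_gap m u v x (y + b).
Hypothesis gap_le : forall eta, 0 < eta -> exists2 d, 0 < d &
  forall a, `|a| < d -> exists2 b, `|b| < eta & sphere_gap m u v (x + a) (y + b) <= 0.

Let Q := gap_hess m u v x y.
Let L := gap_grad m u v x y.

Let small (d : R) (a : 'rV[R]_n) : 0 < d -> exists2 r, 0 < r &
  forall t, 0 < t < r -> `|t *: a| < d.
Proof.
move=> d0; exists (d / (`|a| + 1)); first by rewrite divr_gt0 // ltr_wpDl.
move=> t /andP[t0 tr]; apply: (norm_scale_lt (K := `|a|) _ _ _ tr) => //.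
  by rewrite normrZ gtr0_norm // mulrC.
exact: ltW.
Qed.

Lemma touching_grad_upper b : L 0 b = 0.
Proof.
suff H b' : 0 <= L 0 b'.
  have Ln : L 0 (- b) = - L 0 b.
    by have := gap_gradZ m u v x y (-1) 0 b; rewrite scaler0 scaleN1r mulN1r.
  by apply/eqP; rewrite eq_le H andbT -oppr_ge0 -Ln H.
have [d1 d10 H1] := gap_ge.
have [d2 d20 H2] := gap_expand m su sv Ax Ay ltr01.
have [r r0 H3] := small b' (d := Order.min d1 d2) ltac:(by rewrite lt_min d10).
apply: (@ge0_of_quadratic _ (Q 0 b' + `|b'| ^+ 2) r r0) => t /[dup] t0r /H3.
rewrite lt_min => /andP[tb1 tb2].
have := H2 0 (t *: b'); rewrite normr0 => /(_ d20 tb2).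
rewrite gap0 subr0 addr0.
have := gap_gradZ m u v x y t 0 b'; rewrite scaler0 => ->.
have := gap_hessZ m u v x y t 0 b'; rewrite scaler0 => ->; rewrite -/L -/Q.
rewrite expr0n add0r mul1r normrZ exprMn real_normK ?num_real //.
have := H1 _ tb1; rewrite ler_norml => H4 /andP[_ H5]; lra.
Qed.

(** [v Q(0, b)] is [m u (|b|^2 + (Dv.b)^2)] plus [v - m u] times the admissibility form of [v]. The
    resulting coercivity in [b] is what later bounds the increments produced by [gap_le]. *)
Lemma hess_upper_ge b : m * u x * dotp b b <= v y * Q 0 b.
Proof.
have vy0 : 0 < v y by apply: lt_trans vmu _; rewrite gtrBl mulr_gt0.
have : 0 <= qf (adm_matrix v y) b.
  have [->|b0] := eqVneq b 0; first by rewrite /qf !mul0mx mxE.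
  exact: ltW (pv b0).
rewrite qf_adm => pb.
have -> : v y * Q 0 b = m * u x * dotp b b + (m * u x * dotp (grad v y) b ^+ 2 +
   (v y - m * u x) * (dotp b b + dotp (grad v y) b ^+ 2 + v y * qf (hess v y) b)).
  rewrite /Q /gap_hess; gen_jets u v x y; rewrite -(scale0r (0 : 'rV[R]_n)) !dotpZr qfZ !dotpZl; gen_forms; ring.
rewrite lerDl addr_ge0 // mulr_ge0 ?sqr_ge0 //; first by rewrite mulr_ge0 // ltW.
exact: ltW.
Qed.

Let coef a := l1norm (a + (m * dotp (grad u x) a) *: grad v y).

Lemma hess_coercive a b :
  m * u x / v y * `|b| ^+ 2 - 2 * coef a * `|b| + Q a 0 <= Q a b.
Proof.
have vy0 : 0 < v y by apply: lt_trans vmu _; rewrite gtrBl mulr_gt0.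
have -> : Q a b = Q 0 b - 2 * dotp (a + (m * dotp (grad u x) a) *: grad v y) b + Q a 0.
  rewrite /Q /gap_hess; gen_jets u v x y; rewrite -(scale0r (0 : 'rV[R]_n)) !dotpZr !qfZ !dotp_lin; gen_forms; ring.
rewrite lerD2r; apply: lerB.
  rewrite mulrAC ler_pdivrMr // [leRHS]mulrC; apply: le_trans (hess_upper_ge b).
  by rewrite ler_wpM2l ?dotp_norm_le // mulr_ge0 // ltW.
rewrite -mulrA ler_wpM2l //; apply: le_trans (ler_norm _) _; exact: dotp_le.
Qed.

(** For the increment [t a], [gap_le] gives an increment at [y] that is small but not known to be of
    order [t]. It is divided by [t] here, and the size of the quotient [b] is left to coercivity. *)
Lemma touching_scaled a (e : R) : 0 < e -> exists2 r, 0 < r &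
  forall t, 0 < t < r -> exists b,
    L a 0 + t * (Q a b - e * (`|a| ^+ 2 + `|b| ^+ 2)) <= 0.
Proof.
move=> e0; have [d d0 H1] := gap_expand m su sv Ax Ay e0.
have [d1 d10 H2] := gap_le d0.
have [r r0 H3] := small a (d := Order.min d d1) ltac:(by rewrite lt_min d0).
exists r => // t /[dup] /andP[t0 _] /H3; rewrite lt_min => /andP[ta ta1].
have [b bd gb] := H2 _ ta1; exists (t^-1 *: b).
have bE : b = t *: (t^-1 *: b) by rewrite scalerA mulfV ?scale1r ?gt_eqF.
have := H1 _ _ ta bd; rewrite gap0 subr0.
have -> : gap_grad m u v x y (t *: a) b = t * L a 0.
  have -> : gap_grad m u v x y (t *: a) b = L (t *: a) 0 + L 0 b.
    by rewrite /L /gap_grad; gen_jets u v x y; rewrite -(scale0r (0 : 'rV[R]_n)) !dotpZr; gen_forms; ring.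
  rewrite touching_grad_upper addr0.
  by have := gap_gradZ m u v x y t a 0; rewrite scaler0.
rewrite [in gap_hess _ _ _ _ _ _ b]bE gap_hessZ -/Q.
have -> : e * (`|t *: a| ^+ 2 + `|b| ^+ 2) =
    t ^+ 2 * (e * (`|a| ^+ 2 + `|t^-1 *: b| ^+ 2)).
  rewrite [in `|b|]bE !normrZ !exprMn !real_normK ?num_real //.
  ring.
rewrite ler_norml => /andP[H4 _].
rewrite -(pmulr_rle0 _ t0); move: gb H4.
set G := sphere_gap _ _ _ _ _; set q := Q _ _; set N := e * _; lra.
Qed.

Let c := m * u x / v y.
Let c0 : 0 < c.
Proof.
have vy0 : 0 < v y by apply: lt_trans vmu _; rewrite gtrBl mulr_gt0.
by rewrite divr_gt0 // mulr_gt0.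
Qed.

Lemma touching_grad_lower a : L a 0 = 0.
Proof.
suff H a' : L a' 0 <= 0.
  have Ln : L (- a) 0 = - L a 0.
    by have := gap_gradZ m u v x y (-1) a 0; rewrite scaler0 scaleN1r mulN1r.
  by apply/eqP; rewrite eq_le H -oppr_le0 -Ln H.
have c2 : 0 < c / 2 by rewrite divr_gt0.
have [r r0 H1] := touching_scaled a' c2.
(* A lower bound, uniform in [b], for [Q a' b] minus the error with [e = c / 2], obtained by
   completing the square in [|b|]. *)
rewrite -oppr_ge0; pose K := Q a' 0 - 2 * coef a' ^+ 2 / c - c / 2 * `|a'| ^+ 2.
apply: (@ge0_of_quadratic _ (- K) r r0) => t /[dup] /andP[t0 _] /H1[b Hb].
have := hess_coercive a' b; rewrite -/c => Hq.
have sq : 0 <= (c * `|b| - 2 * coef a') ^+ 2 / (2 * c).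
  by rewrite divr_ge0 ?sqr_ge0 // mulr_ge0 // ltW.
have sqE : (c * `|b| - 2 * coef a') ^+ 2 / (2 * c) =
    c / 2 * `|b| ^+ 2 - 2 * coef a' * `|b| + 2 * coef a' ^+ 2 / c.
  by field; rewrite gt_eqF.
have HK : K <= Q a' b - c / 2 * (`|a'| ^+ 2 + `|b| ^+ 2).
  rewrite sqE in sq; rewrite /K; lra.
have : t * K <= t * (Q a' b - c / 2 * (`|a'| ^+ 2 + `|b| ^+ 2)).
  by rewrite ler_pM2l.
move=> HtK; have HL : 0 <= - (L a' 0 + t * K) by rewrite oppr_ge0; lra.
have := mulr_ge0 (ltW t0) HL; lra.
Qed.

Lemma touching_hess a (e : R) : 0 < e -> exists b, Q a b <= e.
Proof.
(* [M] bounds [|b|^2] for every [b] with [Q a b <= e1 (|a|^2 + |b|^2)], given [e1 <= 1] and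
   [e1 <= c / 2]; the last entry of [e1] then brings the error below [e]. *)
move=> e0; pose M := 4 / c * (`|a| ^+ 2 - Q a 0 + 4 * coef a ^+ 2 / c).
pose e1 := Order.min (Order.min 1 (c / 2)) (e / (`|a| ^+ 2 + `|M| + 1)).
have N0 : 0 < `|a| ^+ 2 + `|M| + 1 by rewrite ltr_wpDl // addr_ge0 // sqr_ge0.
have e10 : 0 < e1 by rewrite !lt_min ltr01 (divr_gt0 c0 (ltr0n R 2)) (divr_gt0 e0 N0).
have [e1a e1b e1c] : [/\ e1 <= 1, e1 <= c / 2 & e1 * (`|a| ^+ 2 + `|M| + 1) <= e].
  by rewrite -ler_pdivlMr // /e1 !ge_min !lexx !orbT.
have [r r0 H1] := touching_scaled a e10.
have r2 : 0 < r / 2 < r.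
  by rewrite divr_gt0 //= gtr_pMr // invf_lt1 // ltr1n.
have [b] := H1 _ r2; rewrite touching_grad_lower add0r.
rewrite pmulr_rle0 ?divr_gt0 // subr_le0 => Hb; exists b.
have := hess_coercive a b; rewrite -/c => Hq.
have sq : 0 <= (c * `|b| - 4 * coef a) ^+ 2 / (4 * c).
  by rewrite divr_ge0 ?sqr_ge0 // mulr_ge0 // ltW.
have sqE : (c * `|b| - 4 * coef a) ^+ 2 / (4 * c) =
    c / 4 * `|b| ^+ 2 - 2 * coef a * `|b| + 4 * coef a ^+ 2 / c.
  by field; rewrite gt_eqF.
have na := sqr_ge0 `|a|; have nb := sqr_ge0 `|b|.
have ea : e1 * `|a| ^+ 2 <= `|a| ^+ 2 by rewrite ler_piMl.
have eb : e1 * `|b| ^+ 2 <= c / 2 * `|b| ^+ 2 by rewrite ler_wpM2r.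
have bM : `|b| ^+ 2 <= M.
  rewrite /M mulrAC ler_pdivlMr //; rewrite sqE in sq.
  by move: Hb; rewrite mulrDr; lra.
apply: le_trans Hb _; apply: le_trans e1c; rewrite ler_pM2l //.
by have := ler_norm M; lra.
Qed.

End Touching.

(** Here [m = cosh d] and [s = sinh d]. The mixed term of the second variation is parallel transport
    along the connecting geodesic, written as the matrix [O] in the two orthonormal frames. In frame
    coordinates the form is diagonal in [b]; completing the square leaves [m - s l] against
    [1 / (m + s k)], and [s^2 = m^2 - 1] turns [m - 1 / (m + s k)] into [s] times the curvature of
    the parallel surface. *)
Lemma second_variation_frames n (gu hu gv hv P S : 'M[R]_n)
    (al l k : 'rV[R]_n) (c m s u v : R) :
  0 < u -> 0 < v -> 0 < m -> 0 < s -> s ^+ 2 = m ^+ 2 - 1 ->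
  gu = (u ^+ 2)^-1 *: (1%:M + al^T *m al) ->
  gv = (v ^+ 2)^-1 *: (1%:M + c ^+ 2 *: (al^T *m al)) ->
  P *m gu *m P^T = 1%:M -> P *m hu *m P^T = diag_mx l ->
  S *m gv *m S^T = 1%:M -> S *m hv *m S^T = diag_mx k -> Kpos k ->
  2 * m * c + m ^+ 2 * c ^+ 2 * dotp al al =
    1 + c ^+ 2 + c ^+ 2 * dotp al al ->
  (forall a e, 0 < e -> exists b,
    u * v * (m * qf gu a - s * qf hu a) + u * v * (m * qf gv b + s * qf hv b) -
    2 * (dotp a b + m * c * dotp al a * dotp al b) <= e) ->
  exists2 O : 'M[R]_n, O *m O^T = 1%:M & forall e : 'rV[R]_n,
    \sum_j psi (s / m) k 0 j * (e *m O) 0 j ^+ 2 <= \sum_i l 0 i * e 0 i ^+ 2.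
Proof.
move=> u0 v0 m0 s0 sm guE gvE Pg Ph Sg Sh kK star H.
pose E := al^T *m al; pose q := dotp al al.
have q0 : 0 <= q by exact: dotp_ge0.
have EE : E *m E = q *: E.
  rewrite /E mulmxA -[al^T *m al *m al^T]mulmxA.
  have -> : al *m al^T = q%:M by rewrite [LHS]mx11_scalar.
  by rewrite mul_mx_scalar -scalemxAl.
have Emul (r t : R) : (1%:M + r *: E) *m (1%:M + t *: E) =
    1%:M + (r + t + r * t * q) *: E.
  rewrite mulmxDl !mulmxDr !mul1mx mulmx1 -scalemxAl -scalemxAr EE !scalerA.
  by rewrite -!addrA -!scalerDl; congr (_ + _ *: _); ring.
pose M := 1%:M + (m * c) *: E.
have MT : M^T = M.
  by rewrite /M linearD linearZ /= trmx1 /E trmx_mul trmxK.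
have D0 : 0 < 1 + c ^+ 2 * q by rewrite ltr_wpDr // mulr_ge0 // sqr_ge0.
pose yy := (m * c - c ^+ 2) / (1 + c ^+ 2 * q).
(* [Y] is [gv^-1 M], found within the rank-one perturbations of the identity. Orthogonality of [O]
   amounts to [M gv^-1 M = (u v)^2 gu], which is the scalar identity assumed on [c]. *)
pose Y := v ^+ 2 *: (1%:M + yy *: E).
have gvY : gv *m Y = M.
  rewrite gvE /Y -scalemxAl -scalemxAr scalerA mulVf ?gt_eqF ?exprn_gt0 //.
  rewrite scale1r -/E Emul /M; congr (_ + _ *: _); rewrite /yy; field.
  by rewrite gt_eqF.
have MY : M *m Y = (u * v) ^+ 2 *: gu.
  rewrite guE scalerA exprMn mulrAC mulfV ?gt_eqF ?exprn_gt0 // mul1r.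
  rewrite /Y -scalemxAr Emul -/E; congr (_ *: (_ + _)).
  rewrite -[RHS]scale1r; congr (_ *: _); rewrite /yy.
  apply/eqP; rewrite -subr_eq0; apply/eqP.
  have -> : m * c + (m * c - c ^+ 2) / (1 + c ^+ 2 * q) +
     m * c * ((m * c - c ^+ 2) / (1 + c ^+ 2 * q)) * q - 1 =
     (2 * m * c + m ^+ 2 * c ^+ 2 * q - (1 + c ^+ 2 + c ^+ 2 * q)) /
       (1 + c ^+ 2 * q).
    by field; rewrite gt_eqF.
  by rewrite star subrr mul0r.
have SS : S^T *m S *m gv = 1%:M.
  by rewrite -mulmxA; apply: mulmx1C.
have uv0 : u * v != 0 by rewrite mulf_neq0 // gt_eqF.
pose O := (u * v)^-1 *: (P *m M *m S^T).
have OO : O *m O^T = 1%:M.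
  rewrite /O linearZ /= -scalemxAl -scalemxAr scalerA !trmx_mul trmxK MT.
  have -> : P *m M *m S^T *m (S *m (M *m P^T)) =
     P *m (M *m ((S^T *m S *m gv) *m Y)) *m P^T.
    by rewrite -(mulmxA _ gv) gvY !mulmxA.
  rewrite SS mul1mx MY -scalemxAr -scalemxAl Pg scalerA -expr2 exprVn mulVf.
    by rewrite scale1r.
  by rewrite expf_neq0.
exists O => // e; pose d := e *m O.
have dsum := orthogonal_sum_sqr e OO.
have kp j : 0 < m + s * k 0 j.
  by rewrite ltr_wpDr // mulr_ge0 // ltW //; exact: kK.
have qP (X : 'M[R]_n) (z : 'rV[R]_n) (T : 'M[R]_n) (r : 'rV[R]_n) :
    T *m X *m T^T = diag_mx r -> qf X (z *m T) = \sum_i r 0 i * z 0 i ^+ 2.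
  move=> TX; rewrite /qf trmx_mul !mulmxA -(mulmxA z) -(mulmxA z) TX.
  rewrite mul_mx_diag mxE; apply: eq_bigr => i _; rewrite !mxE; ring.
have qP1 (X : 'M[R]_n) (z : 'rV[R]_n) (T : 'M[R]_n) :
    T *m X *m T^T = 1%:M -> qf X (z *m T) = \sum_i z 0 i ^+ 2.
  move=> TX; rewrite (qP X z T (const_mx 1)) ?diag_const_mx //.
  by apply: eq_bigr => i _; rewrite mxE mul1r.
have ST1 : S^T *m (S *m gv) = 1%:M by rewrite mulmxA.
have low : \sum_i (m - s * l 0 i) * e 0 i ^+ 2 <=
           \sum_j d 0 j ^+ 2 / (m + s * k 0 j).
  apply/ler_addgt0Pr => r r0.
  have [b Hb] := H (e *m P) (u * v * r) ltac:(by rewrite !mulr_gt0).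
  (* The coordinates of [b] in the frame [S]. *)
  pose z := b *m gv *m S^T.
  have bE : b = z *m S.
    by rewrite /z -!mulmxA (mulmx1C SS) mulmx1.
  have cross : dotp (e *m P) b + m * c * dotp al (e *m P) * dotp al b =
      u * v * dotp d z.
    have a1 (a : 'rV[R]_n) : a *m al^T = (dotp al a)%:M.
      by rewrite [LHS]mx11_scalar dotpC.
    have -> : dotp (e *m P) b + m * c * dotp al (e *m P) * dotp al b =
        (e *m P *m M *m b^T) 0 0.
      rewrite /M mulmxDr mulmx1 -scalemxAr mulmxDl -scalemxAl mxE.
      congr (_ + _); rewrite [RHS]mxE -mulrA; congr (_ * _).
      by rewrite /E (mulmxA _ al^T) a1 mul_scalar_mx -scalemxAl [RHS]mxE.
    rewrite bE trmx_mul /d /O -scalemxAr dotpZl mulrA mulfV // mul1r.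
    by rewrite /dotp !mulmxA.
  have := Hb; rewrite cross (qP1 _ _ _ Pg) (qP _ _ _ _ Ph) bE (qP1 _ _ _ Sg).
  rewrite (qP _ _ _ _ Sh) => Hb'.
  have {}Hb' : \sum_i (m - s * l 0 i) * e 0 i ^+ 2 +
      \sum_j ((m + s * k 0 j) * z 0 j ^+ 2 - 2 * d 0 j * z 0 j) <= r.
    have uv1 : 0 < u * v by rewrite mulr_gt0.
    rewrite -(ler_pM2l uv1); apply: le_trans Hb'.
    have -> : \sum_i (m - s * l 0 i) * e 0 i ^+ 2 =
        m * (\sum_i e 0 i ^+ 2) - s * (\sum_i l 0 i * e 0 i ^+ 2).
      by rewrite !mulr_sumr -sumrB; apply: eq_bigr => i _; ring.
    have -> : \sum_j ((m + s * k 0 j) * z 0 j ^+ 2 - 2 * d 0 j * z 0 j) =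
        m * (\sum_i z 0 i ^+ 2) + s * (\sum_i k 0 i * z 0 i ^+ 2) - 2 * dotp d z.
      rewrite dotpE !mulr_sumr -big_split -sumrB; apply: eq_bigr => i _ /=; ring.
    by rewrite le_eqVlt; apply/orP; left; apply/eqP; ring.
  have : - (\sum_j d 0 j ^+ 2 / (m + s * k 0 j)) <=
      \sum_j ((m + s * k 0 j) * z 0 j ^+ 2 - 2 * d 0 j * z 0 j).
    rewrite -sumrN; apply: ler_sum => j _; rewrite -subr_ge0.
    have -> : (m + s * k 0 j) * z 0 j ^+ 2 - 2 * d 0 j * z 0 j -
       - (d 0 j ^+ 2 / (m + s * k 0 j)) =
       ((m + s * k 0 j) * z 0 j - d 0 j) ^+ 2 / (m + s * k 0 j).
      by field; rewrite gt_eqF.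
    by rewrite divr_ge0 ?sqr_ge0 // ltW.
  lra.
rewrite -(ler_pM2l s0).
have -> : s * \sum_j psi (s / m) k 0 j * (e *m O) 0 j ^+ 2 =
    m * (\sum_i e 0 i ^+ 2) - \sum_j d 0 j ^+ 2 / (m + s * k 0 j).
  rewrite -dsum !mulr_sumr -sumrB; apply: eq_bigr => j _; rewrite -/d mxE.
  have kj : 0 < k 0 j by exact: kK.
  have E1 : s * ((k 0 j + s / m) / (1 + s / m * k 0 j)) = m - (m + s * k 0 j)^-1.
    have -> : m - (m + s * k 0 j)^-1 =
        (m ^+ 2 - 1 + m * s * k 0 j) / (m + s * k 0 j).
      by field; rewrite gt_eqF.
    by rewrite -sm; field; rewrite !gt_eqF.
  by rewrite mulrA E1; ring.
have -> : s * \sum_i l 0 i * e 0 i ^+ 2 =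
    m * (\sum_i e 0 i ^+ 2) - \sum_i (m - s * l 0 i) * e 0 i ^+ 2.
  by rewrite !mulr_sumr -sumrB; apply: eq_bigr => i _; ring.
lra.
Qed.
End SecondVariation2.

(** * Hyperbolic curvatures at a point and the contradiction at a contact *)

Section Pointwise.
Set Implicit Arguments.
Unset Strict Implicit.
Unset Printing Implicit Defensive.
Import numFieldNormedType.Exports.
Variable R : realType.
Lemma qf_scale n (c : R) (X : 'M[R]_n) b : qf (c *: X) b = c * qf X b.
Proof. by rewrite /qf -scalemxAr -scalemxAl mxE. Qed.

Lemma qf_metric n (al b : 'rV[R]_n) :
  qf (1%:M + al^T *m al) b = dotp b b + dotp al b ^+ 2.
Proof.
rewrite /qf mulmxDr mulmxDl mxE mulmx1; congr (_ + _).
have -> : b *m (al^T *m al) = dotp al b *: al.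
  rewrite mulmxA; have -> : b *m al^T = (dotp al b)%:M.
    by rewrite [LHS]mx11_scalar dotpC.
  by rewrite mul_scalar_mx.
by rewrite -scalemxAl mxE expr2.
Qed.

Lemma qf_frame n (X T : 'M[R]_n) (z r : 'rV[R]_n) :
  T *m X *m T^T = diag_mx r -> qf X (z *m T) = \sum_i r 0 i * z 0 i ^+ 2.
Proof.
move=> TX; rewrite /qf trmx_mul !mulmxA -(mulmxA z) -(mulmxA z) TX.
by rewrite mul_mx_diag mxE; apply: eq_bigr => i _; rewrite !mxE; ring.
Qed.

Lemma qf_gmat n (u : 'rV[R]_n -> R) x b :
  qf (gmat u x) b = (u x ^+ 2)^-1 * (dotp b b + dotp (grad u x) b ^+ 2).
Proof. by rewrite /gmat qf_scale qf_metric. Qed.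

Definition slope n (u : 'rV[R]_n -> R) x : R :=
  Num.sqrt (1 + dotp (grad u x) (grad u x)).

Lemma slope_gt0 n (u : 'rV[R]_n -> R) x : 0 < slope u x.
Proof. by rewrite sqrtr_gt0 ltr_wpDr // dotp_ge0. Qed.

Lemma slope_sqr n (u : 'rV[R]_n -> R) x :
  slope u x ^+ 2 = 1 + dotp (grad u x) (grad u x).
Proof. by rewrite sqr_sqrtr // addr_ge0 // dotp_ge0. Qed.

Lemma qf_hmat n (u : 'rV[R]_n -> R) x b : qf (hmat u x) b =
  (u x ^+ 2 * slope u x)^-1 * qf (adm_matrix u x) b.
Proof.
rewrite /hmat qf_scale; congr ((_ * _)^-1 * _).
rewrite /slope; congr (Num.sqrt (1 + _)).
by rewrite dotpE; apply: eq_bigr => i _; rewrite !mxE expr2.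
Qed.

Lemma princ_curv_frame n (A : set 'rV[R]_n) u x l : smooth_on A u -> A x ->
  0 < u x -> posdef (adm_matrix u x) -> princ_curv u x l ->
  exists2 P : 'M[R]_n, P *m gmat u x *m P^T = 1%:M &
    P *m hmat u x *m P^T = diag_mx l.
Proof.
move=> su Ax u0 pa cp.
have [|||P [PG PH]] := rel_spectral _ _ _ cp; last by exists P.
- by rewrite /gmat linearZ /= linearD /= trmx1 trmx_mul trmxK.
- rewrite /hmat linearZ /= /adm_matrix !linearD /= trmx1 trmx_mul trmxK.
  by rewrite linearZ /= (hess_sym su Ax).
move=> b b0; rewrite -/(qf _ b) qf_gmat mulr_gt0 ?invr_gt0 ?exprn_gt0 //.
rewrite ltr_wpDr ?sqr_ge0 // lt_def dotp_ge0 andbT.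
by apply: contra_neq b0 => b0; apply: dotp_eq0; rewrite b0.
Qed.

Lemma princ_curv_pos n (A : set 'rV[R]_n) u x l : smooth_on A u -> A x ->
  0 < u x -> posdef (adm_matrix u x) -> princ_curv u x l -> Kpos l.
Proof.
move=> su Ax u0 pa cp i; have [P PG PH] := princ_curv_frame su Ax u0 pa cp.
have -> : l ord0 i = qf (hmat u x) (evec R i *m P).
  rewrite (qf_frame _ PH) (bigD1 i) //= big1 => [|j ji].
    by rewrite mxE !eqxx expr1n mulr1 addr0.
  by rewrite mxE eqxx (negPf ji) expr0n mulr0.
rewrite qf_hmat mulr_gt0 ?invr_gt0 ?mulr_gt0 ?exprn_gt0 ?slope_gt0 //.
apply: pa; apply/negP => /eqP e0.
have : evec R i *m (P *m gmat u x *m P^T) = 0 by rewrite !mulmxA e0 !mul0mx.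
rewrite PG mulmx1 => /rowP/(_ i); rewrite !mxE !eqxx => /eqP.
by rewrite oner_eq0.
Qed.

(** On a vector [b] of unit length for [gmat] the second form is [(1 + D^2u(b,b) / u) / W], with [W]
    the slope factor, and [|b|^2 + (Du.b)^2 = u^2] gives [|b|^2 <= u^2]. The sign of [k] decides in
    which of the two bounds [|b|^2] may be replaced by [u^2]. *)
Lemma curv_bounds n (A : set 'rV[R]_n) u x l (k : R) i :
  smooth_on A u -> A x -> 0 < u x -> posdef (adm_matrix u x) ->
  princ_curv u x l ->
  ((forall b, 2 * k * dotp b b <= qf (hess u x) b) ->
    k <= 0 -> (1 + 2 * u x * k) / slope u x <= l 0 i) /\
  ((forall b, qf (hess u x) b <= 2 * k * dotp b b) ->
    0 <= k -> l 0 i <= (1 + 2 * u x * k) / slope u x).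
Proof.
move=> su Ax u0 pa cp; have [P PG PH] := princ_curv_frame su Ax u0 pa cp.
pose z := evec R i.
have sz : \sum_j z 0 j ^+ 2 = 1.
  rewrite (bigD1 i) //= big1 => [|j ji].
    by rewrite mxE !eqxx expr1n addr0.
  by rewrite mxE eqxx (negPf ji) expr0n.
have lE : l 0 i = qf (hmat u x) (z *m P).
  rewrite (qf_frame _ PH) (bigD1 i) //= big1 => [|j ji].
    by rewrite mxE !eqxx expr1n mulr1 addr0.
  by rewrite mxE eqxx (negPf ji) expr0n mulr0.
have gE : qf (gmat u x) (z *m P) = 1.
  rewrite (@qf_frame _ _ _ _ (const_mx 1)) ?diag_const_mx // -[RHS]sz.
  by apply: eq_bigr => j _; rewrite mxE mul1r.
have W0 := slope_gt0 u x.
have u2 : 0 < u x ^+ 2 by rewrite exprn_gt0.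
move: gE; rewrite qf_gmat => /(canRL (mulVKf (lt0r_neq0 u2))); rewrite mulr1 => gE.
have q0 := sqr_ge0 (dotp (grad u x) (z *m P)).
rewrite lE qf_hmat qf_adm gE.
set b := z *m P in gE q0 *.
have -> : (u x ^+ 2 * slope u x)^-1 * (u x ^+ 2 + u x * qf (hess u x) b) =
    (1 + qf (hess u x) b / u x) / slope u x.
  by field; rewrite !gt_eqF.
split=> Hk k0; rewrite ler_pM2r ?invr_gt0 // lerD2l.
  rewrite ler_pdivlMr //; apply: le_trans (Hk b).
  have : k * u x ^+ 2 <= k * dotp b b.
    by rewrite -gE mulrDr gerDl mulr_le0_ge0.
  lra.
rewrite ler_pdivrMr //; apply: le_trans (Hk b) _.
have : k * dotp b b <= k * u x ^+ 2 by rewrite -gE mulrDr lerDl mulr_ge0.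
lra.
Qed.

(** The jet is passed abstractly so that the lemma covers interior minima, through
    [w h = u x - u (x + h)], as well as paraboloids touching from either side. *)
Lemma jet_max n (w : 'rV[R]_n -> R) (G p : 'rV[R]_n) (H : 'M[R]_n) (k d : R) :
  (forall e, 0 < e -> exists2 d, 0 < d & forall h, `|h| < d ->
    `|w h - dotp G h - 2^-1 * qf H h| <= e * `|h| ^+ 2) ->
  0 < d -> (forall h, `|h| < d -> w h <= dotp p h + k * dotp h h) ->
  G = p /\ forall h, qf H h <= 2 * k * dotp h h.
Proof.
move=> J d0 wle.
have small (r : R) (h : 'rV[R]_n) : 0 < r -> exists2 r', 0 < r' &
    forall t, 0 < t < r' -> `|t *: h| < r.
  move=> r0; exists (r / (`|h| + 1)); first by rewrite divr_gt0 // ltr_wpDl.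
  move=> t /andP[t0 tr]; apply: (norm_scale_lt (K := `|h|) _ _ _ tr) => //.
    by rewrite normrZ gtr0_norm // mulrC.
  exact: ltW.
have main h e : 0 < e -> exists2 r, 0 < r & forall t, 0 < t < r ->
    t * dotp (G - p) h + t ^+ 2 * (2^-1 * qf H h - k * dotp h h - e * `|h| ^+ 2) <= 0.
  move=> e0; have [d1 d10 dP] := J e e0.
  have [r r0 rP] := small (Order.min d d1) h ltac:(by rewrite lt_min d0).
  exists r => // t /rP; rewrite lt_min => /andP[t1 t2].
  have := dP _ t2; have := wle _ t1.
  rewrite normrZ exprMn real_normK ?num_real // ler_norml !dotp_lin qfZ.
  by move=> H1 /andP[H2 _]; lra.
have GE : G = p.
  have ge0 h : 0 <= dotp (p - G) h.
    have [r r0 rP] := main h 1 ltr01.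
    apply: (@ge0_of_quadratic _ _ (- (2^-1 * qf H h - k * dotp h h - 1 * `|h| ^+ 2)) _ r0) => t /rP.
    by rewrite !dotp_lin; lra.
  apply/eqP; rewrite -subr_eq0; apply/eqP; apply: dotp_eq0.
  by have := ge0 (G - p); rewrite -[p - G]opprB dotpNl oppr_ge0.
split => // h; apply/ler_addgt0Pr => e e0.
have X1 : 0 < `|h| ^+ 2 + 1 by rewrite ltr_wpDl // sqr_ge0.
have e1 : 0 < e / 2 / (`|h| ^+ 2 + 1) by rewrite !divr_gt0.
have [r r0 rP] := main h _ e1.
have r2 : 0 < r / 2 < r by rewrite divr_gt0 //= gtr_pMr // invf_lt1 // ltr1n.
have := rP _ r2; rewrite GE subrr.
have -> : dotp 0 h = 0 by rewrite /dotp mul0mx mxE.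
rewrite mulr0 add0r pmulr_rle0 ?exprn_gt0 ?divr_gt0 //.
have : e / 2 / (`|h| ^+ 2 + 1) * `|h| ^+ 2 <= e / 2.
  by rewrite mulrAC ler_pdivrMr // ler_wpM2l ?divr_ge0 ?ltW // ltrDl.
lra.
Qed.

Lemma inv_mul_eq (a W K b : R) : 0 < a -> 0 < K -> K * W = b -> 0 < W ->
  (a * W)^-1 = K / (a * b).
Proof. by move=> a0 K0 <- W0; field; rewrite !gt_eqF. Qed.

(* Stated over scalars, because rewriting with the formulas for [qf] makes
   unification unfold the matrices. *)
Lemma frame_identity (u v m s c W V G H A G' H' A' X1 X2 X3 X4 X5 X6 X7 Z : R) :
  0 < u -> 0 < v -> 0 < s -> 0 < W -> 0 < V -> 0 < v - m * u -> 0 < m * v - u ->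
  (m * v - u) * W = v * s -> (v - m * u) * V = u * s ->
  G = (u ^+ 2)^-1 * (X1 + X2 ^+ 2) -> H = (u ^+ 2 * W)^-1 * A ->
  A = X1 + X2 ^+ 2 + u * X3 ->
  G' = (v ^+ 2)^-1 * (X4 + Z ^+ 2) -> H' = (v ^+ 2 * V)^-1 * A' ->
  A' = X4 + Z ^+ 2 + v * X6 -> Z = c * X5 ->
  u * v * (m * G - s * H) + u * v * (m * G' + s * H') -
  2 * (X7 + m * c * X2 * X5) =
  X1 + X2 ^+ 2 - (m * v - u) * X3 + (X4 + Z ^+ 2 + (v - m * u) * X6) -
  2 * (X7 + m * X2 * Z).
Proof.
move=> u0 v0 s0 W0 V0 N0 K0 KW NV -> -> -> -> -> -> ->.
rewrite (inv_mul_eq (exprn_gt0 2 u0) K0 KW W0).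
rewrite (inv_mul_eq (exprn_gt0 2 v0) N0 NV V0).
by field; rewrite !gt_eqF.
Qed.

(** The two relations on the slopes express that a geodesic of length [d], with [s = sinh d], meets
    both graphs orthogonally. They convert the coefficients of the Euclidean Hessians into those of
    the hyperbolic second forms. *)
Lemma gap_hess_geometric n (m c s : R) (u v : 'rV[R]_n -> R) x y a b :
  0 < u x -> 0 < v y -> 0 < s -> 0 < v y - m * u x -> 0 < m * v y - u x ->
  grad v y = c *: grad u x ->
  (m * v y - u x) * slope u x = v y * s ->
  (v y - m * u x) * slope v y = u x * s ->
  u x * v y * (m * qf (gmat u x) a - s * qf (hmat u x) a) +
  u x * v y * (m * qf (gmat v y) b + s * qf (hmat v y) b) -
  2 * (dotp a b + m * c * dotp (grad u x) a * dotp (grad u x) b) =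
  gap_hess m u v x y a b.
Proof.
move=> u0 v0 s0 N0 K0 gv Wu Wv.
have Z : dotp (grad v y) b = c * dotp (grad u x) b.
  by transitivity (dotp (c *: grad u x) b); [congr dotp|exact: dotpZl].
exact: (frame_identity _ u0 v0 s0 (slope_gt0 u x) (slope_gt0 v y) N0 K0 Wu Wv
  (qf_gmat u x a) (qf_hmat u x a) (qf_adm u x a)
  (qf_gmat v y b) (qf_hmat v y b) (qf_adm v y b) Z).
Qed.

Lemma touching_contradiction n (A : set 'rV[R]_n) (f : 'rV[R]_n -> R) (s m : R)
    u v x y : comparison_function f s ->
  smooth_on A u -> smooth_on A v -> A x -> A y ->
  admissible A u -> admissible A v ->
  (exists l, princ_curv u x l /\ f l = s) ->
  (exists l, princ_curv v y l /\ f l = s) ->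
  1 < m -> m * u x <= v y -> sphere_gap m u v x y = 0 ->
  (exists2 d, 0 < d & forall b, `|b| < d -> 0 <= sphere_gap m u v x (y + b)) ->
  (forall eta, 0 < eta -> exists2 d, 0 < d & forall a, `|a| < d ->
     exists2 b, `|b| < eta & sphere_gap m u v (x + a) (y + b) <= 0) -> False.
Proof.
move=> cf su sv Ax Ay au av [l [cl fl]] [k [ck fk]] m1 muv gap0 gge gle.
have [u0 pu] := au x Ax; have [v0 pv] := av y Ay.
have m0 : 0 < m by rewrite (lt_trans ltr01).
have Gv := touching_grad_upper su sv Ax Ay gap0 gge.
have d0 (z : 'rV[R]_n) : dotp 0 z = 0 by rewrite /dotp mul0mx mxE.
have d0r (z : 'rV[R]_n) : dotp z 0 = 0 by rewrite dotpC d0.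
have {}Gv b : (v y - m * u x) * dotp (grad v y) b = dotp (x - y) b.
  by have := Gv b; rewrite /gap_grad !d0r mulr0 subr0 mulr0 add0r; lra.
(* With equality the first-order condition forces [x = y] and [v = m u], and the gap would be
   [- u^2 (m^2 - 1)]. *)
have vmu : 0 < v y - m * u x.
  rewrite lt_def subr_ge0 muv andbT; apply/negP => /eqP E.
  have xy : x - y = 0 by apply: dotp_eq0; rewrite -Gv E mul0r.
  move: gap0; rewrite /sphere_gap xy d0 add0r.
  have -> : v y = m * u x by apply/eqP; rewrite -subr_eq0 E.
  have -> : u x ^+ 2 + (m * u x) ^+ 2 - 2 * m * u x * (m * u x) =
    - (u x ^+ 2 * ((m - 1) * (m + 1))) by ring.
  move/eqP; rewrite oppr_eq0 gt_eqF // mulr_gt0 ?exprn_gt0 // mulr_gt0 ?subr_gt0 //.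
  by rewrite addr_gt0.
have Gu := touching_grad_lower su sv Ax Ay m0 u0 vmu pv gap0 gge gle.
have {}Gu a : (m * v y - u x) * dotp (grad u x) a = dotp (x - y) a.
  by have := Gu a; rewrite /gap_grad !d0r mulr0 subr0 mulr0 addr0; lra.
have HQ := touching_hess su sv Ax Ay m0 u0 vmu pv gap0 gge gle.
(* The first-order conditions read [K Du = x - y = N Dv]: the gradients are parallel with ratio
   [c = K / N], and the vanishing of the gap determines [K^2 |Du|^2]. *)
pose N := v y - m * u x; pose K := m * v y - u x.
pose c := K / N; pose al := grad u x; pose q := dotp al al.
have N0 : 0 < N by [].
have K0 : 0 < K.
  rewrite /K subr_gt0; apply: lt_trans (_ : v y < _); last by rewrite ltr_pMl.
  by apply: lt_le_trans muv; rewrite ltr_pMl.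
have gvE : grad v y = c *: al.
  apply/eqP; rewrite -subr_eq0; apply/eqP; apply: dotp_eq0.
  set z := _ - _; suff -> : dotp z z = 0 by [].
  apply: (mulfI (lt0r_neq0 N0)); rewrite mulr0.
  rewrite {1}/z dotpDl dotpNl dotpZl mulrBr Gv /c mulrA.
  by rewrite [N * _]mulrC divfK ?gt_eqF // Gu subrr.
have Kq : K ^+ 2 * q = 2 * m * u x * v y - u x ^+ 2 - v y ^+ 2.
  have E : dotp (x - y) (x - y) = K ^+ 2 * q.
    by rewrite -Gu dotpC -[dotp (x - y) _]Gu mulrA -expr2.
  by move: gap0; rewrite /sphere_gap E; lra.
pose s0 := Num.sqrt (m ^+ 2 - 1).
have m21 : 0 < m ^+ 2 - 1 by rewrite subr_gt0 expr_gt1 // ltW.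
have s00 : 0 < s0 by rewrite sqrtr_gt0.
have s02 : s0 ^+ 2 = m ^+ 2 - 1 by rewrite sqr_sqrtr // ltW.
have Wu : K * slope u x = v y * s0.
  apply/eqP; rewrite -(eqrXn2 (n := 2)) ?mulr_ge0 ?ltW ?slope_gt0 // !exprMn.
  by rewrite slope_sqr s02 mulrDr mulr1 Kq /K; apply/eqP; ring.
have Wv : N * slope v y = u x * s0.
  apply/eqP; rewrite -(eqrXn2 (n := 2)) ?mulr_ge0 ?ltW ?slope_gt0 // !exprMn.
  rewrite slope_sqr s02 gvE dotpZl dotpZr -/q mulrDr mulr1.
  have -> : N ^+ 2 * (c * (c * q)) = K ^+ 2 * q by rewrite /c; field; rewrite gt_eqF.
  by rewrite Kq /N; apply/eqP; ring.
have [P Pg Ph] := princ_curv_frame su Ax u0 pu cl.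
have [S Sg Sh] := princ_curv_frame sv Ay v0 pv ck.
have kK := princ_curv_pos sv Ay v0 pv ck.
have star : 2 * m * c + m ^+ 2 * c ^+ 2 * q = 1 + c ^+ 2 + c ^+ 2 * q.
  have NN : N ^+ 2 != 0 by rewrite expf_neq0 // gt_eqF.
  apply: (mulfI NN).
  have -> : N ^+ 2 * (2 * m * c + m ^+ 2 * c ^+ 2 * q) =
     2 * m * K * N + m ^+ 2 * (K ^+ 2 * q) by rewrite /c; field; rewrite gt_eqF.
  have -> : N ^+ 2 * (1 + c ^+ 2 + c ^+ 2 * q) = N ^+ 2 + K ^+ 2 + K ^+ 2 * q.
    by rewrite /c; field; rewrite gt_eqF.
  by rewrite Kq /K /N; ring.
have gvmat : gmat v y = (v y ^+ 2)^-1 *: (1%:M + c ^+ 2 *: (al^T *m al)).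
  have cT : (c *: al)^T = c *: al^T by rewrite linearZ.
  by rewrite /gmat gvE cT -scalemxAl -scalemxAr scalerA -expr2.
have [a e e0|O OO Oe] := second_variation_frames u0 v0 m0 s00 s02 (erefl (gmat u x))
    gvmat Pg Ph Sg Sh kK star.
  have [b Hb] := HQ a e e0; exists b; apply: le_trans Hb.
  have eq_le' (X Y : R) : X = Y -> X <= Y by move=> ->.
  exact: (eq_le' _ _ (gap_hess_geometric a b u0 v0 s00 N0 K0 gvE Wu Wv)).
(* [s0 / m] is [tanh d]. *)
have t01 : 0 < s0 / m < 1.
  rewrite divr_gt0 //= ltr_pdivrMr // mul1r.
  rewrite -(ltr_pXn2r (n := 2)) ?nnegrE ?ltW // s02; lra.
have lt1 := cf_flow cf t01 kK fk.
have le1 : f (psi (s0 / m) k) <= f l.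
  apply: (symmetric_mono_le (cf_symm cf) (cf_mono cf) OO) => //.
  by apply: psi_pos => //; rewrite divr_ge0 // ltW.
by move: (lt_le_trans lt1 le1); rewrite fl ltxx.
Qed.
End Pointwise.

(** * Semicontinuous maxima and convexity above the extended graph *)

Section MaxMin.
Set Implicit Arguments.
Unset Strict Implicit.
Unset Printing Implicit Defensive.
Import numFieldNormedType.Exports.
Variable R : realType.
(** The distance to the closest point enters as a minimum over a family of continuous functions, for
    which upper semicontinuity is immediate and sufficient. Without a maximum the sets [M z < M y]
    cover [C], and the largest [M y] of a finite subcover is a contradiction. *)
Lemma usc_max n (M : 'rV[R]_n -> R) (C : set 'rV[R]_n) :
  compact C -> C !=set0 ->
  (forall x, C x -> forall e, 0 < e -> \forall z \near x, M z < M x + e) ->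
  exists2 x, C x & forall z, C z -> M z <= M x.
Proof.
move=> cC [c0 Cc0] usc; apply: contrapT => nomax.
have bigger x : C x -> exists2 y, C y & M x < M y.
  move=> Cx; apply: contrapT => H; apply: nomax; exists x => // z Cz.
  by rewrite leNgt; apply/negP => lt; apply: H; exists z.
pose U y := interior [set z | M z < M y].
have CU : C `<=` cover C U.
  move=> x Cx; have [y Cy xy] := bigger x Cx; exists y => //.
  have e0 : 0 < M y - M x by rewrite subr_gt0.
  rewrite /U /interior /=; near=> z; rewrite -[M y](subrK (M x)) addrC.
  by near: z; exact: usc.
have [D DC CD] : exists2 D : {fset 'rV[R]_n}, {subset D <= C} &
    C `<=` cover [set i | i \in D] U.
  move: cC; rewrite compact_cover; apply => // i _; exact: open_interior.
have [y yD ymax] : exists2 y, y \in D & forall z, z \in D -> M z <= M y.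
  have [y0 y0D _] := CD _ Cc0.
  have := @arg_maxP _ _ _ [` y0D]%fset xpredT (fun z => M (val z)) isT.
  case=> i _ H; exists (val i); first exact: valP.
  by move=> z zD; exact: (H [` zD]%fset isT).
have Cy : C y by have := DC _ yD; rewrite inE.
have [z zD] := CD _ Cy; move=> /interior_subset /=.
by rewrite ltNge ymax.
Unshelve. all: by end_near. Qed.

Lemma continuous_at_eps n (f : 'rV[R]_n -> R) x :
  (forall e, 0 < e -> exists2 d, 0 < d & forall y, `|y - x| < d -> `|f y - f x| < e) ->
  {for x, continuous f}.
Proof.
move=> H; apply/(@cvgrPdist_lt _ _ _ (nbhs x) (nbhs_filter x)) => e e0.
have [d d0 dP] := H e e0; apply/nbhs_ballP; exists d => // y.
by rewrite -ball_normE /= distrC => /dP; rewrite distrC.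
Qed.

Lemma cvg_sum_seq (T : Type) (F : set_system T) (FF : Filter F) (I : Type)
    (r : seq I) (f : I -> T -> R) (a : I -> R) :
  (forall i, f i t @[t --> F] --> a i) ->
  \sum_(i <- r) f i t @[t --> F] --> \sum_(i <- r) a i.
Proof.
move=> H; elim: r => [|i r IH].
  have -> : (fun t => \sum_(j <- [::]) f j t) = (fun _ : T => 0 : R).
    by apply/funext => t; rewrite big_nil.
  by rewrite big_nil; exact: cvg_cst.
have -> : (fun t => \sum_(j <- i :: r) f j t) =
    (fun t => f i t + \sum_(j <- r) f j t).
  by apply/funext => t; rewrite big_cons.
by rewrite big_cons; exact: cvgD.
Qed.

Lemma cvg_dotp (T : topologicalType) (w : T) n (p q : T -> 'rV[R]_n) x y :
  p @ nbhs w --> x -> q @ nbhs w --> y ->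
  dotp (p t) (q t) @[t --> nbhs w] --> dotp x y.
Proof.
move=> cp cq; rewrite dotpE.
have -> : (fun t => dotp (p t) (q t)) = (fun t => \sum_i p t 0 i * q t 0 i).
  by apply/funext => t; rewrite dotpE.
apply: cvg_sum_seq => i; apply: cvgM.
  by apply: (cvg_comp p (fun w : 'rV[R]_n => w 0 i) cp); exact: coord_continuous.
by apply: (cvg_comp q (fun w : 'rV[R]_n => w 0 i) cq); exact: coord_continuous.
Qed.

Lemma cvg_pairr n (z y : 'rV[R]_n) : (fun w => (z, w)) @ nbhs y --> (z, y).
Proof.
move=> P [[U V] /= [zU yV] UV]; apply: (filterS _ yV) => w Vw.
by apply: UV; split => //=; exact: nbhs_singleton zU.
Qed.

Lemma cvg_pairl n (z y : 'rV[R]_n) : (fun w => (w, y)) @ nbhs z --> (z, y).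
Proof.
move=> P [[U V] /= [zU yV] UV]; apply: (filterS _ zU) => w Uw.
by apply: UV; split => //=; exact: nbhs_singleton yV.
Qed.

Section Data.
Variables (n : nat) (O : set 'rV[R]_n) (eps : R) (v : 'rV[R]_n -> R).
Hypotheses (eps0 : 0 <= eps) (sv : smooth_on O v) (av : admissible O v).
Hypothesis cv : {within closure O, continuous v}.
Hypothesis bv : forall x, (closure O `\` O) x -> v x = eps.
Hypothesis veps : forall x, O x -> eps < v x.

Definition extend_cst (x : 'rV[R]_n) : R := if `[< O x >] then v x else eps.

Lemma extend_in x : O x -> extend_cst x = v x.
Proof. by move=> Ox; rewrite /extend_cst asboolT. Qed.

Lemma extend_out x : ~ O x -> extend_cst x = eps.
Proof. by move=> Ox; rewrite /extend_cst asboolF. Qed.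

Lemma extend_ge x : eps <= extend_cst x.
Proof. by rewrite /extend_cst; case: asboolP => // /veps/ltW. Qed.

Lemma extend_continuous : continuous extend_cst.
Proof.
move=> x; apply: continuous_at_eps => e e0.
have [cx|cx] := pselect (closure O x); last first.
  have oc : open (~` closure O) by apply: closed_openC; exact: closed_closure.
  have [d d0 dP] := open_eps oc cx; exists d => // y /dP cy.
  by rewrite !extend_out ?subrr ?normr0 // => /subset_closure.
have vx : extend_cst x = v x.
  by have [Ox|Ox] := pselect (O x); [rewrite extend_in|rewrite extend_out // bv].
have /within_continuous_eps/(_ x cx e e0)[d d0 dP] := cv.
have [Ox|Ox] := pselect (O x).
  have [r r0 rP] := open_eps (smooth_open sv) Ox.
  exists (Order.min d r); first by rewrite lt_min d0.
  move=> z; rewrite lt_min => /andP[zd zr].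
  have Oz := rP z zr; rewrite vx extend_in //; apply: dP => //.
  exact: subset_closure.
exists d => // z zd; rewrite vx; have [Oz|Oz] := pselect (O z).
  by rewrite extend_in //; apply: dP => //; exact: subset_closure.
by rewrite (extend_out Oz) bv // subrr normr0.
Qed.

Lemma second_difference x w : O x -> w != 0 -> exists2 t, 0 < t & forall r, 0 < r < t ->
  [/\ O (x + r *: w), O (x - r *: w) &
   2 * v x ^+ 2 < v (x + r *: w) ^+ 2 + v (x - r *: w) ^+ 2 + 2 * r ^+ 2 * dotp w w].
Proof.
move=> Ox w0; have [v0 pv] := av Ox.
have Q0 : 0 < qf (adm_matrix v x) w := pv w w0.
have w1 : 0 < `|w| ^+ 2 by rewrite exprn_gt0 // normr_gt0.
have e0 : 0 < qf (adm_matrix v x) w / 2 / `|w| ^+ 2 by rewrite !divr_gt0.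
(* For [m = 0] and both functions equal to [v], the gap in its first variable is
   [|a|^2 + v(x + a)^2] up to a constant, with second-order term the admissibility form. *)
have [d d0 dP] := gap_expand 0 sv sv Ox Ox e0.
have [r0 r00 rP] := open_eps (smooth_open sv) Ox.
have w2 : 0 < `|w| by rewrite normr_gt0.
exists (Order.min d r0 / `|w|); first by rewrite divr_gt0 // lt_min d0.
move=> r /andP[r1]; rewrite ltr_pdivlMr // lt_min => /andP[rd rr].
have nr : `|r *: w| = r * `|w| by rewrite normrZ gtr0_norm.
have zero : `|0 : 'rV[R]_n| < d by rewrite normr0.
have H1 := dP (r *: w) 0 ltac:(by rewrite nr) zero.
have H2 := dP (- (r *: w)) 0 ltac:(by rewrite normrN nr) zero.
split.
- by apply: rP; rewrite addrC addKr nr.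
- by apply: rP; rewrite addrC addKr normrN nr.
have rhs : qf (adm_matrix v x) w / 2 / `|w| ^+ 2 *
      (`|r *: w| ^+ 2 + `|0 : 'rV[R]_n| ^+ 2) =
    r ^+ 2 * (qf (adm_matrix v x) w / 2).
  by rewrite nr normr0; field; rewrite gt_eqF.
move: H1 H2; rewrite normrN rhs.
rewrite !ler_norml => /andP[H1 _] /andP[H2 _].
have d00 (z : 'rV[R]_n) : dotp z 0 = 0 by rewrite dotpC /dotp mul0mx mxE.
move: H1 H2; rewrite /sphere_gap /gap_grad /gap_hess.
have q0 : qf (hess v x) 0 = 0 by rewrite /qf !mul0mx mxE.
have qN : qf (hess v x) (- (r *: w)) = r ^+ 2 * qf (hess v x) w.
  by rewrite -scaleNr qfZ sqrrN.
rewrite qN qfZ qf_adm in Q0 *; rewrite q0 !d00 subrr addr0.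
have e1 : x + r *: w - x = r *: w by rewrite addrC addKr.
have e2 : x - r *: w - x = - (r *: w) by rewrite addrC addKr.
rewrite e1 e2.
have e3 (z : 'rV[R]_n) : dotp 0 z = 0 by rewrite /dotp mul0mx mxE.
rewrite !e3 !(dotpNl (r *: w)) !(dotpNr (r *: w)).
rewrite !(dotpZl r w) !(dotpZr r w).
have r2 : 0 < r ^+ 2 by rewrite exprn_gt0.
have := mulr_gt0 r2 Q0.
move: (dotp w w) (dotp (grad v x) w) (qf (hess v x) w) => X1 X2 X3.
lra.
Qed.

(* [extend_cst ^ 2 + |x|^2] is convex on the whole space: in O this is
   admissibility, and outside O it is supported by [eps ^ 2 + |x|^2]. *)
Lemma midpoint_convex p q : extend_cst (2^-1 *: (p + q)) ^+ 2 <=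
  (extend_cst p ^+ 2 + extend_cst q ^+ 2) / 2 + dotp (p - q) (p - q) / 4.
Proof.
have [->|qp] := eqVneq q p.
  have -> : 2^-1 *: (p + p) = p.
    by rewrite scalerDr -scalerDl -[RHS]scale1r; congr (_ *: _); field.
  have -> : dotp (p - p) (p - p) = 0 by rewrite subrr /dotp mul0mx mxE.
  lra.
pose z := 2^-1 *: (p + q); rewrite -/z.
pose w := q - p; have w0 : w != 0 by rewrite subr_eq0.
(* The excess of [extend_cst^2 + |x|^2] over its chord from [p] to [q]; [t (1 - t) |w|^2] is the
   contribution of [|x|^2]. *)
pose g (t : R) := extend_cst (p + t *: w) ^+ 2 -
   ((1 - t) * extend_cst p ^+ 2 + t * extend_cst q ^+ 2) - t * (1 - t) * dotp w w.
have cg : {within `[0, 1], continuous g}.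
  apply: continuous_subspaceT => t.
  have c1 : (fun t : R => extend_cst (p + t *: w)) @ t --> extend_cst (p + t *: w).
    have : (fun t : R => p + t *: w) @ t --> p + t *: w.
      by apply: cvgD; [exact: cvg_cst|apply: cvgZr_tmp; exact: cvg_id].
    by move=> H; apply: cvg_comp H _; exact: extend_continuous.
  apply: cvgB; first apply: cvgB.
  - by rewrite !expr2; apply: cvgM.
  - by apply: cvgD; apply: cvgM; try exact: cvg_cst; try exact: cvg_id;
      apply: cvgB; [exact: cvg_cst|exact: cvg_id].
  - by apply: cvgM; [apply: cvgM; [exact: cvg_id|apply: cvgB;
      [exact: cvg_cst|exact: cvg_id]]|exact: cvg_cst].
have [t t01 tmax] := EVT_max ler01 cg.
have half : (2^-1 : R) \in `[0, 1]%R.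
  by rewrite in_itv /=; apply/andP; split; lra.
have zE : z = p + 2^-1 *: w.
  rewrite /z /w scalerDr scalerBr [RHS]addrCA [RHS]addrC; congr (_ + _).
  by rewrite -[X in X - _]scale1r -scalerBl; congr (_ *: _); field.
have dw : dotp (p - q) (p - q) = dotp w w.
  by rewrite /w -opprB dotpNl dotpNr opprK.
suff : g t <= 0.
  move=> gt0; have := le_trans (tmax _ half) gt0.
  by rewrite /g -zE dw; lra.
have [tO|tO] := pselect (O (p + t *: w)); last first.
  move: t01; rewrite in_itv /= => /andP[t0 t1].
  rewrite /g (extend_out tO).
  have E (x : 'rV[R]_n) : eps ^+ 2 <= extend_cst x ^+ 2.
    by rewrite lerXn2r ?nnegrE ?extend_ge // (le_trans eps0 (extend_ge x)).
  have := ler_wpM2l t0 (E q); have t1' : 0 <= 1 - t by rewrite subr_ge0.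
  have := ler_wpM2l t1' (E p).
  have : 0 <= t * (1 - t) * dotp w w by rewrite !mulr_ge0 // dotp_ge0.
  lra.
rewrite leNgt; apply/negP => gt0.
have g0 : g 0 = 0 by rewrite /g scale0r addr0; ring.
have g1 : g 1 = 0 by rewrite /g scale1r /w [p + _]addrC subrK; ring.
have [t0 t1] : 0 < t /\ t < 1.
  move: t01; rewrite in_itv /= => /andP[t0 t1]; split.
    by rewrite lt_def t0 andbT; apply: contraTneq gt0 => ->; rewrite g0 ltxx.
  by rewrite lt_def t1 andbT eq_sym; apply: contraTneq gt0 => ->; rewrite g1 ltxx.
have [r0 r00 rP] := second_difference tO w0.
pose r := Order.min (r0 / 2) (Order.min t (1 - t)).
have rr : 0 < r < r0.
  rewrite !lt_min t0 subr_gt0 t1 divr_gt0 //= gt_min.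
  by rewrite [r0 / 2 < r0]gtr_pMr // invf_lt1 // ltr1n.
have [inp inm sd] := rP r rr.
have rt : r <= t by rewrite /r !ge_min lexx ?orbT.
have rt' : r <= 1 - t by rewrite /r !ge_min lexx ?orbT.
have r1 : 0 < r by case/andP: rr.
have in_r1 : t + r \in `[0, 1]%R.
  by rewrite in_itv /=; apply/andP; split; lra.
have in_r2 : t - r \in `[0, 1]%R.
  by rewrite in_itv /=; apply/andP; split; lra.
have := tmax _ in_r1; have := tmax _ in_r2.
have E1 : p + (t + r) *: w = p + t *: w + r *: w by rewrite scalerDl addrA.
have E2 : p + (t - r) *: w = p + t *: w - r *: w by rewrite scalerBl addrA.
rewrite /g E1 E2 (extend_in inp) (extend_in inm) (extend_in tO); lra.
Qed.

End Data.
End MaxMin.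

(** * The comparison principle *)

Section MaxMin2.
Set Implicit Arguments.
Unset Strict Implicit.
Unset Printing Implicit Defensive.
Import numFieldNormedType.Exports.
Variable R : realType.
Section Comparison.
Variables (n : nat) (O : set 'rV[R]_n) (eps s : R) (f u v : 'rV[R]_n -> R).
Hypotheses (eps0 : 0 <= eps) (cf : comparison_function f s).
Hypotheses (su : smooth_on O u) (sv : smooth_on O v).
Hypotheses (au : admissible O u) (av : admissible O v).
Hypothesis bO : bounded_set O.
Hypothesis cv : {within closure O, continuous v}.
Hypothesis bv : forall x, (closure O `\` O) x -> v x = eps.
Hypotheses (ueps : forall x, O x -> eps < u x) (veps : forall x, O x -> eps < v x).
Hypotheses (eu : curv_eq f O u s) (ev : curv_eq f O v s).
(** [(u^2 + v^2) / (2 u v)] is the hyperbolic cosine of the distance between the points of the two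
    graphs above [x]; it is asked to tend to 1 at the boundary. *)
Hypothesis bdry : forall m x0, 1 < m -> (closure O `\` O) x0 ->
  exists2 d, 0 < d & forall x, O x -> `|x - x0| < d ->
    u x ^+ 2 + v x ^+ 2 <= 2 * m * u x * v x.

Let vt := extend_cst O eps v.

Let dist2 x y : R := dotp (x - y) (x - y) + u x ^+ 2.
Let low x y : R := Num.max (vt y) (Num.sqrt (dist2 x y)).

(* The hyperbolic cosine of the distance from the point (x, u x) to the
   vertical ray above (y, vt y), whose closest point has height [low x y]. *)
Let G x y : R := (dist2 x y + low x y ^+ 2) / (2 * u x * low x y).

Let u0 x : O x -> 0 < u x. Proof. by case/au. Qed.

Let dist2_gt0 x y : O x -> 0 < dist2 x y.
Proof. by move=> Ox; rewrite ltr_wpDl ?dotp_ge0 // exprn_gt0 // u0. Qed.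

Let low_gt0 x y : O x -> 0 < low x y.
Proof. by move=> Ox; rewrite lt_max sqrtr_gt0 dist2_gt0 // orbT. Qed.

Let low_sqr x y : O x -> dist2 x y <= low x y ^+ 2.
Proof.
move=> Ox; have d0 := dist2_gt0 y Ox; have l0 := ltW (low_gt0 y Ox).
rewrite -[X in X <= _](sqr_sqrtr (ltW d0)).
by rewrite ler_pXn2r ?nnegrE ?sqrtr_ge0 // le_max lexx orbT.
Qed.

Let G_le x y h : O x -> 0 < h -> vt y <= h ->
  G x y * (2 * u x * h) <= dist2 x y + h ^+ 2.
Proof.
move=> Ox h0 hv; have ux := u0 Ox; have l0 := low_gt0 y Ox.
have -> : G x y * (2 * u x * h) = (dist2 x y + low x y ^+ 2) * h / low x y.
  by rewrite /G; field; rewrite !gt_eqF.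
rewrite ler_pdivrMr //; set L := low x y in l0 *.
(* [(D + h^2) / h] decreases up to [h = sqrt D] and increases afterwards, so its minimum over
   [h >= vt y] is at [L]; this product is the cleared-denominator form. *)
suff : 0 <= (h - L) * (h * L - dist2 x y) by lra.
have d0 := dist2_gt0 y Ox.
have [Lh|hL] := leP L h.
  apply: mulr_ge0; first by rewrite subr_ge0.
  rewrite subr_ge0; apply: le_trans (low_sqr y Ox) _.
  by rewrite expr2 ler_pM2r.
have LE : L = Num.sqrt (dist2 x y).
  move: hL; rewrite /L /low; case: (leP (vt y) _) => // _ hv'.
  by move: (lt_le_trans hv' hv); rewrite ltxx.
have -> : dist2 x y = L ^+ 2 by rewrite LE sqr_sqrtr // ltW.
have -> : (h - L) * (h * L - L ^+ 2) = L * (h - L) ^+ 2 by ring.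
by rewrite mulr_ge0 ?sqr_ge0 // ltW.
Qed.

Let G_low x y : O x -> G x y * (2 * u x * low x y) = dist2 x y + low x y ^+ 2.
Proof.
move=> Ox; rewrite /G divfK // !mulf_neq0 ?pnatr_eq0 ?gt_eqF ?u0 ?low_gt0 //.
Qed.

Let G_cont x y : O x ->
  G z.1 z.2 @[z --> (x, y)] --> G x y.
Proof.
move=> Ox.
have cu : u z.1 @[z --> (x, y)] --> u x.
  have ux : {for x, continuous u}.
    by apply: continuous_at_eps => e e0; exact: (smooth_cont su Ox e0).
  by apply: (cvg_comp (fun z : 'rV[R]_n * 'rV[R]_n => z.1) u _ ux); exact: cvg_fst.
have cvt : vt z.2 @[z --> (x, y)] --> vt y.
  have vy := extend_continuous sv cv bv (x := y).
  by apply: (cvg_comp (fun z : 'rV[R]_n * 'rV[R]_n => z.2) vt _ vy); exact: cvg_snd.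
have cd : dist2 z.1 z.2 @[z --> (x, y)] --> dist2 x y.
  apply: cvgD; last by rewrite !expr2; exact: (cvgM cu cu).
  have c1 i : (z : 'rV[R]_n * 'rV[R]_n).1 0 i @[z --> (x, y)] --> x 0 i.
    apply: (@cvg_comp _ _ _ (fun z : 'rV[R]_n * 'rV[R]_n => z.1)
      (fun w : 'rV[R]_n => w 0 i) _ (nbhs x) _ cvg_fst).
    exact: coord_continuous.
  have c2 i : (z : 'rV[R]_n * 'rV[R]_n).2 0 i @[z --> (x, y)] --> y 0 i.
    apply: (@cvg_comp _ _ _ (fun z : 'rV[R]_n * 'rV[R]_n => z.2)
      (fun w : 'rV[R]_n => w 0 i) _ (nbhs y) _ cvg_snd).
    exact: coord_continuous.
  have dE (a b : 'rV[R]_n) : dotp (a - b) (a - b) =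
      \sum_i (a 0 i - b 0 i) * (a 0 i - b 0 i).
    by rewrite dotpE; apply: eq_bigr => i _; rewrite !mxE.
  under eq_fun do rewrite dE.
  rewrite dE.
  exact: (@cvg_sum_seq R _ (nbhs (x, y)) (nbhs_filter (x, y)) _ _
    (fun i (z : 'rV[R]_n * 'rV[R]_n) => (z.1 0 i - z.2 0 i) * (z.1 0 i - z.2 0 i))
    _ (fun i => cvgM (cvgB (c1 i) (c2 i)) (cvgB (c1 i) (c2 i)))).
have cl : low z.1 z.2 @[z --> (x, y)] --> low x y.
  apply: (@continuous_max _ _ (fun z : 'rV[R]_n * 'rV[R]_n => vt z.2)
    (fun z : 'rV[R]_n * 'rV[R]_n => Num.sqrt (dist2 z.1 z.2)) (x, y)) => //.
  apply: (cvg_comp (fun z => dist2 z.1 z.2) (@Num.sqrt R) cd).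
  exact: sqrt_continuous.
apply: cvgM; first by apply: cvgD => //; rewrite !expr2; exact: cvgM.
apply: cvgV; first by rewrite !mulf_neq0 ?pnatr_eq0 ?gt_eqF ?u0 ?low_gt0.
by apply: cvgM => //; apply: cvgM => //; exact: cvg_cst.
Qed.

(** If the nearest point of the ray lies strictly above its foot [vt y], then [y] can slide towards
    [x] at constant height and stay above [vt], which shortens the distance unless [y = x] already.
    In that last case the point of graph [u] is itself above graph [v]. *)
Let claim (B : set 'rV[R]_n) x y : O x -> B y ->
  (forall t, 0 <= t <= 1 -> B (y + t *: (x - y))) ->
  (forall z, B z -> G x y <= G x z) ->
  low x y = vt y \/ (y = x /\ v x < u x).
Proof.
move=> Ox By Bconv ymin; have ux := u0 Ox.
have D0 := dist2_gt0 y Ox; have L0 := low_gt0 y Ox.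
have [|lt] := leP (Num.sqrt (dist2 x y)) (vt y).
  by move=> le; left; rewrite /low; apply/max_idPl.
right; have LE : low x y = Num.sqrt (dist2 x y).
  by rewrite /low; apply/max_idPr; exact: ltW.
have xy : y = x.
  apply: contrapT => xy.
  have w0 : 0 < dotp (x - y) (x - y).
    rewrite lt_def dotp_ge0 andbT; apply/negP => /eqP w0; apply: xy.
    by apply/esym/eqP; rewrite -subr_eq0; apply/eqP; apply: dotp_eq0; rewrite w0.
  have e0 : 0 < low x y - vt y by rewrite LE subr_gt0.
  have vy := extend_continuous sv cv bv (x := y).
  have := (@cvgrPdist_lt _ _ _ (nbhs y) (nbhs_filter y) _ _).1 vy _ e0.
  move=> /nbhs_normP[d /= d0 dP].
  pose t := Num.min 1 (d / (`|x - y| + 1) / 2).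
  have n1 : 0 < `|x - y| + 1 by rewrite ltr_wpDl.
  have t0 : 0 < t by rewrite lt_min ltr01 !divr_gt0.
  have t1 : t <= 1 by rewrite ge_min lexx.
  have td : t * (`|x - y| + 1) < d.
    have td2 : t <= d / (`|x - y| + 1) / 2 by rewrite ge_min lexx orbT.
    apply: le_lt_trans (_ : d / 2 < d); last by rewrite gtr_pMr // invf_lt1 // ltr1n.
    by rewrite -ler_pdivlMr // mulrAC.
  pose z := y + t *: (x - y).
  have zd : `|y - z| < d.
    rewrite /z opprD addrA subrr add0r normrN normrZ gtr0_norm //.
    by apply: le_lt_trans td; rewrite ler_pM2l // lerDl.
  have vz : vt z <= low x y.
    have := dP z zd; rewrite -/vt ltr_norml => /andP[H _]; lra.
  have Bz : B z by apply: Bconv; rewrite t1 ltW.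
  have := G_le Ox L0 vz; apply/negP; rewrite -ltNge.
  have l2 : 0 < 2 * u x * low x y by rewrite !mulr_gt0.
  apply: lt_le_trans (_ : G x y * (2 * u x * low x y) <= _); last first.
    by rewrite ler_pM2r // ymin.
  rewrite G_low // ltrD2r /dist2 ltrD2r.
  have -> : x - z = (1 - t) *: (x - y).
    by rewrite /z opprD addrA scalerBl scale1r.
  rewrite dotpZl dotpZr mulrA gtr_pMl //.
  have : 0 <= 1 - t by rewrite subr_ge0.
  nra.
split=> //; move: lt; rewrite xy /dist2 subrr.
have -> : dotp (0 : 'rV[R]_n) 0 = 0 by rewrite /dotp mul0mx mxE.
by rewrite add0r sqrtr_sqr gtr0_norm // /vt extend_in.
Qed.

Lemma comparison_principle x : O x -> v x <= u x.
Proof.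
move=> Ox1; set x1 := x in Ox1 *; rewrite leNgt; apply/negP => uv1.
have [rho rho0 Orho] : exists2 rho, 0 < rho & forall y, O y -> `|y| <= rho.
  have [M [Mr MP]] := bO; exists (`|M| + 1); first by rewrite ltr_wpDl.
  move=> y Oy; apply: MP => //; apply: le_lt_trans (ler_norm M) _.
  by rewrite ltrDl.
(* [O] need not be convex, while the search for the closest point and the midpoint argument want a
   compact convex set; [vt] is defined on all of this ball. *)
pose B := closed_ball (0 : 'rV[R]_n) rho.
have BE y : B y <-> `|y| <= rho.
  by rewrite /B closed_ballE // /closed_ball_ /= sub0r normrN.
have OB y : O y -> B y by move=> /Orho /BE.
have cB : compact B.
  apply: bounded_closed_compact; last exact: closed_ball_closed.
  exists rho; split; first exact: num_real.
  by move=> r rr y /BE; move=> /le_trans; apply; exact: ltW.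
have Bconv y z t : B y -> B z -> 0 <= t <= 1 -> B (y + t *: (z - y)).
  move=> /BE yr /BE zr /andP[t0 t1]; apply/BE.
  have -> : y + t *: (z - y) = (1 - t) *: y + t *: z.
    by rewrite scalerBr scalerBl scale1r addrCA addrC -addrA [- _ + _]addrC.
  apply: le_trans (ler_normD _ _) _; rewrite !normrZ ger0_norm ?subr_ge0 //.
  rewrite ger0_norm //.
  have t1' : 0 <= 1 - t by rewrite subr_ge0.
  have := ler_wpM2l t1' yr; have := ler_wpM2l t0 zr; lra.
pose minimizer z y := B y /\ forall y', B y' -> G z y <= G z y'.
have minE z : O z -> exists y, minimizer z y.
  move=> Oz; have [||y yB ymin] := @EVT_min_rV R n (G z) B _ cB.
  - by exists z; exact: OB.
  - apply: continuous_subspaceT => y.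
    have H := G_cont (y := y) Oz.
    apply: (cvg_comp (fun y => (z, y)) (fun p : _ * _ => G p.1 p.2) _ H).
    exact: cvg_pairr.
  exists y; split; first by rewrite inE in yB.
  by move=> y' By'; apply: ymin; rewrite inE.
pose Y z := xget 0 (minimizer z).
have YP z : O z -> minimizer z (Y z).
  by move=> /minE[y ym]; exact: (xgetPex 0 (ex_intro _ y ym)).
pose M z := G z (Y z).
have Mle z y : O z -> B y -> M z <= G z y by move=> /YP[_]; apply.
have Mone z : O z -> 1 < M z -> u z < v z.
  move=> Oz Mz; rewrite ltNge; apply/negP => vu.
  have vz : vt z <= u z by rewrite /vt extend_in.
  have := G_le Oz (u0 Oz) vz; rewrite /dist2 subrr.
  have -> : dotp (0 : 'rV[R]_n) 0 = 0 by rewrite /dotp mul0mx mxE.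
  have := Mle _ _ Oz (OB _ Oz) => MG; have uz := u0 Oz.
  have uu : 0 < 2 * u z * u z by rewrite !mulr_gt0.
  have : 1 * (2 * u z * u z) < G z z * (2 * u z * u z).
    by rewrite ltr_pM2r //; exact: lt_le_trans Mz MG.
  lra.
have claimY z y : O z -> u z < v z -> minimizer z y -> low z y = vt y.
  move=> Oz uvz [By ymin].
  have [t t01||[_]] // := @claim B z y Oz By _ ymin.
    by apply: Bconv => //; exact: OB.
  by move=> /lt_trans/(_ uvz); rewrite ltxx.
have M1 : 1 < M x1.
  have [By ymin] := YP _ Ox1; rewrite /M; set y := Y x1 in By ymin *.
  have lE := claimY x1 y Ox1 uv1 (conj By ymin).
  have ux := u0 Ox1; have L0 := low_gt0 y Ox1.
  have l2 : 0 < 2 * u x1 * low x1 y by rewrite !mulr_gt0.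
  rewrite -(ltr_pM2r l2) G_low // mul1r.
  have [xy|xy] := eqVneq y x1.
    move: lE; rewrite xy /vt extend_in // => lE; rewrite lE /dist2 subrr.
    have -> : dotp (0 : 'rV[R]_n) 0 = 0 by rewrite /dotp mul0mx mxE.
    have : 0 < (v x1 - u x1) ^+ 2 by rewrite exprn_gt0 // subr_gt0.
    lra.
  have w0 : 0 < dotp (x1 - y) (x1 - y).
    rewrite lt_def dotp_ge0 andbT; apply: contra_neq xy => w0.
    by apply/esym/eqP; rewrite -subr_eq0; apply/eqP; apply: dotp_eq0; rewrite w0.
  by have := sqr_ge0 (low x1 y - u x1); rewrite /dist2; lra.
(* A level strictly between 1 and [M x1]. By [bdry], the points with [M > mb] lie in the compact set
   [C] inside [O], so the maximum of [M] can be sought there. *)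
pose mb := (1 + M x1) / 2.
have mb1 : 1 < mb by rewrite /mb; lra.
have mbM : mb < M x1 by rewrite /mb; lra.
pose good := [set z | O z -> u z ^+ 2 + v z ^+ 2 <= 2 * mb * u z * v z].
have goodM z : O z -> good z -> M z <= mb.
  move=> Oz /(_ Oz) gz; have uz := u0 Oz.
  have vz : 0 < v z by case: (av Oz).
  have vtz : vt z <= v z by rewrite /vt extend_in.
  have := G_le Oz vz vtz; rewrite /dist2 subrr.
  have -> : dotp (0 : 'rV[R]_n) 0 = 0 by rewrite /dotp mul0mx mxE.
  rewrite add0r => H; apply: le_trans (Mle _ _ Oz (OB _ Oz)) _.
  have l2 : 0 < 2 * u z * v z by rewrite !mulr_gt0.
  rewrite -(ler_pM2r l2); apply: le_trans H _; apply: le_trans gz _.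
  by rewrite le_eqVlt; apply/orP; left; apply/eqP; ring.
pose C := closure O `&` ~` (interior good).
have CO z : C z -> O z.
  move=> [cz nz]; apply: contrapT => Oz; apply: nz.
  have [d d0 dP] := bdry mb1 (conj cz Oz).
  rewrite /interior /=; apply/nbhs_ballP; exists d => // y.
  by rewrite -ball_normE /= distrC => yz Oy; exact: dP.
have OC z : O z -> mb < M z -> C z.
  move=> Oz Mz; split; first exact: subset_closure.
  move=> /interior_subset gz; have := goodM z Oz gz.
  by rewrite leNgt Mz.
have cC : compact C.
  apply: (subclosed_compact _ cB).
    apply: closedI; first exact: closed_closure.
    by apply: open_closedC; exact: open_interior.
  by move=> z /CO /OB.
have [|z Cz e e0|x0 Cx0 x0max] := @usc_max R n M C cC.
- by exists x1; exact: OC.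
- have Oz := CO z Cz; have [By _] := YP z Oz.
  have H := G_cont (y := Y z) Oz.
  have H2 : G z' (Y z) @[z' --> z] --> G z (Y z).
    apply: (cvg_comp (fun z' => (z', Y z)) (fun p : _ * _ => G p.1 p.2) _ H).
    exact: cvg_pairl.
  have H3 := (@cvgrPdist_lt _ _ _ (nbhs z) (nbhs_filter z) _ _).1 H2 e e0.
  have H4 : nbhs z O := open_nbhs_nbhs (conj (smooth_open su) Oz).
  apply: filterS2 H3 H4 => z' /= H5 Oz'.
  apply: le_lt_trans (Mle _ _ Oz' By) _.
  by move: H5; rewrite ltr_norml /M => /andP[H5 _]; lra.
set m := M x0 in x0max.
have mM : M x1 <= m by apply: x0max; exact: OC.
have m1 : 1 < m by exact: lt_le_trans M1 mM.
have Ox0 := CO _ Cx0.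
have Mall z : O z -> M z <= m.
  move=> Oz; have [le|lt] := leP (M z) mb; last by apply: x0max; exact: OC.
  by apply: le_trans le _; apply: le_trans mM; exact: ltW.
have uv0 := Mone _ Ox0 m1.
pose y0 := Y x0; have [By0 y0min] := YP _ Ox0.
have ux0 := u0 Ox0.
(* The minimizing height is at least [u z > eps], and outside [O] the foot of the ray is at height
   [eps]. *)
have contact z y : O z -> low z y = vt y -> O y.
  move=> Oz lE; apply: contrapT => Oy.
  have L0 := low_gt0 y Oz; have uz := u0 Oz.
  have : u z <= low z y.
    rewrite -(ler_pXn2r (n := 2)) ?nnegrE ?(ltW uz) ?(ltW L0) //.
    by apply: le_trans (low_sqr y Oz); rewrite /dist2 lerDr dotp_ge0.
  by rewrite lE /vt extend_out // leNgt ueps.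
have l0 := claimY x0 y0 Ox0 uv0 (YP _ Ox0).
have Oy0 := contact _ _ Ox0 l0.
have vtE y : O y -> vt y = v y by move=> Oy; rewrite /vt extend_in.
have gapE z y h : sphere_gap h u v z y = dist2 z y + v y ^+ 2 - 2 * h * u z * v y.
  by [].
have mE : m * (2 * u x0 * v y0) = dist2 x0 y0 + v y0 ^+ 2.
  by have := G_low y0 Ox0; rewrite l0 vtE.
have vy0 : 0 < v y0 by case: (av Oy0).
have muv : m * u x0 <= v y0.
  have := low_sqr y0 Ox0; rewrite l0 vtE // => d2.
  rewrite -(ler_pM2r vy0); lra.
(* Given two closest points, the midpoint at the height [h] allowed by [midpoint_convex] is again
   above [vt]. That its distance is not smaller gives [2 h <= v y0 + v y], and inserting [h^2]
   leaves [(v y0 - v y)^2 + |y0 - y|^2 <= 0]. *)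
have uniq y : B y -> G x0 y <= m -> y = y0.
  move=> By Gy.
  have ymin : minimizer x0 y.
    by split => // y' By'; apply: le_trans Gy _; exact: Mle.
  have ly := claimY x0 y Ox0 uv0 ymin.
  have GE : G x0 y = m by apply/eqP; rewrite eq_le Gy Mle.
  have Oy := contact _ _ Ox0 ly.
  have hE : m * (2 * u x0 * v y) = dist2 x0 y + v y ^+ 2.
    by have := G_low y Ox0; rewrite ly vtE // GE.
  have vy : 0 < v y by case: (av Oy).
  pose z := 2^-1 *: (y0 + y).
  pose h2 := (v y0 ^+ 2 + v y ^+ 2) / 2 + dotp (y0 - y) (y0 - y) / 4.
  have h20 : 0 < h2.
    by rewrite ltr_wpDr ?divr_ge0 ?dotp_ge0 // divr_gt0 // addr_gt0 // exprn_gt0.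
  pose h := Num.sqrt h2; have h0 : 0 < h by rewrite sqrtr_gt0.
  have hh : h ^+ 2 = h2 by rewrite sqr_sqrtr // ltW.
  have vz : vt z <= h.
    rewrite -(ler_pXn2r (n := 2)) ?nnegrE ?(ltW h0) // ?hh.
      have := midpoint_convex eps0 sv av cv bv veps y0 y.
      have E0 := vtE y0 Oy0; have E1 := vtE y Oy.
      by rewrite /vt in E0 E1; rewrite E0 E1.
    by apply: le_trans eps0 _; exact: extend_ge.
  have Bz : B z.
    have -> : z = y0 + 2^-1 *: (y - y0).
      rewrite /z scalerDr scalerBr [RHS]addrCA [RHS]addrC; congr (_ + _).
      by rewrite -[X in X - _]scale1r -scalerBl; congr (_ *: _); field.
    by apply: Bconv => //; apply/andP; split; lra.
  have := G_le Ox0 h0 vz.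
  have : dist2 x0 z + h ^+ 2 = m * u x0 * (v y0 + v y).
    have -> : m * u x0 * (v y0 + v y) =
       (dist2 x0 y0 + v y0 ^+ 2 + (dist2 x0 y + v y ^+ 2)) / 2.
      by rewrite -mE -hE; field.
    rewrite hh /h2 /dist2 /z !dotp_lin (dotpC y0 x0) (dotpC y x0) (dotpC y y0).
    by field.
  move=> -> le1.
  have h2l : 0 < 2 * u x0 * h by rewrite !mulr_gt0.
  have le2 : m * (2 * u x0 * h) <= m * u x0 * (v y0 + v y).
    by apply: le_trans le1; rewrite ler_pM2r //; exact: Mle.
  have mu : 0 < m * u x0 by rewrite mulr_gt0 // (lt_trans ltr01).
  have le3 : 2 * h <= v y0 + v y.
    rewrite -(ler_pM2l mu); apply: le_trans le2.
    by rewrite le_eqVlt; apply/orP; left; apply/eqP; ring.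
  have le4 : (2 * h) ^+ 2 <= (v y0 + v y) ^+ 2.
    have h2p : 0 <= 2 * h := mulr_ge0 (ler0n R 2) (ltW h0).
    have vvp : 0 <= v y0 + v y := addr_ge0 (ltW vy0) (ltW vy).
    by rewrite ler_pXn2r ?nnegrE.
  apply/esym/eqP; rewrite -subr_eq0; apply/eqP; apply: dotp_eq0.
  have := sqr_ge0 (v y0 - v y); move: le4; rewrite exprMn hh /h2; lra.
apply: (touching_contradiction (u := u) (v := v) (x := x0) (y := y0) cf su sv
  Ox0 Oy0 au av (eu Ox0) (ev Oy0) m1 muv).
- by rewrite gapE -mE; ring.
- have [d d0 dP] := open_eps (smooth_open sv) Oy0; exists d => // b bd.
  have Ob : O (y0 + b) by apply: dP; rewrite addrC addKr.
  have vb : 0 < v (y0 + b) by case: (av Ob).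
  have vtb : vt (y0 + b) <= v (y0 + b) by rewrite vtE.
  have := G_le Ox0 vb vtb; have := y0min _ (OB _ Ob); rewrite -/(M x0) -/m => Gm.
  have l2 : 0 < 2 * u x0 * v (y0 + b) by rewrite !mulr_gt0.
  have : m * (2 * u x0 * v (y0 + b)) <= G x0 (y0 + b) * (2 * u x0 * v (y0 + b)).
    by rewrite ler_pM2r.
  by rewrite gapE; lra.
move=> eta eta0.
(* On this compact set [G x0 > m] by uniqueness, and the inequality persists for base points near
   [x0]. Since [M <= m] everywhere, closest points of nearby base points stay within [eta] of [y0],
   which is the last contact condition. *)
pose K := B `&` ~` (ball y0 eta).
have cK : compact K.
  apply: (subclosed_compact _ cB); last by move=> ? [].
  by apply: closedI; [exact: closed_ball_closed|apply: open_closedC; exact: ball_open].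
have far : \forall z \near x0, forall y, K y -> m < G z y.
  have := (compact_near_coveringP K).1 cK _ (nbhs x0) (fun z y => m < G z y).
  apply; move=> y [By ny].
  have Gy : m < G x0 y.
    rewrite ltNge; apply/negP => /(uniq _ By) E.
    by apply: ny; rewrite E; exact: ballxx.
  have H := G_cont (y := y) Ox0.
  have e0 : 0 < G x0 y - m by rewrite subr_gt0.
  have := (@cvgrPdist_lt _ _ _ (nbhs (x0, y)) (nbhs_filter (x0, y)) _ _).1 H _ e0.
  move=> [[U V] /= [nU nV] UV]; exists (V, U) => //= -[y' z'] /= [Vy' Uz'].
  have := UV (z', y') (conj Uz' Vy'); rewrite /= ltr_norml => /andP[_ H5]; lra.
have near_lt : \forall z \near x0, u z < v z.
  have e0 : 0 < (v x0 - u x0) / 2 by rewrite divr_gt0 // subr_gt0.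
  have [d1 d10 dP1] := smooth_cont su Ox0 e0.
  have [d2 d20 dP2] := smooth_cont sv Ox0 e0.
  apply/nbhs_ballP; exists (Num.min d1 d2); first by rewrite /= lt_min d10.
  move=> z; rewrite -ball_normE /= distrC lt_min => /andP[/dP1 H1 /dP2 H2].
  move: H1 H2; rewrite !ltr_norml => /andP[_ H1] /andP[H2 _]; lra.
have nO : nbhs x0 O := open_nbhs_nbhs (conj (smooth_open su) Ox0).
have nb : \forall z \near x0, ((forall y, K y -> m < G z y) /\ u z < v z) /\ O z.
  exact: (@filterI _ (nbhs x0) _ _ _ (@filterI _ (nbhs x0) _ _ _ far near_lt) nO).
have /nbhs_ballP[d /= d0 dP] := nb.
exists d => // a ad; have [[fa uva] Oa] : (((forall y, K y -> m < G (x0 + a) y) /\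
    u (x0 + a) < v (x0 + a)) /\ O (x0 + a)).
  by apply: dP; rewrite -ball_normE /= opprD addrA subrr add0r normrN.
have [BY Ymin] := YP _ Oa; pose y := Y (x0 + a).
have lE := claimY _ y Oa uva (conj BY Ymin).
have OY := contact _ _ Oa lE.
exists (y - y0).
  have : ~ K y.
    by move=> /fa; rewrite ltNge Mall.
  move=> nK; rewrite distrC; apply: contrapT => nfar; apply: nK; split => //.
  by rewrite -ball_normE.
rewrite subrKC gapE.
have := G_low y Oa; rewrite lE vtE // => <-.
have vy : 0 < v y by case: (av OY).
have l2 : 0 < 2 * u (x0 + a) * v y by rewrite !mulr_gt0 // u0.
have : G (x0 + a) y * (2 * u (x0 + a) * v y) <= m * (2 * u (x0 + a) * v y).
  by rewrite ler_pM2r //; exact: Mall.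
lra.
Qed.

End Comparison.
End MaxMin2.

(** * Behaviour of solutions at the boundary *)

Section Boundary.
Set Implicit Arguments.
Unset Strict Implicit.
Unset Printing Implicit Defensive.
Import numFieldNormedType.Exports.
Variable R : realType.
(** The distance between heights [t p] and [t q] above one point does not depend on [t]. For
    boundary height [eps > 0] it is used with [t = 1] and [A = eps], for boundary height 0 with [t]
    the time along the inner normal and [A] the common normal derivative. The bounds on [d] come
    from [(p - q)^2 <= 4 d^2] and [p q >= A^2 / 4]. *)
Lemma ratio_bound (m A t p q d : R) : 1 < m -> 0 < A -> 0 <= t -> d <= A / 2 ->
  d <= (m - 1) * A / 4 -> `|p - A| <= d -> `|q - A| <= d ->
  (t * p) ^+ 2 + (t * q) ^+ 2 <= 2 * m * (t * p) * (t * q).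
Proof.
move=> m1 A0 t0 dA dm; rewrite !ler_norml => /andP[p1 p2] /andP[q1 q2].
have p0 : A / 2 <= p by lra.
have q0 : A / 2 <= q by lra.
have A2 : 0 <= A / 2 by rewrite divr_ge0 // ltW.
have pq : A / 2 * (A / 2) <= p * q by exact: ler_pM.
have d0 : 0 <= d by lra.
have dd : d * d <= A / 2 * ((m - 1) * A / 4) by exact: ler_pM.
have sq : (p - q) ^+ 2 <= (2 * d) ^+ 2.
  rewrite -[X in X <= _]real_normK ?num_real // lerXn2r ?nnegrE ?normr_ge0 //.
    by rewrite mulr_ge0.
  by rewrite ler_norml; apply/andP; split; lra.
have m10 : 0 <= m - 1 by lra.
have := ler_wpM2l m10 pq => H1.
have : 0 <= t ^+ 2 * (2 * (m - 1) * (p * q) - (p - q) ^+ 2).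
  rewrite mulr_ge0 ?sqr_ge0 //; lra.
lra.
Qed.

Lemma dotp_addZ n (y g : 'rV[R]_n) (k : R) : dotp (y + k *: g) (y + k *: g) =
  dotp y y + 2 * k * dotp y g + k * k * dotp g g.
Proof. by rewrite !dotp_lin (dotpC g y); ring. Qed.

(** At an interior minimum the graph lies above a horizontal horosphere, whose curvatures are all 1;
    its own curvatures are then at least 1 and [f >= 1 > s]. So the minimum over the closure is
    attained on the boundary only. *)
Lemma admissible_above_boundary n (O : set 'rV[R]_n) eps s (f u : 'rV[R]_n -> R) :
  s < 1 -> comparison_function f s -> bounded_set O ->
  smooth_on O u -> {within closure O, continuous u} -> admissible O u ->
  curv_eq f O u s -> (forall x, (closure O `\` O) x -> u x = eps) ->
  forall x, O x -> eps < u x.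
Proof.
move=> s1 cf bO su cu au eu bu.
have nomin x : O x -> ~ (forall y, O y -> u x <= u y).
  move=> Ox xmin; have [u0 pu] := au x Ox; have [l [cl fl]] := eu x Ox.
  have [r r0 rP] := open_eps (smooth_open su) Ox.
  have [] := @jet_max R n (fun h => - (u (x + h) - u x)) (- grad u x) 0
    (- hess u x) 0 r.
  - move=> e e0; have [d d0 dP] := taylor2 su Ox e0.
    have qN h : qf (- hess u x) h = - qf (hess u x) h.
      by rewrite /qf mulmxN mulNmx mxE.
    exists d => // h hd; rewrite qN dotpNl; have := dP h hd.
    move: (dotp _ _) (qf _ _) => X1 X2.
    have -> : - (u (x + h) - u x) - - X1 - 2^-1 * - X2 =
      - (u (x + h) - u x - X1 - 2^-1 * X2) by ring.
    by rewrite normrN.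
  - exact: r0.
  - move=> h hr; rewrite mul0r addr0 /dotp mul0mx mxE oppr_le0 subr_ge0.
    by apply: xmin; apply: rP; rewrite addrC addKr.
  move=> G0 H0.
  have G00 : grad u x = 0 by rewrite -[LHS]opprK G0 oppr0.
  have W1 : slope u x = 1.
    by rewrite /slope G00 /dotp mul0mx mxE addr0 sqrtr1.
  have lge i : 1 <= l 0 i.
    have [H _] := curv_bounds 0 i su Ox u0 pu cl.
    have := H _ (lexx 0); rewrite W1 !mulr0 addr0 divr1; apply => b.
    rewrite mul0r; have := H0 b; rewrite mulr0 mul0r.
    have -> : qf (- hess u x) b = - qf (hess u x) b.
      by rewrite /qf mulmxN mulNmx mxE.
    by rewrite oppr_le0.
  have := cf_mono cf (a := const_mx 1) (b := l).
  rewrite (cf_diag cf ltr01) fl leNgt s1 => H.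
  suff : false by [].
  by apply: H => i; rewrite mxE.
move=> x Ox.
have cC : compact (closure O).
  apply: bounded_closed_compact; last exact: closed_closure.
  have [M [Mr MP]] := bO; exists M; split => // k Mk y cy.
  rewrite /= leNgt; apply/negP => ky.
  have : 0 < `|y| - k by rewrite subr_gt0.
  move=> e0; have [z [Oz]] := cy _ (nbhsx_ballx y _ e0).
  rewrite -ball_normE /= => yz; have zk : `|z| <= k := MP _ Mk z Oz.
  have := ler_normD (y - z) z; rewrite subrK; lra.
have [|y yC ymin] := @EVT_min_rV R n u (closure O) _ cC cu.
  by exists x; exact: subset_closure.
rewrite inE in yC.
have ymin' z : O z -> u y <= u z.
  by move=> Oz; apply: ymin; rewrite inE; exact: subset_closure.
have Oy : ~ O y by move=> Oy; exact: (nomin y Oy ymin').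
rewrite -(bu y (conj yC Oy)) lt_neqAle ymin' // andbT.
apply/negP => /eqP E; apply: (nomin x Ox) => z Oz; rewrite -E; exact: ymin'.
Qed.

Lemma MVT_ray n (A : set 'rV[R]_n) u (x z : 'rV[R]_n) (t : R) :
  smooth_on A u -> {within closure A, continuous u} -> closure A x -> 0 < t ->
  (forall r, 0 < r <= t -> A (x + r *: z)) ->
  exists2 r, 0 < r < t & u (x + t *: z) - u x = t * dotp (grad u (x + r *: z)) z.
Proof.
move=> su cu cx t0 Az.
have [|||r] := @MVT R (fun r => u (x + r *: z))
    (fun r => dotp (grad u (x + r *: z)) z) 0 t.
- exact: t0.
- move=> r; rewrite in_itv /= => /andP[r0 rt].
  apply: eps_diff_line; apply: (smooth_eps_diff [::] su).
  by apply: Az; rewrite r0 ltW.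
- apply/subspace_continuousP => r /=; rewrite in_itv /= => /andP[r0 rt].
  have cl q : 0 <= q <= t -> closure A (x + q *: z).
    move=> /andP[q0 qt]; have [->|q1] := eqVneq q 0.
      by rewrite scale0r addr0.
    by apply: subset_closure; apply: Az; rewrite lt_def q1 q0.
  have clr := cl r; rewrite r0 rt in clr.
  apply/cvgrPdist_lt => e e0.
  have /within_continuous_eps/(_ _ (clr isT) e e0)[d d0 dP] := cu.
  rewrite near_withinE; apply/nbhs_ballP.
  exists (d / (`|z| + 1)); first by rewrite /= divr_gt0 // ltr_wpDl.
  move=> q; rewrite -ball_normE /= distrC => qr; rewrite in_itv /= => qt.
  rewrite distrC; apply: dP; first exact: cl.
  rewrite opprD addrACA subrr add0r -scalerBl.
  by apply: (norm_scale_lt (K := `|z|) _ _ _ qr) => //; rewrite normrZ mulrC.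
rewrite in_itv /= => r0t; rewrite scale0r addr0 subr0 => E; exists r => //.
by rewrite E mulrC.
Qed.

Lemma sub_ray n (x N : 'rV[R]_n) (q t : R) :
  x - q *: N - (x - t *: N) = (t - q) *: N.
Proof. by rewrite opprB addrC addrA subrK scalerBl. Qed.

Section Slope.
Variables (n : nat) (O : set 'rV[R]_n) (s : R) (f : 'rV[R]_n -> R).
Hypotheses (s01 : 0 < s < 1) (cf : comparison_function f s).
Hypothesis bO : bounded_smooth_domain O.
Variable x0 : 'rV[R]_n.
Hypothesis bx0 : (closure O `\` O) x0.

(* The inner normal [N] only enters through the three facts below. *)
Lemma inner_normal : exists N : 'rV[R]_n, [/\ N != 0,
  (forall z, 0 < dotp z N -> exists c t, [/\ 0 < c, 0 < t &
     forall r w, 0 < r < t -> `|w - z| <= c -> O (x0 + r *: w)]) &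
  forall e, 0 < e -> exists2 d, 0 < d & forall x, `|x - x0| < d ->
     exists2 r, 0 < r < e & ~ O (x - r *: N)].
Proof.
have [_ [_ [_ [_ H]]]] := bO.
have [U [rho [oU [Ux0 [srho [rhoP rhoN]]]]]] := H x0 bx0.
have [cx0 nx0] := bx0.
have [i0 i0P] := rhoN x0 Ux0.
pose g := grad rho x0; pose N := - g.
have N0 : N != 0.
  rewrite oppr_eq0; apply: contra_neq i0P => /rowP/(_ i0).
  by rewrite !mxE.
have df := smooth_eps_diff [::] srho Ux0.
have rho0 : rho x0 = 0.
  apply/eqP; rewrite eq_le; apply/andP; split; last first.
    by rewrite leNgt; apply/negP => /(rhoP x0 Ux0).2.
  rewrite leNgt; apply/negP => r0.
  have [d d0 dP] := smooth_cont srho Ux0 r0.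
  have [d' d'0 d'P] := open_eps oU Ux0.
  have e0 : 0 < Num.min d d' by rewrite lt_min d0.
  have [z [Oz]] := cx0 _ (nbhsx_ballx x0 _ e0).
  rewrite -ball_normE /= distrC lt_min => /andP[z1 z2].
  have := (rhoP z (d'P z z2)).1 Oz; have := dP z z1.
  rewrite ltr_norml => /andP[H1 _]; lra.
have [d' d'0 d'P] := open_eps oU Ux0.
exists N; split => //.
  move=> z zN.
  have l0 := l1norm_ge0 g; have nz := normr_ge0 z.
  pose c := Num.min 1 (dotp z N / 2 / (l1norm g + 1)).
  have lg : 0 < l1norm g + 1 by rewrite ltr_wpDl.
  have c0 : 0 < c by rewrite lt_min ltr01 !divr_gt0.
  have zz : 0 < `|z| + 2 by lra.
  have e0 : 0 < dotp z N / 4 / (`|z| + 2) by rewrite !divr_gt0.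
  have [d d0 dP] := df _ e0.
  exists c, (Num.min d d' / (`|z| + 2)); split => //.
    by rewrite divr_gt0 // lt_min d0.
  move=> r w /andP[r0]; rewrite ltr_pdivlMr // lt_min => /andP[rd rd'] wz.
  have c1 : c <= 1 by rewrite ge_min lexx.
  have nw : `|w| <= `|z| + 1.
    rewrite -(subrK z w); apply: le_trans (ler_normD _ _) _; lra.
  have rw : `|r *: w| <= r * (`|z| + 2).
    rewrite normrZ gtr0_norm // ler_pM2l //; lra.
  apply/(rhoP _ _).
    by apply: d'P; rewrite addrC addKr; exact: le_lt_trans rw rd'.
  have := dP _ (le_lt_trans rw rd); rewrite /= rho0 subr0 -dotpE dotpZr.
  rewrite ler_norml => /andP[_ H1].
  have H2 : dotp g w <= - (dotp z N / 2).
    have -> : dotp g w = dotp g (w - z) - dotp z N.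
      by rewrite /N dotpNr (dotpC z) dotpDr dotpNr; ring.
    have : dotp g (w - z) <= dotp z N / 2.
      apply: le_trans (ler_norm _) _; apply: le_trans (dotp_le _ _) _.
      apply: le_trans (_ : (l1norm g + 1) * c <= _).
        by apply: ler_pM => //; rewrite ?lerDl // l1norm_ge0.
      by rewrite mulrC -ler_pdivlMr // /c ge_min lexx orbT.
    lra.
  have H3 : dotp z N / 4 / (`|z| + 2) * `|r *: w| <= dotp z N / 4 * r.
    rewrite -[leRHS](_ : dotp z N / 4 / (`|z| + 2) * (r * (`|z| + 2)) = _).
      by rewrite ler_pM2l.
    by field; rewrite gt_eqF.
  have := ler_wpM2l (ltW r0) H2; have := mulr_gt0 r0 zN; lra.
move=> e e0.
have NN : 0 < dotp N N.
  rewrite lt_def dotp_ge0 andbT; apply: contra_neq N0 => N0.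
  by apply: dotp_eq0; rewrite N0.
have nN : 0 < `|N| by rewrite normr_gt0.
have e1 : 0 < dotp N N / 2 / `|N| by rewrite !divr_gt0.
have [d d0 dP] := df _ e1.
pose r := Num.min (e / 2) (Num.min d d' / `|N| / 2).
have dd : 0 < Num.min d d' by rewrite lt_min d0.
have r0 : 0 < r by rewrite lt_min !divr_gt0.
have rN : r * `|N| < Num.min d d'.
  have r1 : r <= Num.min d d' / `|N| / 2 by rewrite ge_min lexx orbT.
  apply: le_lt_trans (_ : Num.min d d' / 2 < _).
    by rewrite -ler_pdivlMr // mulrAC.
  by rewrite gtr_pMr // invf_lt1 // ltr1n.
have re : r < e.
  have r1 : r <= e / 2 by rewrite ge_min lexx.
  by apply: le_lt_trans r1 _; rewrite gtr_pMr // invf_lt1 // ltr1n.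
move: rN; rewrite lt_min => /andP[rN rN'].
have nrN : `|- (r *: N)| = r * `|N| by rewrite normrN normrZ gtr0_norm.
have pos : 0 < rho (x0 - r *: N).
  have := dP (- (r *: N)); rewrite nrN => /(_ rN).
  rewrite /= rho0 subr0 -dotpE dotpNr dotpZr ler_norml => /andP[H1 _].
  move: H1; have -> : dotp N N / 2 / `|N| * (r * `|N|) = r * (dotp N N / 2).
    by field; rewrite gt_eqF.
  have -> : dotp (grad rho x0) N = - dotp N N.
    by rewrite [in RHS]/N dotpNl opprK.
  have := mulr_gt0 r0 NN; lra.
have Uy : U (x0 - r *: N).
  by apply: d'P; rewrite addrC addKr nrN.
have [d1 d10 d1P] := smooth_cont srho Uy pos.
have [d2 d20 d2P] := open_eps oU Uy.
exists (Num.min d1 d2); first by rewrite lt_min d10.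
move=> x; rewrite lt_min => /andP[x1 x2]; exists r; first by rewrite r0.
have E : x - r *: N - (x0 - r *: N) = x - x0.
  by rewrite opprB addrA subrK.
have Ux : U (x - r *: N) by apply: d2P; rewrite E.
move=> /(rhoP _ Ux).1.
have := d1P (x - r *: N); rewrite E => /(_ x1).
rewrite ltr_norml => /andP[H1 _]; lra.
Qed.

Lemma boundary_gradient u : C1_closure O u -> exists a : 'rV[R]_n,
  forall e, 0 < e -> exists2 d, 0 < d & forall x z, O x -> `|x - x0| < d ->
    `|dotp (grad u x) z - dotp a z| <= e * `|z|.
Proof.
move=> [_ cg]; have [cx0 _] := bx0.
have /choice[g gP] : forall i, exists gi : 'rV[R]_n -> R,
   {within closure O, continuous gi} /\ forall x, O x -> partial u i x = gi x by [].
exists (\row_i g i x0) => e e0.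
have en : 0 < e / n.+1%:R by rewrite divr_gt0.
have : forall i, exists d, 0 < d /\ forall x, O x -> `|x - x0| < d ->
    `|partial u i x - g i x0| <= e / n.+1%:R.
  move=> i; have [ci gE] := gP i.
  have /within_continuous_eps/(_ _ cx0 _ en)[d d0 dP] := ci.
  exists d; split => // x Ox xd; rewrite gE // ltW // dP //.
  exact: subset_closure.
move=> /choice[d dP]; exists (\big[Order.min/1]_i d i).
  by apply/bigmin_gtP; split => // i _; have [] := dP i.
move=> x z Ox xd; rewrite !dotpE -sumrB.
apply: le_trans (ler_norm_sum _ _ _) _.
apply: le_trans (_ : \sum_(i < n) e / n.+1%:R * `|z| <= _).
  apply: ler_sum => i _; rewrite !mxE -mulrBl normrM.
  apply: ler_pM => //; last exact: coord_le_norm.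
  apply: (dP i).2 => //; apply: lt_le_trans xd _; exact: bigmin_le_cond.
rewrite sumr_const card_ord -[leLHS]mulr_natl mulrA ler_wpM2r //.
by rewrite mulrCA ger_pMr // ler_pdivrMr // mul1r ler_nat.
Qed.

Section OneSolution.
Variables (u : 'rV[R]_n -> R) (a N : 'rV[R]_n).
Hypotheses (su : smooth_on O u) (cu : {within closure O, continuous u}).
Hypotheses (au : admissible O u) (eu : curv_eq f O u s) (ux0 : u x0 = 0).
Hypothesis ga : forall e, 0 < e -> exists2 d, 0 < d & forall x z, O x ->
  `|x - x0| < d -> `|dotp (grad u x) z - dotp a z| <= e * `|z|.
Hypothesis N0 : N != 0.
Hypothesis cone : forall z, 0 < dotp z N -> exists c t, [/\ 0 < c, 0 < t &
  forall r w, 0 < r < t -> `|w - z| <= c -> O (x0 + r *: w)].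

Let NN : 0 < dotp N N.
Proof.
rewrite lt_def dotp_ge0 andbT; apply: contra_neq N0 => NN.
by apply: dotp_eq0; rewrite NN.
Qed.

Let clx0 : closure O x0. Proof. by case: bx0. Qed.

Lemma boundary_grad_ge0 z : 0 < dotp z N -> 0 <= dotp a z.
Proof.
move=> zN; have [c [t [c0 t0 H]]] := cone zN.
rewrite leNgt; apply/negP => az.
have z1 : 0 < `|z| + 1 by rewrite ltr_wpDl.
have e0 : 0 < - dotp a z / (`|z| + 1) by rewrite divr_gt0 // oppr_gt0.
have [d d0 dP] := ga e0.
pose r := Num.min (t / 2) (d / (`|z| + 1) / 2).
have r0 : 0 < r by rewrite lt_min !divr_gt0.
have rt : r < t.
  have r1 : r <= t / 2 by rewrite ge_min lexx.
  by apply: le_lt_trans r1 _; rewrite gtr_pMr // invf_lt1 // ltr1n.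
have rd : r * (`|z| + 1) < d.
  have r1 : r <= d / (`|z| + 1) / 2 by rewrite ge_min lexx orbT.
  apply: le_lt_trans (_ : d / 2 < d); last by rewrite gtr_pMr // invf_lt1 // ltr1n.
  by rewrite -ler_pdivlMr // mulrAC.
have Oz q : 0 < q <= r -> O (x0 + q *: z).
  move=> /andP[q0 qr]; apply: H; first by rewrite q0 (le_lt_trans qr).
  by rewrite subrr normr0 ltW.
have [q /andP[q0 qr] E] := MVT_ray su cu clx0 r0 Oz.
have Or : O (x0 + r *: z) by apply: Oz; rewrite r0 lexx.
have [ur _] := au Or.
move: E; rewrite ux0 subr0 => E; rewrite E pmulr_rgt0 // in ur.
have Oq : O (x0 + q *: z) by apply: Oz; rewrite q0 ltW.
have qd : `|x0 + q *: z - x0| < d.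
  rewrite addrC addKr normrZ gtr0_norm //; apply: le_lt_trans rd.
  by apply: ler_pM => //; [exact: ltW|exact: ltW|rewrite lerDl].
have := dP _ z Oq qd; rewrite ler_norml => /andP[_ H1].
have : - dotp a z / (`|z| + 1) * `|z| <= - dotp a z.
  rewrite mulrAC ler_pdivrMr // ler_wpM2l ?lerDl // oppr_ge0; exact: ltW.
lra.
Qed.

(** A linear form that is nonnegative on the open half-space [z.N > 0] is a nonnegative multiple of
    [N]. *)
Lemma boundary_grad_normal : exists2 c, 0 <= c & a = c *: N.
Proof.
pose c := dotp a N / dotp N N; exists c.
  by rewrite divr_ge0 ?dotp_ge0 // boundary_grad_ge0.
pose p := a - c *: N.
have pN : dotp p N = 0.
  by rewrite /p !dotp_lin /c divfK ?subrr // gt_eqF.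
have ap : dotp a p = dotp p p.
  have -> : dotp a p = dotp (p + c *: N) p by rewrite /p subrK.
  by rewrite dotpDl dotpZl (dotpC N) pN mulr0 addr0.
suff : p = 0 by move=> /eqP; rewrite subr_eq0 => /eqP.
clearbody p.
apply: dotp_eq0; apply/ler_addgt0Pr => e e0.
have aN : 0 <= dotp a N by exact: boundary_grad_ge0.
have a1 : 0 < dotp a N + 1 by rewrite ltr_wpDl.
(* The opposite of the tangential part [p], tilted slightly into the half-space. *)
have := @boundary_grad_ge0 (- p + (e / (dotp a N + 1)) *: N).
rewrite !dotpDl !dotpDr !dotpZl !dotpZr dotpNl dotpNr pN ap oppr0 !add0r.
rewrite mulr_gt0 ?divr_gt0 // => /(_ isT).
have : e / (dotp a N + 1) * dotp a N <= e.
  by rewrite mulrAC ler_pdivrMr // ler_wpM2l ?lerDl // ltW.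
lra.
Qed.

(** [u] is only C1 up to the boundary and its Hessian has no bound there, but the curvatures involve
    only [u D^2u]. At scale [r] near the boundary point, [u] differs from its linear part by a small
    fraction of [r], so a paraboloid of opening [eta / r] touches it (from above for [sg = 1], from
    below for [sg = -1]) at a point where [u] is at most of order [r]; the scale cancels in
    [u k <= C eta]. *)
Lemma touching_test : exists C K, [/\ 0 <= C, 0 <= K &
  forall sg eta : R, sg = 1 \/ sg = -1 -> 0 < eta <= 1 -> exists x k,
  [/\ O x, 0 <= k, u x * k <= C * eta,
   `|dotp (grad u x) (grad u x) - dotp a a| <= K * eta &
   forall h, sg * qf (hess u x) h <= 2 * k * dotp h h]].
Proof.
have [c [t [c0 t0 H]]] := cone NN.
pose nN := `|N| + c; have nN0 : 0 < nN by rewrite ltr_wpDl.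
exists (l1norm a * nN + c ^+ 2), (4 * (l1norm a * c) + 4 * (n%:R * c * c)).
have la := l1norm_ge0 a.
have c2 : 0 < c ^+ 2 by rewrite exprn_gt0.
split.
- by rewrite addr_ge0 ?mulr_ge0 // ltW.
- by rewrite addr_ge0 // !mulr_ge0 // ltW.
move=> sg eta sgE /andP[eta0 eta1].
have sgn (X : R) : `|sg * X| = `|X|.
  by case: sgE => ->; rewrite ?mul1r ?mulN1r ?normrN.
have sg2 : sg * sg = 1 by case: sgE => ->; ring.
pose e := eta * c ^+ 2 / 4 / nN.
have e0 : 0 < e by rewrite !divr_gt0 // mulr_gt0.
have [d d0 dP] := ga e0.
pose r := Num.min (t / 2) (d / nN / 2).
have r0 : 0 < r by rewrite lt_min !divr_gt0.
have rt : r < t.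
  have r1 : r <= t / 2 by rewrite ge_min lexx.
  by apply: le_lt_trans r1 _; rewrite gtr_pMr // invf_lt1 // ltr1n.
have rd : r * nN < d.
  have r1 : r <= d / nN / 2 by rewrite ge_min lexx orbT.
  apply: le_lt_trans (_ : d / 2 < d); last by rewrite gtr_pMr // invf_lt1 // ltr1n.
  by rewrite -ler_pdivlMr // mulrAC.
have wn w : `|w - N| <= c -> `|w| <= nN.
  move=> wc; rewrite -(subrK N w); apply: le_trans (ler_normD _ _) _.
  by rewrite addrC lerD2l.
have Ow w q : `|w - N| <= c -> 0 < q <= r -> O (x0 + q *: w).
  by move=> wc /andP[q0 qr]; apply: H => //; rewrite q0 (le_lt_trans qr).
have est w : `|w - N| <= c ->
    `|u (x0 + r *: w) - r * dotp a w| <= r * (eta * c ^+ 2 / 4).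
  move=> wc; have [q /andP[q0 qr] E] := MVT_ray su cu clx0 r0 (fun q => Ow w q wc).
  move: E; rewrite ux0 subr0 => ->; rewrite -mulrBr normrM gtr0_norm // ler_pM2l //.
  have Oq : O (x0 + q *: w) by apply: Ow => //; rewrite q0 ltW.
  have qd : `|x0 + q *: w - x0| < d.
    rewrite addrC addKr normrZ gtr0_norm //; apply: le_lt_trans rd.
    by apply: ler_pM => //; [exact: ltW|exact: ltW|exact: wn].
  apply: le_trans (dP _ w Oq qd) _.
  have -> : eta * c ^+ 2 / 4 = e * nN by rewrite /e divfK // gt_eqF.
  by rewrite ler_pM2l // wn.
pose ps w := sg * (u (x0 + r *: w) - r * dotp a w) - r * eta * dotp (w - N) (w - N).
pose B := closed_ball N c.
have BE w : B w <-> `|w - N| <= c.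
  by rewrite /B closed_ballE // /closed_ball_ /= distrC.
have [|||w0 w0B w0max] := @EVT_max_rV R n ps B.
- by exists N; apply/BE; rewrite subrr normr0 ltW.
- apply: bounded_closed_compact; last exact: closed_ball_closed.
  exists nN; split; first exact: num_real.
  by move=> k kn w /BE/wn; move=> /le_trans; apply; exact: ltW.
- apply/subspace_continuousP => w /BE wc; apply: cvg_within_filter.
  have Oxw : O (x0 + r *: w) by apply: Ow => //; rewrite r0 lexx.
  have cline : (fun w : 'rV[R]_n => x0 + r *: w) @ nbhs w --> x0 + r *: w.
    apply: cvgD; first exact: cvg_cst.
    by apply: cvgZl_tmp; exact: cvg_id.
  have cu' : {for (x0 + r *: w), continuous u}.
    by apply: continuous_at_eps => e' e'0; exact: (smooth_cont su Oxw e'0).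
  apply: cvgB.
    apply: cvgM; first exact: cvg_cst.
    apply: cvgB; first exact: (cvg_comp _ u cline cu').
    apply: cvgM; first exact: cvg_cst.
    by apply: (cvg_dotp (p := fun _ => a) (q := id)); [exact: cvg_cst|exact: cvg_id].
  apply: cvgM; first exact: cvg_cst.
  have cN : (fun w : 'rV[R]_n => w - N) @ nbhs w --> w - N.
    by apply: cvgB; [exact: cvg_id|exact: cvg_cst].
  exact: (cvg_dotp cN cN).
rewrite inE in w0B; have w0c := (BE w0).1 w0B.
have d00 : dotp (0 : 'rV[R]_n) 0 = 0 by rewrite /dotp mul0mx mxE.
have psmax w : `|w - N| <= c -> ps w <= ps w0.
  by move=> /BE Bw; apply: w0max; rewrite inE.
(* On the boundary of the ball the penalty is at least [r eta c^2], more than twice the error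
   [r eta c^2 / 4] of [est], so the value at the centre is larger. *)
have w0lt : `|w0 - N| < c.
  rewrite lt_neqAle w0c andbT; apply/negP => /eqP E.
  have Nc : `|N - N| <= c by rewrite subrr normr0 ltW.
  have := psmax N Nc; rewrite /ps [N - N]subrr d00 mulr0 subr0.
  have H1 := est N Nc; rewrite -sgn in H1.
  have H2 := est w0 w0c; rewrite -sgn in H2.
  have H3 : r * eta * c ^+ 2 <= r * eta * dotp (w0 - N) (w0 - N).
    by rewrite ler_wpM2l ?mulr_ge0 ?(ltW r0) ?(ltW eta0) // -E dotp_norm_le.
  have H4 : 0 < r * eta * c ^+ 2 by rewrite !mulr_gt0.
  move: H1 H2; rewrite !ler_norml => /andP[H1 _] /andP[_ H2]; lra.
have Ox : O (x0 + r *: w0) by apply: Ow => //; rewrite r0 lexx.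
set x := x0 + r *: w0 in Ox.
pose z := w0 - N.
have cz : 0 < r * (c - `|z|) by rewrite mulr_gt0 // subr_gt0.
have [|||G0 H0] := @jet_max R n (fun h => sg * (u (x + h) - u x)) (sg *: grad u x)
    (sg *: a + (2 * eta) *: z) (sg *: hess u x) (eta / r) (r * (c - `|z|)).
- move=> e' e'0; have [d' d'0 d'P] := taylor2 su Ox e'0.
  exists d' => // h hd; have := d'P h hd; rewrite qf_scale dotpZl -sgn.
  move: (dotp _ _) (qf _ _) => X1 X2; congr (_ <= _); congr (`| _ |); ring.
- exact: cz.
- move=> h hr; have hc : `|w0 + r^-1 *: h - N| <= c.
    rewrite addrAC; apply: le_trans (ler_normD _ _) _.
    rewrite normrZ gtr0_norm ?invr_gt0 // -/z -lerBrDl ler_pdivrMl //.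
    exact: ltW.
  have := psmax _ hc; rewrite /ps.
  have -> : x0 + r *: (w0 + r^-1 *: h) = x + h.
    by rewrite scalerDr scalerA mulfV ?gt_eqF // scale1r addrA.
  rewrite [w0 + _ - N]addrAC -/z -/x (dotp_addZ z h r^-1).
  rewrite (dotpDr w0 (r^-1 *: h) a) (dotpZr r^-1 h a).
  rewrite (dotpDl (sg *: a) ((2 * eta) *: z) h) (dotpZl sg a h) (dotpZl (2 * eta) z h).
  move: (dotp z z) (dotp z h) (dotp h h) (dotp a w0) (dotp a h) => X1 X5 X2 X3 X4.
  have -> : r * (X3 + r^-1 * X4) = r * X3 + X4 by field; rewrite gt_eqF.
  have -> : r * eta * (X1 + 2 * r^-1 * X5 + r^-1 * r^-1 * X2) =
     r * eta * X1 + 2 * eta * X5 + eta / r * X2 by field; rewrite gt_eqF.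
  by case: sgE => ->; lra.
have z1 : `|z| <= c by exact: w0c.
exists x, (eta / r); split => //.
- by rewrite divr_ge0 ?ltW.
- rewrite mulrA ler_pdivrMr //.
  have := est w0 w0c; rewrite -/x ler_norml => /andP[_ H2].
  have H3 : dotp a w0 <= l1norm a * nN.
    apply: le_trans (ler_norm _) _; apply: le_trans (dotp_le _ _) _.
    by rewrite ler_wpM2l // wn.
  have H4 : u x <= r * (l1norm a * nN + c ^+ 2).
    have := ler_wpM2l (ltW r0) H3.
    have : r * (eta * c ^+ 2 / 4) <= r * c ^+ 2.
      rewrite ler_pM2l // -mulrA mulrCA ler_piMr ?(ltW c2) //; lra.
    lra.
  have := ler_wpM2r (ltW eta0) H4; lra.
- have gE : grad u x = a + (2 * eta * sg) *: z.
    have := congr1 (fun y => sg *: y) G0; rewrite scalerA sg2 scale1r => ->.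
    by rewrite scalerDr !scalerA sg2 scale1r; congr (_ + _ *: _); ring.
  rewrite gE (dotp_addZ a z (2 * eta * sg)).
  have -> : dotp a a + 2 * (2 * eta * sg) * dotp a z +
     2 * eta * sg * (2 * eta * sg) * dotp z z - dotp a a
     = 4 * (eta * (sg * dotp a z)) + 4 * ((sg * sg) * (eta * eta * dotp z z)) by ring.
  rewrite sg2 mul1r; apply: le_trans (ler_normD _ _) _; rewrite [leRHS]mulrDl.
  have ee : eta * eta <= eta by rewrite ler_piMr // ltW.
  have zz : dotp z z <= n%:R * c * c.
    apply: le_trans (ler_norm _) _; apply: le_trans (dotp_le _ _) _.
    apply: ler_pM => //; first exact: l1norm_ge0.
    rewrite /l1norm; apply: le_trans (_ : \sum_(i < n) c <= _).
      by apply: ler_sum => i _; apply: le_trans (coord_le_norm z i) z1.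
    by rewrite sumr_const card_ord mulr_natl.
  have p4 : 0 < 4 :> R by [].
  have Ez : `|4 * (eta * (sg * dotp a z))| = 4 * (eta * `|dotp a z|).
    have h : `|sg * dotp a z| = `|dotp a z| by first [exact: sgn | rewrite sgn].
    by rewrite normrM (gtr0_norm p4) normrM (gtr0_norm eta0) h.
  have Zz : `|4 * (eta * eta * dotp z z)| = 4 * (eta * eta * dotp z z).
    by rewrite ger0_norm // mulr_ge0 // mulr_ge0 ?dotp_ge0 // mulr_ge0 // ltW.
  have az : `|dotp a z| <= l1norm a * c.
    by apply: le_trans (dotp_le _ _) _; rewrite ler_wpM2l // l1norm_ge0.
  rewrite Ez Zz; apply: lerD.
    by rewrite -[leRHS]mulrA ler_pM2l // [leRHS]mulrC ler_pM2l.
  rewrite -[leRHS]mulrA ler_pM2l // [leRHS]mulrC.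
  apply: ler_pM => //; first by rewrite mulr_ge0 // ltW.
  exact: dotp_ge0.
by move=> h; have := H0 h; rewrite qf_scale.
Qed.

(** Where [u D^2u] is small on one side, all curvatures are bounded on that side by [1 / W] up to
    order [eta], with [W^2 = 1 + |Du|^2]. Monotonicity and [f (t, ..., t) = t] then compare [s] with
    [1 / W]; each sign of the test gives one inequality as [eta] tends to 0. *)
Lemma boundary_slope : s ^+ 2 * (1 + dotp a a) = 1.
Proof.
have [C [K [C0 K0 T]]] := touching_test.
have [s0 s1] := andP s01.
have s2 : s ^+ 2 <= 1 by rewrite exprn_ile1 // ltW.
have s20 : 0 <= s ^+ 2 := sqr_ge0 s.
(* [4 C] and [4 C^2] come from squaring [1 + 2 C eta] or [1 - 2 C eta], [K] from the error in
   [|Du|^2]; the 1 makes [D] positive. *)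
pose D := 4 * C + 4 * C ^+ 2 + K + 1.
have C2 := sqr_ge0 C.
have D0 : 0 < D by rewrite /D; lra.
have low eta : 0 < eta <= 1 -> 2 * C * eta < 1 ->
    1 - D * eta <= s ^+ 2 * (1 + dotp a a).
  move=> eta01 Ce; have [x [k [Ox k0 uk gd hs]]] := T (-1) eta (or_intror erefl) eta01.
  have [eta0 eta1] := andP eta01.
  have [u0 pu] := au Ox; have [l [cl fl]] := eu Ox.
  have W0 := slope_gt0 u x.
  have q0 : 0 < (1 - 2 * C * eta) / slope u x by rewrite divr_gt0 // subr_gt0.
  have lge i : (1 - 2 * C * eta) / slope u x <= l 0 i.
    have [L _] := curv_bounds (- k) i su Ox u0 pu cl.
    apply: le_trans (L _ _); last by rewrite oppr_le0.
      rewrite ler_pM2r ?invr_gt0 //; lra.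
    by move=> b; have := hs b; lra.
  have := cf_mono cf (a := const_mx ((1 - 2 * C * eta) / slope u x)) (b := l).
  rewrite (cf_diag cf q0) fl => cm.
  have {}cm : (1 - 2 * C * eta) / slope u x <= s.
    by apply: cm => i; rewrite mxE.
  rewrite ler_pdivrMr // in cm.
  have : (1 - 2 * C * eta) ^+ 2 <= (s * slope u x) ^+ 2.
    by rewrite ler_pXn2r ?nnegrE ?mulr_ge0 ?(ltW s0) ?(ltW W0) // subr_ge0 ltW.
  rewrite exprMn slope_sqr; move: gd; rewrite ler_norml => /andP[_ gd].
  have : s ^+ 2 * (dotp (grad u x) (grad u x) - dotp a a) <= K * eta.
    have Ke : 0 <= K * eta by rewrite mulr_ge0 // ltW.
    have [ge|lt] := leP 0 (dotp (grad u x) (grad u x) - dotp a a).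
      apply: le_trans gd; by rewrite ler_piMl.
    apply: le_trans Ke; by rewrite mulr_ge0_le0 // ltW.
  have ce : 0 <= C * eta by rewrite mulr_ge0 // ltW.
  have c2e : 0 <= C ^+ 2 * eta by rewrite mulr_ge0 // ltW.
  have := sqr_ge0 (C * eta); rewrite /D; lra.
have up eta : 0 < eta <= 1 -> s ^+ 2 * (1 + dotp a a) <= 1 + D * eta.
  move=> eta01; have [x [k [Ox k0 uk gd hs]]] := T 1 eta (or_introl erefl) eta01.
  have [eta0 eta1] := andP eta01.
  have [u0 pu] := au Ox; have [l [cl fl]] := eu Ox.
  have W0 := slope_gt0 u x.
  have ce : 0 <= C * eta by rewrite mulr_ge0 // ltW.
  have q0 : 0 < (1 + 2 * C * eta) / slope u x by rewrite divr_gt0 //; lra.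
  have lle i : l 0 i <= (1 + 2 * C * eta) / slope u x.
    have [_ L] := curv_bounds k i su Ox u0 pu cl.
    apply: le_trans (L _ k0) _; last by rewrite ler_pM2r ?invr_gt0 //; lra.
    by move=> b; have := hs b; rewrite mul1r.
  have lK := princ_curv_pos su Ox u0 pu cl.
  have := cf_mono cf (a := l) (b := const_mx ((1 + 2 * C * eta) / slope u x)) lK.
  rewrite (cf_diag cf q0) fl => cm.
  have {}cm : s <= (1 + 2 * C * eta) / slope u x.
    by apply: cm => i; rewrite mxE.
  rewrite ler_pdivlMr // in cm.
  have : (s * slope u x) ^+ 2 <= (1 + 2 * C * eta) ^+ 2.
    by rewrite ler_pXn2r ?nnegrE ?mulr_ge0 ?(ltW s0) ?(ltW W0) //; lra.
  rewrite exprMn slope_sqr; move: gd; rewrite ler_norml => /andP[gd _].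
  have : - (K * eta) <= s ^+ 2 * (dotp (grad u x) (grad u x) - dotp a a).
    have Ke : 0 <= K * eta by rewrite mulr_ge0 // ltW.
    have [ge|lt] := leP 0 (dotp (grad u x) (grad u x) - dotp a a).
      apply: le_trans (_ : 0 <= _); first by rewrite oppr_le0.
      by rewrite mulr_ge0.
    apply: le_trans gd _; by rewrite ler_niMl // ltW.
  have c2e : 0 <= C ^+ 2 * eta by rewrite mulr_ge0 // ltW.
  have : (C * eta) ^+ 2 <= C ^+ 2 * eta.
    by rewrite exprMn ler_wpM2l // expr2 ler_piMr // ltW.
  rewrite /D; lra.
apply/eqP; rewrite eq_le; apply/andP; split; apply/ler_addgt0Pr => e e0.
  pose eta := Num.min 1 (e / D).
  have eta0 : 0 < eta by rewrite lt_min ltr01 divr_gt0.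
  have eta1 : 0 < eta <= 1 by rewrite eta0 ge_min lexx.
  apply: le_trans (up _ eta1) _; rewrite lerD2l mulrC -ler_pdivlMr //.
  by rewrite ge_min lexx orbT.
pose eta := Num.min 1 (Num.min (e / D) (1 / D / 2)).
have eta0 : 0 < eta by rewrite !lt_min ltr01 !divr_gt0.
have eta1 : 0 < eta <= 1 by rewrite eta0 ge_min lexx.
have etaD : D * eta <= e.
  by rewrite mulrC -ler_pdivlMr // /eta !ge_min lexx ?orbT.
have etaC : D * eta <= 1 / 2.
  rewrite mulrC -ler_pdivlMr // mulrAC /eta !ge_min; apply/orP; right.
  by apply/orP; right; rewrite mulrAC.
have := low _ eta1; have : 2 * C * eta <= D * eta.
  rewrite ler_wpM2r ?(ltW eta0) // /D; lra.
move=> H1 H2; have : 2 * C * eta < 1 by lra.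
move=> /H2; lra.
Qed.
End OneSolution.

Lemma first_exit (x N : 'rV[R]_n) (r : R) : open O -> O x -> 0 < r ->
  ~ O (x - r *: N) -> exists2 t, 0 < t <= r &
    (closure O `\` O) (x - t *: N) /\ forall q, 0 <= q < t -> O (x - q *: N).
Proof.
move=> oO Ox r0 nr; pose S := [set q : R | 0 <= q /\ ~ O (x - q *: N)].
have Sr : S r by split => //; exact: ltW.
have hS : has_inf S by split; [exists r|exists 0 => q []].
pose t := inf S.
have t0 : 0 <= t by apply: lb_le_inf; [exists r|move=> q []].
have tr : t <= r by apply: ge_inf => //; exact: hS.2.
have before q : 0 <= q < t -> O (x - q *: N).
  move=> /andP[q0 qt]; apply: contrapT => nq.
  have : t <= q by apply: ge_inf; [exact: hS.2|split].
  by rewrite leNgt qt.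
have nt : ~ O (x - t *: N).
  move=> Ot; have [d d0 dP] := open_eps oO Ot.
  have N1 : 0 < `|N| + 1 by rewrite ltr_wpDl.
  have [q Sq qt] := inf_adherent (divr_gt0 d0 N1) hS.
  have tq : t <= q by apply: ge_inf => //; exact: hS.2.
  case: Sq => _; apply; apply: dP.
  rewrite sub_ray.
  have qt' : `|t - q| < d / (`|N| + 1).
    by rewrite distrC ger0_norm ?subr_ge0 // ltrBlDl.
  by apply: (norm_scale_lt (K := `|N|) _ _ _ qt') => //; rewrite normrZ mulrC.
have tp : 0 < t.
  rewrite lt_def t0 andbT; apply/negP => /eqP te; apply: nt.
  by rewrite te scale0r subr0.
exists t; first by rewrite tp tr.
split=> //; split => // B /nbhs_ballP[d /= d0 dB].
have N1 : 0 < `|N| + 1 by rewrite ltr_wpDl.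
pose q := Num.max 0 (t - d / (`|N| + 1) / 2).
have e0 : 0 < d / (`|N| + 1) by rewrite divr_gt0.
have qt : 0 <= q < t.
  rewrite le_max lexx /= gt_max tp /= gtrBl divr_gt0 //.
exists (x - q *: N); split; first exact: before.
apply: dB; rewrite -ball_normE /= sub_ray.
have tq : `|q - t| < d / (`|N| + 1).
  have [q0 qt'] := andP qt; rewrite distrC gtr0_norm ?subr_gt0 //.
  have : t - d / (`|N| + 1) / 2 <= q by rewrite le_max lexx orbT.
  lra.
by apply: (norm_scale_lt (K := `|N|) _ _ _ tq) => //; rewrite normrZ mulrC.
Qed.

(** The boundary gradients of [u] and [v] are nonnegative multiples of [N] of the same length by
    [boundary_slope], hence equal, and nonzero because [s < 1]. From [x] one goes back along [-N] to
    the first boundary point [y]; both functions vanish there, so the mean value theorem writes them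
    at [x] as the same [t] times numbers close to [A]. *)
Lemma boundary_ratio u v m : 1 < m ->
  smooth_on O u -> C1_closure O u -> admissible O u -> curv_eq f O u s ->
  (forall x, (closure O `\` O) x -> u x = 0) ->
  smooth_on O v -> C1_closure O v -> admissible O v -> curv_eq f O v s ->
  (forall x, (closure O `\` O) x -> v x = 0) ->
  exists2 d, 0 < d & forall x, O x -> `|x - x0| < d ->
    u x ^+ 2 + v x ^+ 2 <= 2 * m * u x * v x.
Proof.
move=> m1 su cu au eu bu sv cv av ev bv.
have [N [N0 cone exitP]] := inner_normal.
have [a ga] := boundary_gradient cu; have [b gb] := boundary_gradient cv.
have u0 := bu x0 bx0; have v0 := bv x0 bx0.
have [c c0 aE] := boundary_grad_normal su cu.1 au u0 ga N0 cone.
have [c' c'0 bE] := boundary_grad_normal sv cv.1 av v0 gb N0 cone.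
have sa := boundary_slope su cu.1 au eu u0 ga N0 cone.
have sb := boundary_slope sv cv.1 av ev v0 gb N0 cone.
have NN : 0 < dotp N N.
  rewrite lt_def dotp_ge0 andbT; apply: contra_neq N0 => NN.
  by apply: dotp_eq0; rewrite NN.
have [s0 s1] := andP s01.
have s20 : s ^+ 2 != 0 by rewrite expf_neq0 // gt_eqF.
have aabb : dotp a a = dotp b b.
  by apply: (addrI 1); apply: (mulfI s20); rewrite sa sb.
have cc : c = c'.
  move: aabb; rewrite aE bE !dotpZl !dotpZr !mulrA -!expr2.
  move=> /(mulIf (lt0r_neq0 NN)) /eqP; rewrite eqrXn2 // => /eqP //.
have cp : 0 < c.
  rewrite lt_def c0 andbT; apply/negP => /eqP ce.
  move: sa; rewrite aE ce scale0r.
  have -> : dotp (0 : 'rV[R]_n) 0 = 0 by rewrite /dotp mul0mx mxE.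
  by rewrite addr0 mulr1 => /eqP; rewrite lt_eqF // exprn_ilt1 // ltW.
pose A := c * dotp N N; have A0 : 0 < A by rewrite mulr_gt0.
have aN : dotp a N = A by rewrite aE dotpZl.
have bN : dotp b N = A by rewrite bE -cc dotpZl.
pose d1 := Num.min (A / 2) ((m - 1) * A / 4).
have m10 : 0 < m - 1 by rewrite subr_gt0.
have d10 : 0 < d1 by rewrite lt_min !divr_gt0 // mulr_gt0.
have N1 : 0 < `|N| + 1 by rewrite ltr_wpDl.
have e0 : 0 < d1 / (`|N| + 1) by rewrite divr_gt0.
have [da da0 daP] := ga _ e0; have [db db0 dbP] := gb _ e0.
pose D := Num.min da db; have D0 : 0 < D by rewrite lt_min da0.
have D2 : 0 < D / 2 / (`|N| + 1) by rewrite !divr_gt0.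
have [d d0 dP] := exitP _ D2.
exists (Num.min d (D / 2)); first by rewrite lt_min d0 divr_gt0.
move=> x Ox; rewrite lt_min => /andP[/dP[r /andP[r0 rD] nr] xD].
have [t /andP[t0 tr] [yb before]] := first_exit (smooth_open su) Ox r0 nr.
pose y := x - t *: N.
have back q : y + q *: N = x - (t - q) *: N.
  by rewrite /y -addrA; congr (_ + _); rewrite scalerBl opprB addrC.
have Oy q : 0 < q <= t -> O (y + q *: N).
  move=> /andP[q0 qt]; rewrite back; apply: before.
  by rewrite subr_ge0 qt gtrBl.
have xE : x = y + t *: N by rewrite /y subrK.
have closeN q : 0 < q < t -> `|y + q *: N - x0| < D.
  move=> /andP[q0 qt]; rewrite back addrAC; apply: le_lt_trans (ler_normB _ _) _.
  have : `|(t - q) *: N| < D / 2.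
    have tq : `|t - q| < D / 2 / (`|N| + 1).
      rewrite gtr0_norm ?subr_gt0 //; apply: le_lt_trans rD; lra.
    by apply: (norm_scale_lt (K := `|N|) _ _ _ tq) => //; rewrite normrZ mulrC.
  lra.
have small e : e <= d1 / (`|N| + 1) * `|N| -> e <= d1.
  move=> /le_trans; apply; rewrite mulrAC ler_pdivrMr // ler_wpM2l ?lerDl //.
  exact: ltW.
have cy : closure O y by case: yb.
have [q q01 Eu] := MVT_ray su cu.1 cy t0 Oy.
have [q' q'01 Ev] := MVT_ray sv cv.1 cy t0 Oy.
rewrite (bu y yb) subr0 -xE in Eu; rewrite (bv y yb) subr0 -xE in Ev.
rewrite Eu Ev; apply: (ratio_bound (A := A) (d := d1)) => //.
- exact: ltW.
- by rewrite ge_min lexx.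
- by rewrite ge_min lexx orbT.
- apply: small; rewrite -aN; apply: daP.
    by have [q1 q2] := andP q01; apply: Oy; rewrite q1 ltW.
  by have := closeN q q01; rewrite lt_min => /andP[].
apply: small; rewrite -bN; apply: dbP.
  by have [q1 q2] := andP q'01; apply: Oy; rewrite q1 ltW.
by have := closeN q' q'01; rewrite lt_min => /andP[].
Qed.
End Slope.
End Boundary.

(** * Uniqueness, by comparison in both directions *)

Section Uniqueness.
Set Implicit Arguments.
Unset Strict Implicit.
Unset Printing Implicit Defensive.
Import numFieldNormedType.Exports.
Variable R : realType.
Lemma boundary_ratio_pos n (O : set 'rV[R]_n) (u v : 'rV[R]_n -> R) eps m x0 :
  0 < eps -> 1 < m -> (closure O `\` O) x0 ->
  {within closure O, continuous u} -> {within closure O, continuous v} ->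
  u x0 = eps -> v x0 = eps ->
  exists2 d, 0 < d & forall x, O x -> `|x - x0| < d ->
    u x ^+ 2 + v x ^+ 2 <= 2 * m * u x * v x.
Proof.
move=> eps0 m1 [cx0 _] cu cv ue ve.
pose d1 := Num.min (eps / 2) ((m - 1) * eps / 4).
have m10 : 0 < m - 1 by rewrite subr_gt0.
have d10 : 0 < d1 by rewrite lt_min !divr_gt0 // mulr_gt0.
have /within_continuous_eps/(_ _ cx0 _ d10)[da da0 daP] := cu.
have /within_continuous_eps/(_ _ cx0 _ d10)[db db0 dbP] := cv.
exists (Num.min da db); first by rewrite lt_min da0.
move=> x Ox; rewrite lt_min => /andP[xa xb].
have cx : closure O x by exact: subset_closure.
have := @ratio_bound R m eps 1 (u x) (v x) d1 m1 eps0 ler01.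
rewrite !mul1r; apply.
- by rewrite ge_min lexx.
- by rewrite ge_min lexx orbT.
- by rewrite -ue ltW // daP.
- by rewrite -ve ltW // dbP.
Qed.

Lemma comparison_uniqueness n (f : 'rV[R]_n -> R) O s : 0 < s < 1 ->
  comparison_function f s -> bounded_smooth_domain O ->
  uniqueness_a f O s /\ (forall eps, 0 < eps -> uniqueness_b f O s eps).
Proof.
move=> s01 cf bO; have [s0 s1] := andP s01; have bdO := bO.1.
split=> [u v [su [cu [au [eu bu]]]] [sv [cv [av [ev bv]]]] x Ox|
         eps eps0 u v [su [[cu _] [au [eu bu]]]] [sv [[cv _] [av [ev bv]]]] x Ox].
  have up := admissible_above_boundary s1 cf bdO su cu.1 au eu bu.
  have vp := admissible_above_boundary s1 cf bdO sv cv.1 av ev bv.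
  apply/eqP; rewrite eq_le; apply/andP; split.
    apply: (comparison_principle (lexx 0) cf sv su av au bdO cu.1 bu vp up ev eu _ Ox).
    by move=> m x0 m1 bx0; exact: (boundary_ratio s01 cf bO bx0 m1 sv cv av ev bv su cu au eu bu).
  apply: (comparison_principle (lexx 0) cf su sv au av bdO cv.1 bv up vp eu ev _ Ox).
  by move=> m x0 m1 bx0; exact: (boundary_ratio s01 cf bO bx0 m1 su cu au eu bu sv cv av ev bv).
have up := admissible_above_boundary s1 cf bdO su cu au eu bu.
have vp := admissible_above_boundary s1 cf bdO sv cv av ev bv.
apply/eqP; rewrite eq_le; apply/andP; split.
  apply: (comparison_principle (ltW eps0) cf sv su av au bdO cu bu vp up ev eu _ Ox).
  by move=> m x0 m1 bx0; exact: (boundary_ratio_pos eps0 m1 bx0 cv cu (bv x0 bx0) (bu x0 bx0)).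
apply: (comparison_principle (ltW eps0) cf su sv au av bdO cv bv up vp eu ev _ Ox).
by move=> m x0 m1 bx0; exact: (boundary_ratio_pos eps0 m1 bx0 cu cv (bu x0 bx0) (bv x0 bx0)).
Qed.
End Uniqueness.

Theorem theorem1p6 (R : realType) (n : nat) (hn : (0 < n)%N) :
  (forall f : 'rV[R]_n -> R,
     structure_conditions f -> extra_condition f ->
     forall (O : set 'rV[R]_n) (s : R),
       bounded_smooth_domain O -> 0 < s < 1 ->
       uniqueness_a f O s /\ (forall eps : R, 0 < eps -> uniqueness_b f O s eps))
  /\
  (forall k : nat, (k = n.-1 \/ ((1 < n)%N /\ k = n.-2)) ->
     forall (O : set 'rV[R]_n) (s : R),
       bounded_smooth_domain O -> 0 < s < 1 ->
       uniqueness_a (Hquot k) O s /\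
       (forall eps : R, 0 < eps -> uniqueness_b (Hquot k) O s eps)).
Proof.
split=> [f sf ef O s bO s01|k kE O s bO s01].
  exact: comparison_uniqueness s01 (structure_comparison s01 sf ef) bO.
exact: comparison_uniqueness s01 (Hquot_comparison hn kE s01) bO.
Qed.
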